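(* Let $m,n\in\mathbb{N}$ be positive integers and let $T_m$ be an $m$-th Calderón-Zygmund type singular integral on $\mathbb{R}^n$. Let $x_0\in\mathbb{R}^n$ and let $1<p,p_i,q_i<\infty$ ($i=1,\dots,m$) be such that $1/p=1/p_1+1/p_2+\dots+1/p_m+1/q_1+1/q_2+\dots+1/q_m$. Let $b_i\in LC^{\{x_0\}}_{q_i,\lambda_i}$ with $0<\lambda_i<1/n$, $i=1,\dots,m$, and let $T_m^{\vec b}$ be the commutator generated by $T_m$ and $\vec b=(b_1,\dots,b_m)$. Suppose that the positive measurable functions $\psi,\varphi_1,\dots,\varphi_m:\mathbb{R}^n\times(0,\infty)\to(0,\infty)$ satisfy, for all $r>0$, $$\int_r^\infty\left(1+\ln\frac tr\right)^m t^{\,n\sum_{i=1}^m\lambda_i-n\sum_{i=1}^m1/p_i-1}\;\operatorname*{ess\,inf}_{t<s<\infty}\prod_{i=1}^m\left[\varphi_i(x_0,s)s^{n/p_i}\right]dt\le C\,\psi(x_0,r),$$ where the constant $C>0$ does not depend on $r$. Then the operator $T_m^{\vec b}$ is bounded from the product space $LM^{\{x_0\}}_{p_1,\varphi_1}\times LM^{\{x_0\}}_{p_2,\varphi_2}\times\dots\times LM^{\{x_0\}}_{p_m,\varphi_m}$ to $LM^{\{x_0\}}_{p,\psi}$. Moreover, there is a constant $C'>0$, independent of $b_1,\dots,b_m$ and $f_1,\dots,f_m$, such that $$\|T_m^{\vec b}(f_1,\dots,f_m)\|_{LM^{\{x_0\}}_{p,\psi}}\le C'\prod_{i=1}^m\|b_i\|_{LC^{\{x_0\}}_{q_i,\lambda_i}}\prod_{i=1}^m\|f_i\|_{LM^{\{x_0\}}_{p_i,\varphi_i}}$$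 for all $f_i\in LM^{\{x_0\}}_{p_i,\varphi_i}$, $i=1,\dots,m$.
   Context: $B(x_0,r)$ is the ball in $\mathbb{R}^n$ with center $x_0$ and radius $r$. **Generalized local Morrey space.** For a positive measurable function $\varphi(x,r)$ on $\mathbb{R}^n\times(0,\infty)$, $1\le p\le\infty$ and fixed $x_0\in\mathbb{R}^n$, $LM^{\{x_0\}}_{p,\varphi}$ is the space of all $f\in L^p_{loc}(\mathbb{R}^n)$ with $$\|f\|_{LM^{\{x_0\}}_{p,\varphi}}=\sup_{r>0}\varphi(x_0,r)^{-1}|B(x_0,r)|^{-1/p}\|f\|_{L^p(B(x_0,r))}<\infty.$$ **Local Campanato space.** For $1\le q<\infty$, $0\le\lambda<1/n$ and $x_0\in\mathbb{R}^n$, $LC^{\{x_0\}}_{q,\lambda}$ is the space of all $f\in L^q_{loc}(\mathbb{R}^n)$ with $$\|f\|_{LC^{\{x_0\}}_{q,\lambda}}=\sup_{r>0}\left(\frac{1}{|B(x_0,r)|^{1+\lambda q}}\int_{B(x_0,r)}|f(y)-f_{B(x_0,r)}|^q\,dy\right)^{1/q}<\infty,\qquad f_{B(x_0,r)}=\frac{1}{|B(x_0,r)|}\int_{B(x_0,r)}f(y)\,dy.$$ **$m$-th Calderón-Zygmund type singular integral.** Let $K(y_0,y_1,\dots,y_m)$ be a function defined away from the diagonal $y_0=y_1=\dots=y_m$ in $(\mathbb{R}^n)^{m+1}$ such that, for some $C>0$ and $\epsilon>0$, $$|K(y_0,y_1,\dots,y_m)|\le \frac{C}{\left(\sum_{k,l=0}^m|y_k-y_l|\right)^{mn}}$$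 for all $(y_0,\dots,y_m)$ away from the diagonal, and $$|K(y_0,\dots,y_i,\dots,y_m)-K(y_0,\dots,y_i',\dots,y_m)|\le \frac{C|y_i-y_i'|^{\epsilon}}{\left(\sum_{k,l=0}^m|y_k-y_l|\right)^{mn+\epsilon}}$$ whenever $0\le i\le m$ and $|y_i-y_i'|\le \frac12\max_{0\le k\le m}|y_i-y_k|$. An $m$-th Calderón-Zygmund type singular integral is an $m$-linear operator $T_m$, initially defined on the $m$-fold product of the Schwartz space $\mathcal{S}(\mathbb{R}^n)$ with values in the tempered distributions $\mathcal{S}'(\mathbb{R}^n)$, such that $$T_m(f_1,\dots,f_m)(x)=\int_{(\mathbb{R}^n)^m}K(x,y_1,\dots,y_m)f_1(y_1)\cdots f_m(y_m)\,dy_1\cdots dy_m$$ whenever $f_1,\dots,f_m$ are smooth with compact support and $x\notin\bigcap_{i=1}^m \mathrm{supp} f_i$. Standing fact about such operators: for all $1<s_1,\dots,s_m<\infty$ and $1/s=1/s_1+\dots+1/s_m$, $T_m$ extends to a bounded operator $L^{s_1}\times\dots\times L^{s_m}\to L^s$, i.e. $\|T_m(f_1,\dots,f_m)\|_{L^s}\le C\prod_i\|f_i\|_{L^{s_i}}$. **Commutator.** For locally integrable $b_1,\dots,b_m$, the commutator is (formally) $$T_m^{\vec b}(f_1,\dots,f_m)(x)=\int_{(\mathbb{R}^n)^m}K(x,y_1,\dots,y_m)\prod_{i=1}^m\big(b_i(x)-b_i(y_i)\big)f_i(y_i)\,dy_1\cdots dy_m.$$ It is understood as follows. For compactly supported $f_i\in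 L^{p_i}$, expand the product: $T_m^{\vec b}(f_1,\dots,f_m)(x)=\sum_{\sigma\subseteq\{1,\dots,m\}}(-1)^{|\sigma|}\prod_{i\notin\sigma}b_i(x)\,T_m(h_1^\sigma,\dots,h_m^\sigma)(x)$, where $h_i^\sigma=b_if_i$ if $i\in\sigma$ and $h_i^\sigma=f_i$ if $i\notin\sigma$, and $T_m$ is the bounded extension. For $f_i\in L^{p_i}_{loc}$ and any $r>0$, put $B=B(x_0,r)$, $2B=B(x_0,2r)$, $f_i^0=f_i\chi_{2B}$, $f_i^\infty=f_i\chi_{(2B)^c}$; on $B$, $T_m^{\vec b}(f_1,\dots,f_m)$ means $T_m^{\vec b}(f_1^0,\dots,f_m^0)$ plus the sum, over all other choices $(\alpha_1,\dots,\alpha_m)\in\{0,\infty\}^m$, of the integrals $\int K(x,y_1,\dots,y_m)\prod_i(b_i(x)-b_i(y_i))f_i^{\alpha_i}(y_i)\,dy_1\cdots dy_m$, which converge absolutely for a.e. $x\in B$ under the hypotheses of the claim. *)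

(* Defs.v *)
From HB Require Import structures.
From mathcomp Require Import all_boot all_order all_algebra.
From mathcomp Require Import all_classical all_reals all_analysis ess_sup_inf.

Set Implicit Arguments.
Unset Strict Implicit.
Unset Printing Implicit Defensive.

Import Order.TTheory GRing.Theory Num.Theory.
Import numFieldNormedType.Exports.

Local Open Scope classical_set_scope.
Local Open Scope ring_scope.

(* The proofs are arguments so that the instances below can be inferred. *)
Section image_measure.
Context d d' (T : measurableType d) (T' : measurableType d') (R : realType).
Variable mu : {sigma_finite_measure set T -> \bar R}.

Definition image_measure (f : T -> T') (g : T' -> T)
    (mf : measurable_fun setT f) (mg : measurable_fun setT g)
    (fK : cancel f g) : set T' -> \bar R := pushforward mu f.

Variables (f : T -> T') (g : T' -> T).
Hypotheses (mf : measurable_fun setT f) (mg : measurable_fun setT g).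
Hypothesis fK : cancel f g.
Local Notation nu := (image_measure mf mg fK).

Let nu0 : nu set0 = 0%E.
Proof. by rewrite /image_measure /pushforward preimage_set0 measure0. Qed.

Let nu_ge0 A : (0 <= nu A)%E.
Proof. exact: measure_ge0. Qed.

Let nu_sigma_additive : semi_sigma_additive nu.
Proof. exact: (@measure_semi_sigma_additive _ _ _
  (measure_function_pushforward__canonical__measure_function_Measure mu mf)). Qed.

HB.instance Definition _ := isMeasure.Build _ _ _ nu nu0 nu_ge0 nu_sigma_additive.

Let nu_sigma_finite : sigma_finite setT nu.
Proof.
have [F FT Foo] := sigma_finiteT mu.
exists (fun i => g @^-1` F i) => [|i].
  by rewrite -preimage_bigcup -FT preimage_setT.
have [mF muF] := Foo i; split; first by rewrite -[X in measurable X]setTI; exact: mg.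
rewrite /image_measure /pushforward -comp_preimage.
by rewrite (_ : g \o f = id) //; apply/funext => x /=; rewrite fK.
Qed.

HB.instance Definition _ := Measure_isSigmaFinite.Build _ _ _ nu nu_sigma_finite.

End image_measure.

(* mu \x nu, named so that its sigma-finiteness can be inferred: instance
   resolution on \x itself stops at subprobability measures. *)
Section sf_product.
Context d d' (T : measurableType d) (T' : measurableType d') (R : realType).
Variable mu : {sigma_finite_measure set T -> \bar R}.
Variable nu : {sigma_finite_measure set T' -> \bar R}.

Definition sf_product : set (T * T') -> \bar R := (mu \x nu)%E.

HB.instance Definition _ := Measure.copy sf_product (mu \x nu)%E.

Let sf_product_sigma_finite : sigma_finite setT sf_product.
Proof.
have /sigma_finiteP[F [TF ndF Foo]] := sigma_finiteT mu.
have /sigma_finiteP[G [TG ndG Goo]] := sigma_finiteT nu.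
exists (fun n => F n `*` G n).
  rewrite -setXTT TF TG predeqE => -[x y]; split.
    move=> [/= [n _ Fnx] [k _ Gky]]; exists (maxn n k) => //; split.
    - by move: x Fnx; exact/subsetPset/ndF/leq_maxl.
    - by move: y Gky; exact/subsetPset/ndG/leq_maxr.
  by move=> [n _ []/= ? ?]; split; exists n.
move=> k; have [? ?] := Foo k; have [? ?] := Goo k.
split; first exact: measurableX.
by rewrite /sf_product product_measure1E// lte_mul_pinfty// ge0_fin_numE.
Qed.

HB.instance Definition _ :=
  Measure_isSigmaFinite.Build _ _ _ sf_product sf_product_sigma_finite.

End sf_product.

Section tuple_measure.
Context d (T : measurableType d) (R : realType).

Definition tcons n (z : T * n.-tuple T) : n.+1.-tuple T := [tuple of z.1 :: z.2].
Definition tuncons n (t : n.+1.-tuple T) : T * n.-tuple T :=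
  (thead t, [tuple of behead t]).

Lemma measurable_tcons n : measurable_fun setT (@tcons n).
Proof. exact: measurable_cons. Qed.

Lemma measurable_tuncons n : measurable_fun setT (@tuncons n).
Proof.
apply: measurable_fun_pair; last exact: measurable_behead.
exact: measurable_tnth.
Qed.

Lemma tconsK n : cancel (@tcons n) (@tuncons n).
Proof. by move=> [x t]; congr pair; apply/val_inj. Qed.

(* The n-fold product measure mu x ... x mu. *)
Fixpoint tuple_measure (mu : {sigma_finite_measure set T -> \bar R}) n :
    {sigma_finite_measure set (n.-tuple T) -> \bar R} :=
  if n is n'.+1 then
    image_measure (sf_product mu (tuple_measure mu n'))
      (@measurable_tcons n') (@measurable_tuncons n') (@tconsK n')
  else \d_([tuple] : 0.-tuple T).

Lemma tuple_measure_box mu n (A : 'I_n -> set T) :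
  (forall i, measurable (A i)) ->
  tuple_measure mu n [set t | forall i, A i (tnth t i)] =
  \big[*%E/1%E]_(i < n) mu (A i).
Proof.
elim: n A => [|n ih] A mA.
  rewrite big_ord0 /= (_ : [set t | _] = setT) ?diracT//.
  by rewrite -subTset => t _ [].
have mB : measurable [set t : n.-tuple T | forall i, A (lift ord0 i) (tnth t i)].
  rewrite (_ : [set t | _] =
    \big[setI/setT]_(i < n) ((@tnth n T ^~ i) @^-1` A (lift ord0 i))).
    apply: bigsetI_measurable => i _.
    by rewrite -[X in measurable X]setTI; exact: measurable_tnth.
  apply/seteqP; split=> [t /= tA|t].
    by rewrite -bigcap_seq => i _; exact: tA.
  by rewrite -bigcap_seq => tA i; apply: tA => /=; rewrite mem_index_enum.
rewrite big_ord_recl /= /image_measure /pushforward.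
rewrite (_ : _ @^-1` _ =
    A ord0 `*` [set t : n.-tuple T | forall i, A (lift ord0 i) (tnth t i)]).
  by rewrite -(ih (fun i => A (lift ord0 i)))//; exact: product_measure1E.
apply/seteqP; split=> [[x t] /= xtA|[x t] [/= xA tA] i].
  split; first exact: xtA ord0.
  by move=> i; have := xtA (lift ord0 i); rewrite tnthS.
by have [j ->|->] := unliftP ord0 i; rewrite ?tnthS.
Qed.

End tuple_measure.

(* R^n is 'rV[R]_n, with the Borel sigma-algebra, generated by the coordinates. *)
Section euclidean_space.
Context (R : realType) (n : nat).
Local Notation Rn := 'rV[R]_n.

Definition row_coord (i : 'I_n) (x : Rn) : measurableTypeR R := x ord0 i.

Let row_set0 : g_sigma_preimage row_coord set0.
Proof. exact: sigma_algebra0. Qed.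

Let row_setC A : g_sigma_preimage row_coord A -> g_sigma_preimage row_coord (~` A).
Proof. exact: sigma_algebraC. Qed.

Let row_bigcup (F : (set Rn)^nat) : (forall i, g_sigma_preimage row_coord (F i)) ->
  g_sigma_preimage row_coord (\bigcup_i F i).
Proof. exact: sigma_algebra_bigcup. Qed.

HB.instance Definition _ := @isMeasurable.Build default_measure_display
  Rn (g_sigma_preimage row_coord) row_set0 row_setC row_bigcup.

Definition row_of_tuple (t : n.-tuple (measurableTypeR R)) : Rn := \row_i tnth t i.
Definition tuple_of_row (x : Rn) : n.-tuple (measurableTypeR R) :=
  [tuple x ord0 i | i < n].

Lemma row_of_tupleK : cancel row_of_tuple tuple_of_row.
Proof. by move=> t; apply: eq_from_tnth => i; rewrite tnth_mktuple mxE. Qed.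

Lemma measurable_row_of_tuple : measurable_fun setT row_of_tuple.
Proof.
have P : g_sigma_preimage (fun i => row_coord i \o row_of_tuple) `<=` measurable.
  rewrite (_ : (fun i => _) = fun i => @tnth n (measurableTypeR R) ^~ i) //.
  by apply/funext => i; apply/funext => t /=; rewrite /row_coord mxE.
by move=> _ A mA; apply: P; rewrite g_sigma_preimage_comp; exists A.
Qed.

Lemma measurable_tuple_of_row : measurable_fun setT tuple_of_row.
Proof.
apply/measurable_fun_tnthP => i _ Y mY.
rewrite (_ : _ \o _ = row_coord i); last first.
  by apply/funext => x /=; rewrite tnth_mktuple.
apply: sub_sigma_algebra; rewrite -bigcup_seq/=.
by exists i => /=; [rewrite mem_index_enum|exists Y].
Qed.

Definition lebesgueRn : {sigma_finite_measure set Rn -> \bar R} :=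
  image_measure (tuple_measure (@lebesgue_measure R) n)
    measurable_row_of_tuple measurable_tuple_of_row row_of_tupleK.

Lemma lebesgueRn_box (A : 'I_n -> set (measurableTypeR R)) :
  (forall i, measurable (A i)) ->
  lebesgueRn [set x | forall i, A i (x ord0 i)] =
  \big[*%E/1%E]_(i < n) lebesgue_measure (A i).
Proof.
move=> mA; rewrite -tuple_measure_box// /lebesgueRn /= /image_measure /pushforward.
congr (tuple_measure _ _ _); apply/seteqP.
by split=> t /= tA i; have := tA i; rewrite mxE.
Qed.

End euclidean_space.

Section spaces.
Context (R : realType) (n : nat).
Local Notation Rn := 'rV[R]_n.
Local Notation mu := (@lebesgueRn R n).
Implicit Types (x : Rn) (f : Rn -> R) (p q lam r : R).

(* The norm that 'rV[R]_n carries in the library is the sup norm. *)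
Definition enorm x : R := Num.sqrt (\sum_(i < n) x ord0 i ^+ 2).

Definition eball (x0 : Rn) r : set Rn := [set y | enorm (y - x0) < r].

Definition vol (x0 : Rn) r : R := fine (mu (eball x0 r)).

Definition in_Lp p f : Prop :=
  measurable_fun setT f /\ (Lnorm mu p%:E (EFin \o f) < +oo)%E.

Definition in_Lp_loc p f : Prop :=
  measurable_fun setT f /\
  forall A : set Rn, compact A -> (\int[mu]_(y in A) (`|f y| `^ p)%:E < +oo)%E.

Definition morrey_norm p (phi : Rn -> R -> R) (x0 : Rn) f : \bar R :=
  ereal_sup [set (((phi x0 r)^-1 * vol x0 r `^ (- p^-1))%:E *
                  Lnorm mu p%:E (EFin \o (f \_ (eball x0 r))))%E
            | r in [set r | 0 < r]].

Definition in_LM p (phi : Rn -> R -> R) (x0 : Rn) f : Prop :=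
  in_Lp_loc p f /\ (morrey_norm p phi x0 f < +oo)%E.

Definition ball_mean f (x0 : Rn) r : R :=
  (vol x0 r)^-1 * \int[mu]_(y in eball x0 r) f y.

Definition campanato_norm q lam (x0 : Rn) f : \bar R :=
  ereal_sup [set ((((vol x0 r `^ (1 + lam * q))^-1)%:E *
                   \int[mu]_(y in eball x0 r) (`|f y - ball_mean f x0 r| `^ q)%:E)
                  `^ q^-1)%E
            | r in [set r | 0 < r]].

Definition in_LC q lam (x0 : Rn) f : Prop :=
  in_Lp_loc q f /\ (campanato_norm q lam x0 f < +oo)%E.

(* Iterated partial derivatives, in the directions listed in s. *)
Fixpoint partials (s : seq 'I_n) f : Rn -> R :=
  if s is i :: s' then fun x => 'D_(delta_mx ord0 i) (partials s' f) x else f.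

Definition smooth f : Prop := forall s x, differentiable (partials s f) x.

Definition supp f : set Rn := closure [set x | f x != 0].

Definition test_function f : Prop := smooth f /\ compact (supp f).

Definition monomial (a : seq 'I_n) x : R := \prod_(i <- a) x ord0 i.

Definition schwartz f : Prop :=
  smooth f /\
  forall a s, exists M : R, forall x, `|monomial a x * partials s f x| <= M.

(* Continuity of u on the Schwartz space: u is bounded by a multiple of finitely
   many of the seminorms sup_x |x^a d^s f(x)|. *)
Definition tempered_distribution (u : (Rn -> R) -> R) : Prop :=
  (forall a f g, schwartz f -> schwartz g -> u (a \*o f \+ g) = a * u f + u g) /\
  exists (N : nat) (C : R), forall f (M : R), schwartz f ->
    (forall a s, (size a <= N)%N -> (size s <= N)%N ->
       forall x, `|monomial a x * partials s f x| <= M) ->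
    `|u f| <= C * M.

End spaces.

Section calderon_zygmund.
Context (R : realType) (n m : nat).
Local Notation Rn := 'rV[R]_n.
Local Notation mu := (@lebesgueRn R n).
Local Notation mum := (tuple_measure mu m).
Implicit Types (f b : 'I_m -> Rn -> R).

Definition update f (i : 'I_m) (g : Rn -> R) : 'I_m -> Rn -> R :=
  fun j => if j == i then g else f j.

Definition off_diagonal (y : m.+1.-tuple Rn) : Prop :=
  exists k l, tnth y k != tnth y l.

Definition sum_dist (y : m.+1.-tuple Rn) : R :=
  \sum_(k < m.+1) \sum_(l < m.+1) enorm (tnth y k - tnth y l).

Definition CZ_kernel (K : m.+1.-tuple Rn -> R) : Prop :=
  exists C eps : R, [/\ 0 < C, 0 < eps,
    forall y, off_diagonal y -> `|K y| <= C / sum_dist y ^+ (m * n)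
  & forall (i : 'I_m.+1) (y y' : m.+1.-tuple Rn), off_diagonal y ->
      (forall k, k != i -> tnth y' k = tnth y k) ->
      enorm (tnth y i - tnth y' i) <=
        2^-1 * \big[Num.max/0]_(k < m.+1) enorm (tnth y i - tnth y k) ->
      `|K y - K y'| <= C * enorm (tnth y i - tnth y' i) `^ eps /
                       sum_dist y `^ ((m * n)%:R + eps)].

(* T f phi is the pairing of the distribution T(f_1, ..., f_m) with phi. That
   T(f_1, ..., f_m) is given by the kernel at the x outside of the intersection
   of the supports is an identity of distributions on that open set. *)
Definition CZ_integral (K : m.+1.-tuple Rn -> R)
    (T : ('I_m -> Rn -> R) -> (Rn -> R) -> R) : Prop :=
  [/\ CZ_kernel K,
      forall f, (forall i, schwartz (f i)) -> tempered_distribution (T f),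
      forall f i (a : R) (g : Rn -> R) phi,
        (forall j, schwartz (f j)) -> schwartz g -> schwartz phi ->
        T (update f i (a \*o f i \+ g)) phi = a * T f phi + T (update f i g) phi
    & forall f phi, (forall i, test_function (f i)) -> test_function phi ->
        supp phi `<=` ~` (\bigcap_i supp (f i)) ->
        T f phi =
          \int[mu]_x (phi x *
            \int[mum]_y (K [tuple of x :: y] * \prod_(i < m) f i (tnth y i)))].

(* The bounded extensions to the various L^{s_1} x ... x L^{s_m} agree on the
   intersections, so that one Te serves for all exponents; s0 may be below 1. *)
Definition bounded_extension (T : ('I_m -> Rn -> R) -> (Rn -> R) -> R)
    (Te : ('I_m -> Rn -> R) -> Rn -> R) : Prop :=
  (forall f phi, (forall i, schwartz (f i)) -> schwartz phi ->
     mu.-integrable setT (EFin \o (Te f \* phi)) /\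
     T f phi = \int[mu]_x (Te f x * phi x)) /\
  forall s : 'I_m -> R, (forall i, 1 < s i) ->
    (forall f i (a : R) (g : Rn -> R), (forall j, in_Lp (s j) (f j)) -> in_Lp (s i) g ->
       {ae mu, forall x,
         Te (update f i (a \*o f i \+ g)) x = a * Te f x + Te (update f i g) x}) /\
    let s0 := (\sum_(i < m) (s i)^-1)^-1 in
    exists C : R, forall f, (forall i, in_Lp (s i) (f i)) ->
      in_Lp s0 (Te f) /\
      (Lnorm mu s0%:E (EFin \o Te f) <=
       (C * \prod_(i < m) fine (Lnorm mu (s i)%:E (EFin \o f i)))%:E)%E.

(* The commutator for compactly supported f_i. *)
Definition commutator_cpt (Te : ('I_m -> Rn -> R) -> Rn -> R) b f (x : Rn) : R :=
  \sum_(sigma : {set 'I_m}) (-1) ^+ #|sigma| * (\prod_(i | i \notin sigma) b i x) *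
    Te (fun i => if i \in sigma then b i \* f i else f i) x.

Definition commutator_integrand (K : m.+1.-tuple Rn -> R) b f (x : Rn)
    (y : m.-tuple Rn) : R :=
  K [tuple of x :: y] *
  \prod_(i < m) ((b i x - b i (tnth y i)) * f i (tnth y i)).

(* f_i^oo for i in alpha, f_i^0 for the other i. *)
Definition split_at (x0 : Rn) (r : R) (alpha : {set 'I_m}) f (i : 'I_m) : Rn -> R :=
  if i \in alpha then f i \_ (~` eball x0 (2 * r)) else f i \_ (eball x0 (2 * r)).

(* F is T^b(f_1, ..., f_m): a single function on R^n, determined almost
   everywhere, whose restriction to each ball B(x0, r) is a.e. given by the
   splitting along B(x0, 2r), with absolutely convergent integrals. *)
Definition is_commutator (K : m.+1.-tuple Rn -> R)
    (Te : ('I_m -> Rn -> R) -> Rn -> R) (x0 : Rn) b f (F : Rn -> R) : Prop :=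
  measurable_fun setT F /\
  forall r : R, 0 < r -> {ae mu, forall x, eball x0 r x ->
    (forall alpha : {set 'I_m}, alpha != finset.set0 ->
       mum.-integrable setT
         (EFin \o commutator_integrand K b (split_at x0 r alpha f) x)) /\
    F x = commutator_cpt Te b (split_at x0 r finset.set0 f) x +
          \sum_(alpha : {set 'I_m} | alpha != finset.set0)
            \int[mum]_y commutator_integrand K b (split_at x0 r alpha f) x y}.

End calderon_zygmund.

Section weights.
Context (R : realType).
Local Notation lambda := (@lebesgue_measure R).

Definition measurable_weight n (phi : 'rV[R]_n -> R -> R) : Prop :=
  measurable_fun ([set: 'rV[R]_n] `*` [set r : R | 0 < r])
    (fun z : 'rV[R]_n * R => phi z.1 z.2).

Definition ess_inf_after (g : R -> R) (t : R) : \bar R :=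
  ess_inf (mrestr lambda (measurable_itv `]t, +oo[)) (EFin \o g).

End weights.

(* Main.v *)
(* On B = B(x0, r) the commutator splits into a local part, built from the f_i
   restricted to 2B, and an integral over the y with some y_i outside of 2B. The
   commutator does not change when each b_i is replaced by b_i - (b_i)_B, so the
   local part is controlled by the boundedness of the extension, Hoelder's
   inequality and the Campanato norms. In the rest, cutting the space along the
   dyadic balls B(x0, 2^j r) bounds the integral by a product of oscillations of
   the b_i at x times
     sum_j (j+3)^m t_j^e prod_i ||f_i||_{L^(p_i)(B(x0, t_j))},  t_j = 2^(j+2) r,
   where e = n sum lambda_i - n sum 1/p_i and j comes from telescoping the means
   of b_i over the dyadic balls. The norms of the f_i on B(x0, t_j) are at most
   those on B(x0, s) for all s > t_j, which the Morrey norms bound by the product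
   under the essential infimum, so the sum is dominated by the weight integral.

   For the local expressions to define a single function they must agree on
   nested balls. This needs the kernel representation of the extension for merely
   L^s data with bounded support, one of which vanishes near x. It is known for
   smooth bumps, as an identity of distributions, and is carried to indicators of
   boxes by monotone limits, to bounded functions by a monotone class argument in
   each variable, and to L^s by truncation. *)
Require Import Defs.
From mathcomp Require Import all_boot all_order all_algebra.
From mathcomp Require Import all_classical all_reals all_analysis ess_sup_inf measurable_realfun.
From mathcomp Require Import ring lra.

Set Implicit Arguments.
Unset Strict Implicit.
Unset Printing Implicit Defensive.

Import Order.TTheory GRing.Theory Num.Theory.
Import numFieldNormedType.Exports.

Local Open Scope classical_set_scope.
Local Open Scope ring_scope.

(** * Smooth bumps on boxes *)

(** The condition [p > 1] says that the sum of all [1/p_i + 1/q_i] is below 1. For each [i], [f_i]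
    and [b_i f_i] then lie locally in a common space with exponent above 1, and the values of the
    extension have exponent at least 1: they are locally integrable, an identity of distributions
    becomes one of functions, and Minkowski's inequality is available. The kernel is known only off
    the diagonal, where it is continuous; it is extended by 0, which changes no integral that
    occurs, since the integrands vanish unless some variable is away from [x]. The factor
    [prod_i (b_i(x) - b_i(y_i))] is the same for every choice of near and far parts, so all the far
    integrals are gathered in a single one, and one estimate gives both their convergence and their
    size. A commutator has to be one function for all radii: its value at [x] is taken on a ball
    around [x0] of integer radius that contains [x], and comparing the radii involves only countably
    many null sets. The local part needs no weight estimate of its own, being dominated by the first
    term of the dyadic sum. *)

Section smooth_step.
Context {R : realType}.

(* The factors x^-j make the family stable under differentiation. *)
Definition smooth_step (j : nat) (x : R) : R :=
  if 0 < x then x^-1 ^+ j * expR (- x^-1) else 0.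

Lemma smooth_step_le0 j x : x <= 0 -> smooth_step j x = 0.
Proof. by rewrite /smooth_step ltNge => ->. Qed.

Lemma smooth_step_gt0 j x : 0 < x -> 0 < smooth_step j x.
Proof. by move=> x0; rewrite /smooth_step x0 mulr_gt0 ?exprn_gt0 ?invr_gt0 ?expR_gt0. Qed.

Lemma smooth_step_ge0 j x : 0 <= smooth_step j x.
Proof.
by have [/smooth_step_le0->//|/(smooth_step_gt0 j)/ltW] := leP x 0.
Qed.

Lemma smooth_step0_le1 x : smooth_step 0 x <= 1.
Proof.
rewrite /smooth_step; case: ifPn => // x0.
by rewrite expr0 mul1r -expR0 ler_expR oppr_le0 invr_ge0 ltW.
Qed.

(** With [y = 1/x], the term of order [j + 2] of the exponential series gives
    [y^(j+2) <= (j+2)! e^y]. The quadratic bound is what makes the derivative at 0 vanish. *)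
Lemma smooth_step_le_sqr j x : smooth_step j x <= j.+2`!%:R * x ^+ 2.
Proof.
have [x0|x0] := leP x 0; first by rewrite smooth_step_le0// mulr_ge0// sqr_ge0.
rewrite /smooth_step x0.
have : 0 < x^-1 by rewrite invr_gt0.
rewrite -[in X in _ <= X](invrK x); move: (x^-1) => y y0.
have h := expR_ge1Dxn j.+1 (ltW y0).
have f0 : 0 < j.+2`!%:R :> R by rewrite ltr0n fact_gt0.
rewrite expRN ler_pdivrMr ?expR_gt0//.
have {}h : y ^+ j.+2 <= j.+2`!%:R * expR y.
  by rewrite -ler_pdivrMl// mulrC (le_trans _ h)// lerDr.
rewrite mulrAC exprVn ler_pdivlMr ?exprn_gt0//.
by rewrite -exprD addn2.
Qed.

(** Product rule for [x > 0]; at 0 the difference quotient is at most [(j+2)! |h|]. *)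
Lemma is_derive_smooth_step j x :
  is_derive x (1 : R) (smooth_step j)
    (- j%:R * smooth_step j.+1 x + smooth_step j.+2 x).
Proof.
have [x0|x0|->] := ltgtP x 0.
- rewrite !smooth_step_le0 ?ltW// mulr0 addr0.
  apply: near_eq_is_derive (is_derive_cst 0 x 1).
  near=> y; rewrite smooth_step_le0//; near: y.
  by apply: filterS (lt_nbhsl x0) => y /ltW.
- apply: (@near_eq_is_derive _ _ _ ((fun y => y^-1 ^+ j) * (expR \o (fun y => - y^-1)))).
    near=> y; rewrite /smooth_step [in RHS]ifT//; near: y.
    exact: lt_nbhsr.
  have x0' : x != 0 by rewrite gt_eqF.
  have dV : is_derive x 1 (fun y : R => y^-1) (- x^-2 * 1).
    exact: is_deriveV.
  have d1 : is_derive x 1 (fun y => y^-1 ^+ j) ((j%:R * x^-1 ^+ j.-1) *: (- x^-2 * 1)).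
    rewrite (_ : (fun y => _) = (@GRing.inv R) ^+ j).
      exact: (@is_deriveX _ _ (@GRing.inv R) j x 1 _ dV).
    by apply/funext => y; rewrite exprfctE.
  have d2 : is_derive x 1 (expR \o (fun y => - y^-1)) (- (- x^-2 * 1) * expR (- x^-1)).
    rewrite mulrC; apply: (@is_derive1_comp _ expR (fun y : R => - y^-1)).

  apply: is_derive_eq (is_deriveM d1 d2) _.
  rewrite /smooth_step x0 /GRing.scale/= !mulr1 opprK.
  case: j {d1} => [|j]; first by rewrite !mul0r expr0 oppr0 mul0r !mulr0 addr0 add0r mul1r -exprVn.
  rewrite -!exprVn /= !exprS !expr0 mulr1; ring.
- rewrite !smooth_step_le0// mulr0 addr0.
  have cv : h^-1 *: ((smooth_step j \o shift 0) (h *: 1) - smooth_step j 0) @[h --> 0^'] --> (0:R).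
    apply/cvgrPdist_le => e e0; near=> h.
    rewrite sub0r normrN [smooth_step j 0]smooth_step_le0// subr0 /= addr0 /GRing.scale/= mulr1.
    rewrite normrM normfV ger0_norm ?smooth_step_ge0//.
    have h0 : 0 < `|h| by rewrite normr_gt0; near: h; exact: nbhs_dnbhs_neq.
    rewrite ler_pdivrMl//; apply: le_trans (smooth_step_le_sqr _ _) _.
    rewrite -real_normK ?num_real// expr2 mulrA mulrC ler_wpM2l ?normr_ge0//.
    have f0 : 0 < j.+2`!%:R :> R by rewrite ltr0n fact_gt0.
    rewrite -ler_pdivlMl// ; near: h; apply: nbhs_dnbhs.
    have : 0 < j.+2`!%:R^-1 * e by rewrite mulr_gt0// invr_gt0.
    by move=> d0; apply: (@nbhs0_le R R).
  apply: DeriveDef; first by apply/cvg_ex; exists 0.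
  exact: cvg_lim cv.
Unshelve. all: by end_near.
Qed.

End smooth_step.

Section smooth_algebra.
Context {R : realType} {n : nat}.
Local Notation Rn := 'rV[R]_n.

(** A class of differentiable functions closed under partial derivatives: smoothness to all orders
    follows without formulas for iterated derivatives. The sign of [e] chooses the side of the
    hyperplane [x_i = a] on which a step vanishes. *)
Inductive smooth_algebra : (Rn -> R) -> Prop :=
| smooth_algebra_cst c : smooth_algebra (fun=> c)
| smooth_algebra_step (e : R) (i : 'I_n) (a : R) j :
    smooth_algebra (fun x => smooth_step j (e * (x ord0 i - a)))
| smooth_algebra_add f g : smooth_algebra f -> smooth_algebra g ->
    smooth_algebra (fun x => f x + g x)
| smooth_algebra_mul f g : smooth_algebra f -> smooth_algebra g ->
    smooth_algebra (fun x => f x * g x).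

Lemma smooth_algebra_differentiable f x : smooth_algebra f -> differentiable f x.
Proof.
elim=> [c|e i a j|{}f g _ df _ dg|{}f g _ df _ dg].
- exact: differentiable_cst.
- apply: (@differentiable_comp _ _ _ _ (fun x : Rn => e * (x ord0 i - a)) (smooth_step j)).
    apply: (@differentiableM _ _ (fun=> e) (fun y : Rn => y ord0 i - a)).
      exact: differentiable_cst.
    apply: (@differentiableB _ _ _ (fun y : Rn => y ord0 i) (fun=> a)).
      exact: differentiable_coord.
    exact: differentiable_cst.
  apply/derivable1_diffP; have := is_derive_smooth_step j (e * (x ord0 i - a)).
  by case.
- exact: differentiableD.
- exact: differentiableM.
Qed.

Lemma derive_affine_coord (e a : R) (i : 'I_n) (v x : Rn) :
  'D_v (fun x : Rn => e * (x ord0 i - a)) x = e * v ord0 i.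
Proof.
apply: cvg_lim => //; apply: cvg_near_cst; near=> h.
have h0 : h != 0 by near: h; exact: nbhs_dnbhs_neq.
rewrite /= !mxE /GRing.scale/=; field.
exact: h0.
Unshelve. all: by end_near.
Qed.

Lemma smooth_algebra_derive f i : smooth_algebra f ->
  smooth_algebra ('D_(delta_mx ord0 i) f).
Proof.
elim=> [c|e k a j|{}f g sf df sg dg|{}f g sf df sg dg].
- rewrite (_ : 'D_ _ _ = fun=> 0); first exact: smooth_algebra_cst.
  by apply/funext => x; exact: derive_cst.
- rewrite (_ : 'D_ _ _ = fun x : Rn => (e * (k == i)%:R) *
     ((- j%:R) * smooth_step j.+1 (e * (x ord0 k - a)) +
       smooth_step j.+2 (e * (x ord0 k - a)))).
    apply: smooth_algebra_mul; first exact: smooth_algebra_cst.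
    apply: smooth_algebra_add; last exact: smooth_algebra_step.
    by apply: smooth_algebra_mul; [exact: smooth_algebra_cst|exact: smooth_algebra_step].
  apply/funext => x.
  have dl : differentiable (fun x : Rn => e * (x ord0 k - a)) x.
    apply: (@differentiableM _ _ (fun=> e) (fun y : Rn => y ord0 k - a)).
      exact: differentiable_cst.
    apply: (@differentiableB _ _ _ (fun y : Rn => y ord0 k) (fun=> a)).
      exact: differentiable_coord.
    exact: differentiable_cst.
  have [d1 d2] := is_derive_smooth_step j (e * (x ord0 k - a)).
  have ds : differentiable (smooth_step j) (e * (x ord0 k - a)).
    exact/derivable1_diffP.
  rewrite deriveE; last exact: (@differentiable_comp _ _ _ _
     (fun x : Rn => e * (x ord0 k - a)) (smooth_step j)).
  rewrite (@diff_comp _ _ _ _ (fun x : Rn => e * (x ord0 k - a)) (smooth_step j))//=.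
  rewrite diff1E// -deriveE// derive_affine_coord derive1E d2 mxE eqxx/=.
  by rewrite eq_sym.
- rewrite (_ : 'D_ _ _ = fun x => 'D_(delta_mx ord0 i) f x + 'D_(delta_mx ord0 i) g x).
    exact: smooth_algebra_add.
  by apply/funext => x; apply: deriveD;
    apply: diff_derivable; exact: smooth_algebra_differentiable.
- rewrite (_ : 'D_ _ _ = fun x => f x * 'D_(delta_mx ord0 i) g x +
                                  g x * 'D_(delta_mx ord0 i) f x).
    by apply: smooth_algebra_add; exact: smooth_algebra_mul.
  by apply/funext => x; apply: deriveM;
    apply: diff_derivable; exact: smooth_algebra_differentiable.
Qed.

Lemma smooth_algebra_partials s f : smooth_algebra f -> smooth_algebra (partials s f).
Proof.
by elim: s => //= i s ih sf; apply: smooth_algebra_derive; exact: ih.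
Qed.

Lemma smooth_algebra_smooth f : smooth_algebra f -> smooth f.
Proof.
move=> sf s x; exact/smooth_algebra_differentiable/smooth_algebra_partials.
Qed.

Lemma partials_eq0 s (f : Rn -> R) (O : set Rn) : open O ->
  (forall x, O x -> f x = 0) -> forall x, O x -> partials s f x = 0.
Proof.
move=> oO f0; elim: s => //= i s ih x Ox.
rewrite -[RHS](derive_cst 0 x (delta_mx ord0 i)); apply: near_eq_derive.
by near=> y; apply: ih; near: y; exact: open_nbhs_nbhs.
Unshelve. all: by end_near.
Qed.

(** The product of a monomial and an iterated derivative is continuous, hence bounded on the compact
    support of [f], and it vanishes on the open complement because derivatives are local. *)
Lemma test_function_schwartz (f : Rn -> R) : test_function f -> schwartz f.
Proof.
move=> [sf cf]; split => // a s.
have cg : continuous (fun x => monomial a x * partials s f x).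
  move=> x; apply: (@continuousM _ _ (monomial a) (partials s f)); last first.
    exact: differentiable_continuous (sf s x).
  elim: a => [|i a ih].
    rewrite (_ : monomial [::] = fun=> 1); first exact: cst_continuous.
    by apply/funext => y; rewrite /monomial big_nil.
  rewrite (_ : monomial (i :: a) = fun y => y ord0 i * monomial a y).
    by apply: (@continuousM _ _ (fun y : Rn => y ord0 i) (monomial a)) => //;
      exact: coord_continuous.
  by apply/funext => y; rewrite /monomial big_cons.
have := continuous_compact (continuous_subspaceT cg) cf.
move=> /compact_bounded [M [_ hM]].
exists (Num.max (M + 1) 0) => x.
have [xs|xs] := pselect (supp f x).
  rewrite le_max; apply/orP; left.
  by apply: (hM (M + 1)); [rewrite ltrDl|exists x].
rewrite (@partials_eq0 s f (~` supp f))//.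
- by rewrite mulr0 normr0 le_max lexx orbT.
- by apply: closed_openC; exact: closed_closure.
- move=> y ys; apply/eqP/negPn/negP => fy.
  by apply: ys; exact: subset_closure.
Qed.

End smooth_algebra.

Section box_bump.
Context {R : realType} {n : nat}.
Local Notation Rn := 'rV[R]_n.
Implicit Types (a b : 'I_n -> R).

Definition obox a b : set Rn := [set x | forall i, a i < x ord0 i < b i].
Definition cbox a b : set Rn := [set x | forall i, a i <= x ord0 i <= b i].

Lemma obox_cbox a b : obox a b `<=` cbox a b.
Proof. by move=> x h i; have /andP[/ltW -> /ltW ->] := h i. Qed.

Lemma cbox_compact a b : compact (cbox a b).
Proof.
rewrite (_ : cbox a b = [set v : Rn | forall i, `[a i, b i]%classic (v ord0 i)]).
  apply: (@rV_compact _ _ (fun i => `[a i, b i]%classic)) => i.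
  exact: segment_compact.
by apply/seteqP; split => x /= h i; have := h i; rewrite in_itv.
Qed.

Lemma cbox_closed a b : closed (cbox a b).
Proof.
apply: compact_closed; last exact: cbox_compact.
exact: norm_hausdorff.
Qed.

(* Increases to the indicator of obox a b as k grows, each factor being in [0, 1[. *)
Definition box_bump a b (k : nat) (x : Rn) : R :=
  1 - (1 - \prod_(i < n) (smooth_step 0 (1 * (x ord0 i - a i)) *
                          smooth_step 0 (- 1 * (x ord0 i - b i)))) ^+ k.

Lemma box_bump_smooth_algebra a b k : smooth_algebra (box_bump a b k).
Proof.
have sB (f g : Rn -> R) : smooth_algebra f -> smooth_algebra g ->
    smooth_algebra (fun x => f x - g x).
  move=> sf sg; rewrite (_ : (fun x => _) = (fun x => f x + (- 1) * g x)).
    apply: smooth_algebra_add => //; apply: smooth_algebra_mul => //.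
    exact: smooth_algebra_cst.
  by apply/funext => x; rewrite mulN1r.
have sX (f : Rn -> R) : smooth_algebra f -> smooth_algebra (fun x => f x ^+ k).
  move=> sf; elim: k => [|k ih].
    under eq_fun do rewrite expr0; exact: smooth_algebra_cst.
  under eq_fun do rewrite exprS; exact: smooth_algebra_mul.

apply: (sB) => //; first exact: smooth_algebra_cst.
apply: (sX); apply: (sB); first exact: smooth_algebra_cst.
elim: (index_enum _) => [|i s ih].
  under eq_fun do rewrite big_nil; exact: smooth_algebra_cst.
under eq_fun do rewrite big_cons.
by do 2!(apply: smooth_algebra_mul => //); exact: smooth_algebra_step.
Qed.

Let w a b (x : Rn) : R := \prod_(i < n) (smooth_step 0 (1 * (x ord0 i - a i)) *
                          smooth_step 0 (- 1 * (x ord0 i - b i))).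

Let w01 a b x : 0 <= w a b x <= 1.
Proof.
apply/andP; split.
  by apply: prodr_ge0 => i _; rewrite mulr_ge0// smooth_step_ge0.
apply: prodr_ile1 => i _.
by rewrite mulr_ge0 ?smooth_step_ge0//= mulr_ile1 ?smooth_step_ge0 ?smooth_step0_le1.
Qed.

Let w_gt0 a b x : obox a b x -> 0 < w a b x.
Proof.
move=> xab; apply: prodr_gt0 => i _; have /andP[h1 h2] := xab i.
by rewrite mulr_gt0// smooth_step_gt0// ?mul1r ?mulN1r ?opprB subr_gt0.
Qed.

Let w_eq0 a b x : ~ obox a b x -> w a b x = 0.
Proof.
move=> /existsNP[i] /negP; rewrite negb_and -!leNgt => h.
apply/eqP/prodf_eq0; exists i => //; case/orP: h => h.
  by rewrite [X in X * _]smooth_step_le0 ?mul0r// mul1r subr_le0.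
by rewrite [X in _ * X]smooth_step_le0 ?mulr0// mulN1r opprB subr_le0.
Qed.

Lemma box_bump_ge0 a b k x : 0 <= box_bump a b k x.
Proof.
have /andP[w0 w1] := w01 a b x.
by rewrite subr_ge0 exprn_ile1// ?subr_ge0 ?gerBl.
Qed.

Lemma box_bump_le1 a b k x : box_bump a b k x <= 1.
Proof.
have /andP[w0 w1] := w01 a b x.
by rewrite gerBl exprn_ge0// subr_ge0.
Qed.

Lemma box_bump_eq0 a b k x : ~ obox a b x -> box_bump a b k x = 0.
Proof. by move=> /w_eq0; rewrite /box_bump /w => ->; rewrite subr0 expr1n subrr. Qed.

Lemma box_bump_norm_le1 a b k x : `|box_bump a b k x| <= \1_(obox a b) x.
Proof.
rewrite ger0_norm ?box_bump_ge0// indicE.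
have [xab|xab] := pselect (obox a b x); first by rewrite mem_set// box_bump_le1.
by rewrite memNset// box_bump_eq0.
Qed.

Lemma box_bump_cvg a b x : box_bump a b k x @[k --> \oo] --> (\1_(obox a b) x : R).
Proof.
rewrite indicE; have [xab|xab] := pselect (obox a b x).
  rewrite mem_set//= -[X in _ --> X](subr0 1).
  apply: cvgB; first exact: cvg_cst.
  apply: cvg_expr; have /andP[w0 w1] := w01 a b x.
  by rewrite ger0_norm ?subr_ge0// ltrBlDr ltrDl; exact: w_gt0.
rewrite memNset//=; under eq_fun do rewrite box_bump_eq0//; exact: cvg_cst.
Qed.

Lemma supp_box_bump a b k : supp (box_bump a b k) `<=` cbox a b.
Proof.
rewrite [X in _ `<=` X](iffLR (closure_id _) (@cbox_closed a b)).
apply: closureS => x /= xab; apply: obox_cbox; apply: contrapT => /box_bump_eq0 h.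
by move: xab; rewrite h eqxx.
Qed.

Lemma test_function_box_bump a b k : test_function (box_bump a b k).
Proof.
split; first exact/smooth_algebra_smooth/box_bump_smooth_algebra.
apply: (subclosed_compact _ (@cbox_compact a b)); last exact: supp_box_bump.
exact: closed_closure.
Qed.

Lemma measurable_coord (i : 'I_n) : measurable_fun setT (fun x : Rn => x ord0 i).
Proof.
move=> _ Y mY; apply: sub_sigma_algebra; rewrite -bigcup_seq/=.
exists i => /=; first by rewrite mem_index_enum.
by exists Y => //; rewrite setTI.
Qed.

Lemma measurable_smooth_step j : measurable_fun setT (@smooth_step R j).
Proof.
apply: continuous_measurable_fun => x.
apply: differentiable_continuous; apply/derivable1_diffP.
by case: (is_derive_smooth_step j x).
Qed.

Lemma measurable_smooth_algebra (f : Rn -> R) : smooth_algebra f -> measurable_fun setT f.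
Proof.
elim=> [c|e i a j|{}f g _ mf _ mg|{}f g _ mf _ mg].
- exact: measurable_cst.
- apply: (@measurableT_comp _ _ _ _ _ _ (smooth_step j)).
    exact: measurable_smooth_step.
  by apply: measurable_funM => //; apply: measurable_funB => //; exact: measurable_coord.
- exact: measurable_funD.
- exact: measurable_funM.
Qed.

Lemma measurable_box_bump a b k : measurable_fun setT (box_bump a b k).
Proof. by apply: measurable_smooth_algebra; exact: box_bump_smooth_algebra. Qed.

Lemma measurable_obox a b : measurable (obox a b).
Proof.
rewrite (_ : obox a b = \bigcap_(i in [set` 'I_n])
    ((fun x : Rn => x ord0 i) @^-1` `]a i, b i[%classic)).
  apply: fin_bigcap_measurable => // i _.
  by rewrite -[X in measurable X]setTI; exact: measurable_coord.
apply/seteqP; split => x /= h i; first by move=> _ /=; rewrite in_itv/=.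
by have /= := h i erefl; rewrite in_itv.
Qed.

End box_bump.

(** * Integrals and limits *)

Section integral_tools.
Local Open Scope ereal_scope.

(* Unlike [ge0_le_integral], no measurability is assumed. *)
Lemma ge0_le_integral_sup d (T : measurableType d) (R : realType)
    (mu : {measure set T -> \bar R}) (D E : set T) (f g : T -> \bar R) :
  D `<=` E -> (forall x, D x -> 0 <= f x) -> (forall x, E x -> 0 <= g x) ->
  (forall x, D x -> f x <= g x) ->
  \int[mu]_(x in D) f x <= \int[mu]_(x in E) g x.
Proof.
move=> DE f0 g0 fg; rewrite !ge0_integralE//.
apply: ereal_sup_le => _ [h /= hf <-]; exists h => //= x.
apply: le_trans (hf x) _; rewrite !patchE.
case: ifPn => [/set_mem Dx|_]; first by rewrite mem_set ?fg//; exact: DE.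
by case: ifPn => // /set_mem; exact: g0.
Qed.

Lemma cvg_powR (R : realType) (s l : R) (f_ : R^nat) : (0 < s)%R ->
  (forall k, 0 <= f_ k)%R ->
  (f_ k @[k --> \oo] --> l)%R -> (f_ k `^ s @[k --> \oo] --> l `^ s)%R.
Proof.
move=> s0 f0 fl.
have l0 : (0 <= l)%R by rewrite -(cvg_lim _ fl)//; apply: limr_ge; [apply/cvg_ex; exists l|apply: nearW].
have [l00|lN0] := eqVneq l 0%R; last first.
  have {lN0}l0 : (0 < l)%R by rewrite lt_neqAle eq_sym lN0.
  rewrite /powR (gt_eqF l0).
  have cl : (expR (s * ln (f_ k)) @[k --> \oo] --> expR (s * ln l))%R.
    apply: continuous_cvg; first exact: continuous_expR.
    apply: cvgMl_tmp; apply: continuous_cvg => //.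
    exact: continuous_ln.
  apply: cvg_trans cl; apply: near_eq_cvg; near=> k.
  rewrite gt_eqF//; near: k; exact: (cvgr_gt l).
rewrite l00 in fl *; rewrite powR0 ?gt_eqF//; apply/cvgrPdist_lt => e e0; near=> k.
rewrite sub0r normrN ger0_norm ?powR_ge0//.
have eE : e = ((e `^ s^-1) `^ s)%R.
  by rewrite -powRrM mulVf ?gt_eqF// powRr1// ltW.
rewrite [ltRHS]eE.
rewrite gt0_ltr_powR// ?nnegrE ?powR_ge0//.
near: k; apply: (cvgr_lt 0%R) => //; exact: powR_gt0.
Unshelve. all: by end_near.
Qed.

(** Confronts convergence in L^s with pointwise convergence on [P]. By Fatou's lemma the lower limit
    of [|D_ k|^s] vanishes almost everywhere, and on [P] it equals [|g|^s]. *)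
Lemma integral_eq0_lim d (T : measurableType d) (R : realType)
    (mu : {measure set T -> \bar R}) (P : set T) (s : R) (D_ : (T -> R)^nat)
    (g : T -> R) : (0 < s)%R -> (forall k, measurable_fun setT (D_ k)) ->
  \int[mu]_x (`|D_ k x| `^ s)%:E @[k --> \oo] --> 0 ->
  {ae mu, forall x, P x -> (D_ k x @[k --> \oo] --> g x)%R} ->
  {ae mu, forall x, P x -> g x = 0%R}.
Proof.
move=> s0 mD cD Dg.
pose F k x := (`|D_ k x| `^ s)%:E.
have mF k : measurable_fun setT (F k).
  apply/measurable_EFinP; apply: (measurableT_comp (measurable_powR s)).
  exact: measurableT_comp.
have F0 k x : 0 <= F k x by rewrite lee_fin powR_ge0.
have I0 : \int[mu]_x limn_einf (F ^~ x) = 0.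
  apply/eqP; rewrite eq_le; apply/andP; split; last first.
    apply: integral_ge0 => x _; rewrite limn_einf_lim; apply: lime_ge.
      exact: is_cvg_einfs.
    by apply: nearW => k; apply: le_ereal_inf_tmp => _ [j _ <-].
  apply: le_trans (fatou mu measurableT mF (fun k x _ => F0 k x)) _.
  by rewrite (cvg_limn_einf_sup cD).1.
have mG : measurable_fun setT (fun x => limn_einf (F ^~ x)).
  apply: (@emeasurable_fun_cvg _ _ _ _ (fun k x => einfs (F ^~ x) k)).
    exact: measurable_fun_einfs.
  by move=> x _; rewrite limn_einf_lim; exact: is_cvg_einfs.
have : {ae mu, forall x, limn_einf (F ^~ x) = 0}.
  have /ae_eq_integral_abs := mG; move=> /(_ mu measurableT)[+ _].
  have -> : \int[mu]_x `|limn_einf (F ^~ x)| = 0.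
    rewrite -[RHS]I0; apply: eq_integral => x _; rewrite gee0_abs//.
    rewrite limn_einf_lim; apply: lime_ge; first exact: is_cvg_einfs.
    by apply: nearW => k; apply: le_ereal_inf_tmp => _ [j _ <-].
  by move=> /(_ erefl); apply: filterS => x /(_ I).
apply: filterS2 Dg => x Dgx G0 Px.
have cF : F k x @[k --> \oo] --> (`|g x| `^ s)%:E.
  apply: cvg_EFin; first exact: nearW.
  apply: cvg_powR => // ; apply: cvg_norm; exact: Dgx.
have [+ _] := cvg_limn_einf_sup cF; rewrite G0 => -[] /esym /eqP.
by rewrite powR_eq0 (gt_eqF s0) andbT normr_eq0 => /eqP.
Qed.

Lemma powR_dominated_cvg d (T : measurableType d) (R : realType)
    (mu : {measure set T -> \bar R}) (s : R) (h_ : (T -> R)^nat) (h w : T -> R) :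
  (0 < s)%R -> (forall k, measurable_fun setT (h_ k)) -> measurable_fun setT h ->
  measurable_fun setT w ->
  (forall x, (h_ k x @[k --> \oo] --> h x)%R) -> (forall k x, `|h_ k x| <= w x)%R ->
  \int[mu]_x (`|w x| `^ s)%:E < +oo ->
  \int[mu]_x (`|h x - h_ k x| `^ s)%:E @[k --> \oo] --> 0.
Proof.
move=> s0 mh_ mh mw hc hw wi.
have mP (f : T -> R) : measurable_fun setT f ->
    measurable_fun setT (fun x => (`|f x| `^ s)%:E).
  move=> mf; apply/measurable_EFinP; apply: (measurableT_comp (measurable_powR s)).
  exact: measurableT_comp.
have h_w x : (`|h x| <= w x)%R.
  have cx : (`|h_ k x| @[k --> \oo] --> `|h x|)%R by exact: cvg_norm.
  by rewrite -(cvg_lim _ cx)//; apply: limr_le; [apply/cvg_ex; exists `|h x|%R|apply: nearW].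
have w0 x : (0 <= w x)%R by apply: le_trans (h_w x).
have /dominated_convergence : forall k, measurable_fun setT (fun x => (`|h x - h_ k x| `^ s)%:E).
  by move=> k; apply: mP; exact: measurable_funB.
(* The difference is at most [2 w] in absolute value, so [|2 w|^s] is an integrable majorant. *)
move=> /(_ mu measurableT (cst 0) (fun x => (`|2 * w x| `^ s)%:E)).
case.
- exact: measurable_cst.
- apply: nearW => x _; apply: cvg_EFin; first exact: nearW.
  rewrite -(@powR0 _ s) ?gt_eqF//; apply: cvg_powR => //.
  rewrite -(@normr0 _ R); apply: cvg_norm.
  rewrite -(subrr (h x)); apply: cvgB => //; exact: cvg_cst.
- apply/integrableP; split; first by apply: mP; exact: measurable_funM.
  under eq_integral do rewrite gee0_abs ?lee_fin ?powR_ge0// normrM powRM// EFinM.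
  rewrite ge0_integralZl_EFin ?powR_ge0//; last exact: mP.
  by rewrite lte_mul_pinfty ?lee_fin ?powR_ge0.
- apply: nearW => x k _; rewrite gee0_abs ?lee_fin ?powR_ge0//.
  apply: (ge0_ler_powR (ltW s0)); rewrite ?nnegrE//.
  apply: le_trans (ler_normB _ _) _; rewrite [leRHS]ger0_norm ?mulr_ge0//.
  by rewrite (_ : 2 * w x = w x + w x)%R; [exact: lerD|ring].
move=> _ _; rewrite integral0; apply: cvg_trans.
by apply: near_eq_cvg; apply: nearW.
Qed.

End integral_tools.

(** * Monotone class argument for bounded functions on a box *)

Section functional_monotone_class.
Import HBNNSimple.
Context {R : realType} {n : nat}.
Local Notation Rn := 'rV[R]_n.

Lemma obox_setI (a b a' b' : 'I_n -> R) :
  obox a b `&` obox a' b' =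
  obox (fun i => Num.max (a i) (a' i)) (fun i => Num.min (b i) (b' i)).
Proof.
apply/seteqP; split => x /= => [[h1 h2] i|h].
  by have /andP[? ?] := h1 i; have /andP[? ?] := h2 i; rewrite gt_max lt_min; apply/andP; split; apply/andP.
by split => i; have := h i; rewrite gt_max lt_min => /andP[/andP[? ?] /andP[? ?]]; apply/andP.
Qed.

Definition oboxes : set (set Rn) := [set S | exists a b, S = obox a b].

Lemma measurable_oboxes : @measurable _ Rn = <<s oboxes >>.
Proof.
apply/seteqP; split; last first.
  apply: smallest_sub; first exact: sigma_algebra_measurable.
  by move=> _ [a [b ->]]; exact: measurable_obox.
have mc i : @measurable_fun _ _ (g_sigma_algebraType oboxes) R setT (fun x : Rn => x ord0 i).
  apply: (measurability _ (RGenOInfty.measurableE R)) => _ [_ [u ->] <-].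
  rewrite setTI.
  (* The half-space [u < x_i] is a countable union of open boxes, cut off at [N] in the remaining
     directions. *)
  rewrite (_ : _ @^-1` _ = \bigcup_N
    obox (fun j => if j == i then u else - N%:R) (fun=> N%:R)).
    apply: bigcup_measurable => N _; apply: sub_sigma_algebra.
    by exists (fun j => if j == i then u else - N%:R), (fun=> N%:R).
  apply/seteqP; split => x /=.
    rewrite in_itv/= andbT => ux.
    pose M := \sum_(j < n) `|x ord0 j|.
    have xM j : `|x ord0 j| <= M.
      by rewrite /M (bigD1 j)//= lerDl sumr_ge0.
    have M0 : 0 <= M by exact: sumr_ge0.
    have [N MN] : exists N : nat, M < N%:R.
      by exists (Num.truncn M).+1; exact: truncnS_gt.
    exists N => // j; have := le_lt_trans (xM j) MN; rewrite ltr_norml => /andP[h1 h2].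
    by rewrite h2 andbT; case: eqP => // ->.
  move=> [N _ /(_ i)]; rewrite eqxx in_itv/= andbT => /andP[//].
apply: smallest_sub; first exact: smallest_sigma_algebra.
move=> S; rewrite -bigcup_seq => -[i _ /= [Y mY <-]].
exact: (mc i).
Qed.

Variables (a b : 'I_n -> R) (V : (Rn -> R) -> Prop).
Local Notation U := (obox a b).
Hypothesis V_bump : forall a' b' k, obox a' b' `<=` U -> V (box_bump a' b' k).
Hypothesis V_lin : forall (c : R) g h, V g -> V h -> V (fun x => c * g x + h x).
Hypothesis V_lim : forall (g_ : (Rn -> R)^nat) g (M : R), (forall k, V (g_ k)) ->
  (forall k x, `|g_ k x| <= M * \1_U x) ->
  (forall x, g_ k x @[k --> \oo] --> g x) -> V g.

Let V_obox a' b' : obox a' b' `<=` U -> V (\1_(obox a' b')).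
Proof.
move=> sU; apply: (@V_lim (box_bump a' b') _ 1) => [k|k x|x].
- exact: V_bump.
- apply: le_trans (box_bump_norm_le1 _ _ _ _) _; rewrite mul1r.
  by rewrite !indicE ler_nat; case: (boolP (x \in obox a' b')) => // /set_mem/sU/mem_set ->.
- exact: box_bump_cvg.
Qed.

Let V0 : V (fun=> 0).
Proof.
rewrite (_ : (fun=> 0) = (fun x => (- 1) * \1_U x + \1_U x)); last first.
  by apply/funext => x; rewrite mulN1r addNr.
by apply: V_lin; exact: V_obox.
Qed.

(** Dynkin's lemma: open boxes are stable under intersection, complements are taken inside [U], and
    the partial sums over a disjoint family stay below [\1_U]. *)
Let V_indic S : measurable S -> V (\1_(S `&` U)).
Proof.
rewrite measurable_oboxes; move: S.
apply: (dynkin_induction (P := fun S => V (\1_(S `&` U))) measurable_oboxes).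
- move=> _ _ [a1 [b1 ->]] [a2 [b2 ->]]; rewrite obox_setI.
  by eexists _, _.
- by rewrite setTI; exact: V_obox.
- move=> _ [a1 [b1 ->]]; rewrite /= obox_setI; apply: V_obox.
  by rewrite -obox_setI; exact: subIsetr.
- move=> S' _ VS; rewrite (_ : \1_ _ = (fun x => (- 1) * \1_(S' `&` U) x + \1_U x)).
    by apply: V_lin => //; exact: V_obox.
  apply/funext => x; rewrite !indicE !in_setI in_setC.
  by case: (x \in S'); case: (x \in U); rewrite /= ?mulN1r ?addNr ?oppr0 ?add0r// mulr0 add0r.
- move=> F mF tF VF.
  have sumE (N j : nat) x : F j x -> U x ->
      \sum_(k < N) \1_(F k `&` U) x = (j < N)%:R :> R.
    move=> Fjx Ux; have Fk k : \1_(F k `&` U) x = (k == j)%:R :> R.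
      rewrite indicE; case: eqVneq => [->|kj]; first by rewrite mem_set.
      rewrite memNset// => -[Fkx _]; move/trivIsetP: tF => /(_ k j Logic.I Logic.I kj).
      by apply/eqP/set0P; exists x.
    elim: N => [|N ih]; first by rewrite big_ord0.
    rewrite big_ord_recr/= ih Fk ltnS; case: ltngtP => //= _; by rewrite ?addr0 ?add0r.
  apply: (@V_lim (fun N x => \sum_(k < N) \1_(F k `&` U) x) _ 1).
  + elim=> [|N ih].
      by under eq_fun do rewrite big_ord0.
    under eq_fun do rewrite big_ord_recr/= addrC -[X in X + _]mul1r.
    exact: V_lin.
  + move=> N x; rewrite mul1r ger0_norm; last by apply: sumr_ge0.
    have [xU|xU] := pselect (U x); last first.
      rewrite big1 ?indicE ?ler0n// => k _.
      by rewrite indicE memNset// => -[].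
    have [[j Fjx]|nF] := pselect (exists j, F j x).
      rewrite (sumE _ j)//; first by rewrite indicE mem_set// ler_nat leq_b1.

    rewrite big1 ?indicE ?ler0n// => k _.
    by rewrite indicE memNset// => -[Fk _]; apply: nF; exists k.
  + move=> x.
    have [[[j Fjx] xU]|nF] := pselect ((exists j, F j x) /\ U x).
      rewrite indicE mem_set; last by split => //; exists j.
      apply: cvg_near_cst; near=> N; rewrite (sumE _ j)//.
      by apply/eqP; rewrite eqr_nat eqb1; near: N; exact: nbhs_infty_gt.
    rewrite indicE memNset; last by move=> [[j _ Fj] xU]; apply: nF; split => //; exists j.
    apply: cvg_near_cst; near=> N; rewrite big1// => k _.
    by rewrite indicE memNset// => -[Fk xU]; apply: nF; split => //; exists k.
Unshelve. all: by end_near.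
Qed.

Let V_sum (s : seq R) (S_ : R -> set Rn) : (forall y, measurable (S_ y)) ->
  V (fun x => \sum_(y <- s) y * \1_(S_ y `&` U) x).
Proof.
move=> mS; elim: s => [|y s ih]; first by under eq_fun do rewrite big_nil.
by under eq_fun do rewrite big_cons; apply: V_lin => //; exact: V_indic.
Qed.

(** The limits in [V_lim] are dominated by a multiple of [\1_U], the form in which dominated
    convergence applies to the two uses of the lemma. Adding [M' * \1_U] makes [g] nonnegative,
    hence an increasing limit of simple functions; the shift is removed by linearity. *)
Lemma bounded_monotone_class (g : Rn -> R) (M : R) :
  measurable_fun setT g ->
  (forall x, `|g x| <= M * \1_U x) -> V g.
Proof.
move=> mg gM; pose M' := Num.max M 0.
have M'0 : 0 <= M' by rewrite le_max lexx orbT.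
have gM' x : `|g x| <= M' * \1_U x.
  by apply: le_trans (gM x) _; rewrite ler_wpM2r// ?indicE ?ler0n// le_max lexx.
pose h x := g x + M' * \1_U x.
have h0 x : 0 <= h x by have := gM' x; rewrite ler_norml /h -lerBlDr sub0r => /andP[].
have mh : measurable_fun setT h.
  apply: measurable_funD => //; apply: measurable_funM => //.
  by apply: measurable_indic; exact: measurable_obox.
have mEh : measurable_fun setT (EFin \o h) by exact/measurable_EFinP.
pose f_ k := nnsfun_approx measurableT mEh k : Rn -> R.
have f_cvg x : f_ k x @[k --> \oo] --> h x.
  have : (EFin \o (f_ ^~ x)) k @[k --> \oo] --> (h x)%:E.
    by apply: cvg_nnsfun_approx => // y _; rewrite lee_fin.
  by move/fine_cvgP => [_].
have f_le k x : f_ k x <= h x.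
  rewrite -(cvg_lim _ (f_cvg x))//; apply: (nondecreasing_cvgn_le (u_ := f_ ^~ x)).
    by move=> i j ij; have /lefP/(_ x) := nd_nnsfun_approx measurableT mEh ij.
  by apply/cvg_ex; exists (h x).
have Vh : V h.
  apply: (@V_lim (fun k x => f_ k x * \1_U x) _ (2 * M')) => [k|k x|x].
  - rewrite (_ : (fun x => _) = fun x => \sum_(y <- finmap.enum_fset (fset_set (range (f_ k))))
        y * \1_((f_ k @^-1` [set y]) `&` U) x).
      apply: V_sum => y; exact: measurable_funPTI.
    apply/funext => x; rewrite {1}/f_ fimfunE fsbig_finite//= mulr_suml.
    apply: eq_bigr => y _; rewrite -mulrA; congr (_ * _).
    by rewrite !indicE in_setI -mulnb natrM.
  - rewrite ger0_norm; last by rewrite mulr_ge0 ?indicE ?ler0n// /f_.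
    apply: ler_wpM2r; first by rewrite indicE ler0n.
    apply: le_trans (f_le k x) _; rewrite /h mulrDl mul1r.
    have U1 : \1_U x <= 1 :> R by rewrite indicE lern1 leq_b1.
    apply: lerD; last by rewrite ler_piMr.
    by apply: le_trans (ler_norm _) _; apply: le_trans (gM' x) _; rewrite ler_piMr.
  - rewrite (_ : h x = h x * \1_U x); first exact: cvgMr_tmp.
    rewrite indicE; case: (boolP (x \in U)) => xU; rewrite ?mulr1//= mulr0.
    have := gM' x; rewrite /h indicE (negbTE xU)/= !mulr0 normr_le0 => /eqP ->.
    by rewrite addr0.
rewrite (_ : g = fun x => (- M') * \1_U x + h x).
  by apply: V_lin => //; exact: V_obox.
by apply/funext => x; rewrite /h mulNr addrCA addNr addr0.
Qed.

End functional_monotone_class.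

(** * Powers and Hoelder inequalities *)

Section weighted_amgm.
Context {R : realType}.

(** With [M] the right-hand side, [ln (x i / M) <= x i / M - 1], and the weighted mean of the right
    members is 0. A vanishing factor is treated apart, before logarithms are taken. *)
Lemma weighted_amgm (I : finType) (w x : I -> R) :
  (forall i, 0 < w i) -> \sum_i w i = 1 -> (forall i, 0 <= x i) ->
  \prod_i x i `^ w i <= \sum_i w i * x i.
Proof.
move=> w0 w1 x0.
have S0 : 0 <= \sum_i w i * x i by apply: sumr_ge0 => i _; rewrite mulr_ge0// ltW.
have [[i xi0]|nx] := pselect (exists i, x i = 0).
  by rewrite (bigD1 i)//= xi0 powR0 ?gt_eqF// mul0r.
have {nx}x0' i : 0 < x i.
  rewrite lt_neqAle x0 andbT eq_sym; apply/eqP => xi; apply: nx; by exists i.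
have [i _|e] := pickP (fun _ : I => true); last first.
  by rewrite !big_pred0 // in w1 *; move: w1 => /eqP; rewrite eq_sym oner_eq0.
set M := \sum_i w i * x i.
have M0 : 0 < M.
  rewrite /M (bigD1 i)//= ltr_pwDl ?mulr_gt0//.
  by apply: sumr_ge0 => j _; rewrite mulr_ge0// ltW.
rewrite -[leRHS]lnK ?posrE//.
rewrite (_ : \prod_i _ = expR (\sum_i w i * ln (x i))); last first.
  rewrite expR_sum; apply: eq_bigr => j _.
  by rewrite /powR gt_eqF.
rewrite ler_expR.
have -> : \sum_i w i * ln (x i) = \sum_i w i * ln (x i / M) + ln M.
  rewrite -[X in _ + X]mul1r -w1 mulr_suml -big_split/=; apply: eq_bigr => j _.
  by rewrite ln_div ?posrE// mulrBr subrK.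
rewrite gerDr; apply: (@le_trans _ _ (\sum_i w i * (x i / M - 1))).
  apply: ler_sum => j _; rewrite ler_pM2l//.
  have := @le_ln1Dx R (x j / M - 1); rewrite [X in ln X]addrC subrK; apply.
  by rewrite ltrBDr addrC subrr divr_gt0.
under eq_bigr do rewrite mulrBr mulr1 mulrA.
by rewrite sumrB -mulr_suml -/M w1 mulfV ?gt_eqF// subrr.
Qed.

End weighted_amgm.

Section power_bound.
Lemma powR_invE (R : realType) (v s : R) : 0 <= v -> v^-1 `^ s = (v `^ s)^-1.
Proof. by move=> v0; rewrite -powR_inv1// -powRrM mulN1r powRN. Qed.

Context d (T : measurableType d) (R : realType) (mu : {measure set T -> \bar R}).
Implicit Types (E : set T) (g h : T -> R) (th a b : R).
Local Open Scope ereal_scope.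

(* [Lp_le th E g a] is ||g||_{L^(1/th)(E)} <= a; with exponents written as their
   inverses, Hoelder's inequality adds them up. *)
Definition Lp_le th E g a : Prop :=
  \int[mu]_(x in E) (`|g x| `^ th^-1)%:E <= (a `^ th^-1)%:E.

Lemma measurable_power E g (s : R) : measurable_fun E g ->
  measurable_fun E (fun x => (`|g x| `^ s)%:E).
Proof.
move=> mg; apply/measurable_EFinP; apply: (measurableT_comp (measurable_powR s)).
exact: measurableT_comp.
Qed.

Lemma integral_power_patch E g (s : R) : (0 < s)%R ->
  \int[mu]_x (`|(g \_ E) x| `^ s)%:E = \int[mu]_(x in E) (`|g x| `^ s)%:E.
Proof.
move=> s0; rewrite [RHS]integral_mkcond; apply: eq_integral => x _.
rewrite !patchE; case: ifPn => // _.
by rewrite normr0 powR0// gt_eqF.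
Qed.

Lemma Lp_leP th E g a : (0 < th)%R -> (0 <= a)%R ->
  Lp_le th E g a <-> 'N[mu]_(th^-1)%:E[EFin \o (g \_ E)] <= a%:E.
Proof.
move=> th0 a0; rewrite /Lp_le -integral_power_patch ?invr_gt0//.
rewrite -[X in X <= _](_ : 'N[mu]_(th^-1)%:E[EFin \o (g \_ E)] `^ th^-1 = _); last first.
  by rewrite powR_Lnorm ?gt_eqF ?invr_gt0.
have N0 := Lnorm_ge0 mu (th^-1)%:E (EFin \o (g \_ E)).
rewrite -poweR_EFin; split => [h|h].
  have : ('N[mu]_(th^-1)%:E[EFin \o (g \_ E)] `^ th^-1) `^ th <= (a%:E `^ th^-1) `^ th.
    by apply: (gt0_ler_poweR (ltW th0)) => //; rewrite in_itv/= leey andbT ?lee_fin ?powR_ge0 ?poweR_ge0.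
  by rewrite -!poweRrM mulVf ?gt_eqF// !poweRe1// lee_fin.
by apply: gt0_ler_poweR; rewrite ?in_itv/= ?leey ?andbT ?lee_fin ?invr_ge0 ?(ltW th0).
Qed.

Lemma Lp_le_sub th D E g h a b : D `<=` E -> (0 < th)%R -> (0 <= a <= b)%R ->
  (forall x, D x -> `|g x| <= `|h x|)%R -> Lp_le th E h a -> Lp_le th D g b.
Proof.
move=> DE th0 /andP[a0 ab] gh; rewrite /Lp_le => H.
apply: (@le_trans _ _ (\int[mu]_(x in E) (`|h x| `^ th^-1)%:E)).
  apply: ge0_le_integral_sup => // x Dx; rewrite ?lee_fin ?powR_ge0//.
  by apply: ge0_ler_powR; rewrite ?nnegrE ?invr_ge0 ?(ltW th0)// gh.
apply: le_trans H _; rewrite lee_fin.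
by apply: ge0_ler_powR; rewrite ?nnegrE ?invr_ge0 ?(ltW th0)// (le_trans a0 ab).
Qed.

Lemma Lp_le_ae th E g h a : measurable E -> measurable_fun E g ->
  measurable_fun E h -> {ae mu, forall x, E x -> g x = h x} ->
  Lp_le th E h a -> Lp_le th E g a.
Proof.
move=> mE mg mh gh; rewrite /Lp_le => H; apply: le_trans H.
rewrite le_eqVlt; apply/orP; left; apply/eqP.
apply: ge0_ae_eq_integral => //; first exact: measurable_power.
- exact: measurable_power.
- by apply: filterS gh => x gx Ex; rewrite gx.
Qed.

Lemma Lp_leZ th E g (c : R) a : (0 < th)%R -> measurable E -> measurable_fun E g ->
  (0 <= a)%R -> Lp_le th E g a -> Lp_le th E (fun x => c * g x)%R (`|c| * a).
Proof.
move=> th0 mE mg a0; rewrite /Lp_le => H.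
under eq_integral do rewrite normrM powRM// EFinM.
rewrite ge0_integralZl_EFin ?powR_ge0//; last exact: measurable_power.
by rewrite powRM// EFinM lee_wpmul2l ?lee_fin ?powR_ge0.
Qed.

Lemma Lp_le_cst1 th E (v : R) : measurable E -> (0 < th)%R -> (0 <= v)%R ->
  mu E <= v%:E -> Lp_le th E (fun=> 1%R) (v `^ th).
Proof.
move=> mE th0 v0 muE; rewrite /Lp_le normr1 powR1.
rewrite integral_cst// mul1e (le_trans muE)// -powRrM mulfV ?gt_eqF//.
by rewrite powRr1.
Qed.

Lemma Lp_leD th E g h a b : (0 < th <= 1)%R -> measurable E ->
  measurable_fun E g -> measurable_fun E h -> (0 <= a)%R -> (0 <= b)%R ->
  Lp_le th E g a -> Lp_le th E h b -> Lp_le th E (fun x => g x + h x)%R (a + b).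
Proof.
move=> /andP[th0 th1] mE mg mh a0 b0 /(Lp_leP _ _ th0 a0) ga /(Lp_leP _ _ th0 b0) hb.
apply/Lp_leP; rewrite ?addr_ge0//.
rewrite (_ : (fun x => g x + h x)%R \_ E = (g \_ E) \+ (h \_ E))%R; last first.
  by apply/funext => x; rewrite /= !patchE; case: ifPn => //; rewrite addr0.
apply: (@le_trans _ _ ('N[mu]_(th^-1)%:E[EFin \o (g \_ E)] +
                       'N[mu]_(th^-1)%:E[EFin \o (h \_ E)])).
  apply: minkowski_EFin; last by rewrite invf_ge1.
  - by apply/(measurable_restrictT _ mE).
  - by apply/(measurable_restrictT _ mE).
by rewrite EFinD; exact: leeD.
Qed.

Lemma Lp_le_sum th E (I : Type) (r : seq I) (P : pred I) (g : I -> T -> R) (a : I -> R) :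
  (0 < th <= 1)%R -> measurable E ->
  (forall i, measurable_fun E (g i)) -> (forall i, (0 <= a i)%R) ->
  (forall i, P i -> Lp_le th E (g i) (a i)) ->
  Lp_le th E (fun x => \sum_(i <- r | P i) g i x)%R (\sum_(i <- r | P i) a i).
Proof.
move=> /[dup] th01 /andP[th0 th1] mE mg a0 ga; elim: r => [|i r ih].
  rewrite /Lp_le big_nil; under eq_integral do rewrite big_nil normr0.
  by rewrite powR0 ?invr_eq0 ?gt_eqF// integral0.
rewrite /Lp_le big_cons; under eq_integral do rewrite big_cons.
case: ifPn => // Pi; apply: Lp_leD => //; last exact: ga.
- under eq_fun do rewrite big_mkcond/=; apply: measurable_sum => j.
  by case: (P j).
- by apply: sumr_ge0.
Qed.

Lemma Lp_le1 E g a : (0 <= a)%R -> Lp_le 1 E g a <-> \int[mu]_(x in E) `|g x|%:E <= a%:E.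
Proof.
by move=> a0; rewrite /Lp_le invr1 powRr1//; under eq_integral do rewrite powRr1//.
Qed.

(** Hoelder's inequality for several factors. The weighted mean inequality with weights [th i / S]
    is applied pointwise to [X i], the power of [g i] normalised so that its integral is at most 1;
    the normalisation divides by [a i], which therefore has to be positive. *)
Lemma Lp_le_prod (I : finType) (th : I -> R) E (g : I -> T -> R) (a : I -> R) :
  (forall i, 0 < th i)%R -> (0 < \sum_i th i)%R -> measurable E ->
  (forall i, measurable_fun E (g i)) -> (forall i, 0 < a i)%R ->
  (forall i, Lp_le (th i) E (g i) (a i)) ->
  Lp_le (\sum_i th i)%R E (fun x => \prod_i g i x)%R (\prod_i a i)%R.
Proof.
move=> th0 S0 mE mg a0 ga; set S := (\sum_i th i)%R.
pose w i := (th i / S)%R.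
have w0 i : (0 < w i)%R by rewrite divr_gt0.
have w1 : (\sum_i w i = 1)%R by rewrite -mulr_suml mulfV// gt_eqF.
have pE (u : I -> R) : (forall i, 0 <= u i)%R ->
    ((\prod_i u i) `^ S^-1 = \prod_i (u i `^ (th i)^-1) `^ w i)%R.
  move=> u0; rewrite (_ : (\prod_i u i) `^ S^-1 = \prod_i (u i `^ S^-1))%R; last first.
    elim: (index_enum I) => [|j r ih]; first by rewrite !big_nil powR1.
    by rewrite !big_cons powRM ?ih// prodr_ge0.
  apply: eq_bigr => i _.
  by rewrite -powRrM /w mulrA mulVf ?mul1r// gt_eqF.
pose A := ((\prod_i a i) `^ S^-1)%R.
have A0 : (0 < A)%R by rewrite powR_gt0// prodr_gt0.
pose X i x := (`|g i x| `^ (th i)^-1 / a i `^ (th i)^-1)%R.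
have X0 i x : (0 <= X i x)%R by rewrite divr_ge0// powR_ge0.
have mX i : measurable_fun E (X i).
  by apply: measurable_funM => //; apply/measurable_EFinP; exact: measurable_power.
rewrite /Lp_le.
have mS : measurable_fun E (fun x => \sum_i w i * X i x)%R.
  by apply: measurable_sum => i; exact: measurable_funM.
have Sx0 x : (0 <= \sum_i w i * X i x)%R.
  by apply: sumr_ge0 => i _; rewrite mulr_ge0// ltW.
apply: (@le_trans _ _ (\int[mu]_(x in E) (A * \sum_i w i * X i x)%:E)).
  apply: ge0_le_integral_sup => // x _; rewrite lee_fin.
  - by rewrite mulr_ge0// ltW.
  - rewrite -ler_pdivrMl//.
    apply: le_trans (weighted_amgm w0 w1 (fun i => X0 i x)).
    rewrite normr_prod pE// /A pE; last by move=> i; exact: ltW.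
    rewrite mulrC -prodf_div le_eqVlt; apply/orP; left; apply/eqP.
    apply: eq_bigr => i _; rewrite /X powRM ?powR_ge0 ?invr_ge0 ?powR_ge0//.
    by rewrite powR_invE// powR_ge0.
under eq_integral do rewrite EFinM.
rewrite ge0_integralZl_EFin ?(ltW A0)//; last 2 first.
- by move=> x _; rewrite lee_fin.
- exact/measurable_EFinP.
rewrite -[leRHS]mule1; apply: lee_wpmul2l; first by rewrite lee_fin ltW.
under eq_integral do rewrite -sumEFin.
rewrite ge0_integral_sum//; last 2 first.
- by move=> i; apply/measurable_EFinP; exact: measurable_funM.
- by move=> i x _; rewrite lee_fin mulr_ge0// ltW.
rewrite -w1 -sumEFin; apply: lee_sum => i _.
under eq_integral do rewrite EFinM.
rewrite ge0_integralZl_EFin ?(ltW (w0 i))//; last 2 first.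
- by move=> x _; rewrite lee_fin.
- exact/measurable_EFinP.
rewrite -[leRHS]mule1 lee_wpmul2l ?lee_fin ?(ltW (w0 i))//.
under eq_integral do rewrite /X mulrC EFinM.
rewrite ge0_integralZl_EFin ?invr_ge0 ?powR_ge0//; last exact: measurable_power.
rewrite muleC lee_pdivrMr ?powR_gt0// mul1e; exact: ga.
Qed.

End power_bound.

(** * Euclidean balls and product measures *)

Section euclidean_norm.
Context {R : realType} {n : nat}.
Local Notation Rn := 'rV[R]_n.
Implicit Types x y : Rn.

Lemma enorm_ge0 x : 0 <= enorm x.
Proof. exact: sqrtr_ge0. Qed.

Lemma sqr_enorm x : enorm x ^+ 2 = \sum_(i < n) x ord0 i ^+ 2.
Proof. by rewrite sqr_sqrtr// sumr_ge0// => i _; rewrite sqr_ge0. Qed.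

Lemma coord_le_enorm x i : `|x ord0 i| <= enorm x.
Proof.
rewrite -(@ler_pXn2r _ 2)// ?nnegrE ?enorm_ge0// sqr_enorm real_normK ?num_real//.
by rewrite (bigD1 i)//= lerDl sumr_ge0// => j _; rewrite sqr_ge0.
Qed.

Lemma enorm_le_sum x : enorm x <= \sum_(i < n) `|x ord0 i|.
Proof.
have S0 : 0 <= \sum_(i < n) `|x ord0 i| by exact: sumr_ge0.
rewrite -(@ler_pXn2r _ 2)// ?nnegrE ?enorm_ge0// sqr_enorm expr2 mulr_suml.
apply: ler_sum => i _; rewrite -real_normK ?num_real// expr2 ler_wpM2l//.
by rewrite (bigD1 i)//= lerDl sumr_ge0.
Qed.

Lemma enorm_eq0 x : enorm x = 0 -> x = 0.
Proof.
move=> x0; apply/rowP => i; rewrite mxE; apply/eqP; rewrite -normr_le0 -x0.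
exact: coord_le_enorm.
Qed.

Lemma enorm0 : enorm (0 : Rn) = 0.
Proof.
by rewrite /enorm big1 ?sqrtr0// => i _; rewrite mxE expr0n.
Qed.

Lemma enormN x : enorm (- x) = enorm x.
Proof. by rewrite /enorm; under eq_bigr do rewrite mxE sqrrN. Qed.

Lemma enorm_distC x y : enorm (x - y) = enorm (y - x).
Proof. by rewrite -enormN opprB. Qed.

(** Cauchy-Schwarz: after division by the norms, sum [2 u v <= u^2 + v^2] over the coordinates. *)
Lemma sum_coord_mul_le x y :
  \sum_(i < n) x ord0 i * y ord0 i <= enorm x * enorm y.
Proof.
have [/enorm_eq0 ->|x0] := eqVneq (enorm x) 0.
  by rewrite enorm0 mul0r big1// => i _; rewrite mxE mul0r.
have [/enorm_eq0 ->|y0] := eqVneq (enorm y) 0.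
  by rewrite enorm0 mulr0 big1// => i _; rewrite mxE mulr0.
have {}x0 : 0 < enorm x by rewrite lt_neqAle eq_sym x0 enorm_ge0.
have {}y0 : 0 < enorm y by rewrite lt_neqAle eq_sym y0 enorm_ge0.
rewrite [leRHS]mulrC -ler_pdivrMr// -[leRHS]mul1r -ler_pdivrMr//.
have := sqr_enorm x; have := sqr_enorm y.
move: (enorm x) (enorm y) x0 y0 => a b a0 b0 hb ha.
rewrite !mulr_suml.
apply: (@le_trans _ _ (\sum_(i < n) 2^-1 * (x ord0 i ^+ 2 / a ^+ 2 + y ord0 i ^+ 2 / b ^+ 2))).
  apply: ler_sum => i _.
  have : 0 <= (x ord0 i / a - y ord0 i / b) ^+ 2 by exact: sqr_ge0.
  move: (x ord0 i) (y ord0 i) => u v.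
  have -> : u ^+ 2 / a ^+ 2 = (u / a) ^+ 2 by rewrite expr_div_n.
  have -> : v ^+ 2 / b ^+ 2 = (v / b) ^+ 2 by rewrite expr_div_n.
  have -> : u * v / a / b = (u / a) * (v / b) by ring.
  move: (u / a) (v / b) => p q; nra.
rewrite -mulr_sumr big_split/= -!mulr_suml -ha -hb !mulfV ?expf_neq0 ?gt_eqF//.
by rewrite mulVf.
Qed.

Lemma enormD x y : enorm (x + y) <= enorm x + enorm y.
Proof.
rewrite -(@ler_pXn2r _ 2)// ?nnegrE ?addr_ge0 ?enorm_ge0//.
rewrite sqr_enorm sqrrD !sqr_enorm.
rewrite (eq_bigr (fun i => x ord0 i ^+ 2 + 2 * (x ord0 i * y ord0 i) + y ord0 i ^+ 2)); last first.
  by move=> i _; rewrite mxE; ring.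
rewrite !big_split/= lerD2r lerD2l -mulr_sumr -[leRHS]mulr_natl ler_wpM2l//.
exact: sum_coord_mul_le.
Qed.

Lemma enorm_dist_triangle z x y : enorm (x - y) <= enorm (x - z) + enorm (z - y).
Proof. by apply: le_trans (enormD _ _); rewrite addrA subrK. Qed.

Lemma measurable_enorm (x0 : Rn) : measurable_fun setT (fun x : Rn => enorm (x - x0)).
Proof.
apply: (measurableT_comp (f := @Num.sqrt R)).
  by apply: continuous_measurable_fun; exact: sqrt_continuous.
apply: measurable_sum => i; apply: measurable_funX.
rewrite (_ : (fun x => _) = (fun x : Rn => x ord0 i - x0 ord0 i)); last first.
  by apply/funext => x; rewrite !mxE.
by apply: measurable_funB => //; exact: measurable_coord.
Qed.

Lemma measurable_eball (x0 : Rn) r : measurable (eball x0 r).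
Proof.
rewrite (_ : eball x0 r = (fun x : Rn => enorm (x - x0)) @^-1` `]-oo, r[%classic).
  by rewrite -[X in measurable X]setTI; exact: measurable_enorm.
by apply/seteqP; split => x /=; rewrite in_itv.
Qed.

Lemma le_eball (x0 : Rn) r s : r <= s -> eball x0 r `<=` eball x0 s.
Proof. by move=> rs x /= /lt_le_trans; exact. Qed.

Lemma eball_obox (x0 : Rn) r :
  eball x0 r `<=` obox (fun i => x0 ord0 i - r) (fun i => x0 ord0 i + r).
Proof.
move=> x /= xr i; have := le_lt_trans (coord_le_enorm (x - x0) i) xr.
by rewrite !mxE ltr_distl.
Qed.

Lemma lebesgueRn_obox (a b : 'I_n -> R) : (forall i, a i <= b i) ->
  lebesgueRn R n (obox a b) = (\prod_(i < n) (b i - a i))%:E.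
Proof.
move=> ab; transitivity (\prod_(i < n) lebesgue_measure (`]a i, b i[%classic : set R))%E.
  rewrite -lebesgueRn_box//; congr (lebesgueRn R n _).
rewrite -prodEFin; apply: eq_bigr => i _.
rewrite lebesgue_measure_itv/= lte_fin; case: ltP => // ba.
by rewrite (le_anti (_ : b i <= a i <= b i)) ?subrr// ba ab.
Qed.

Lemma lebesgueRn_eball_le (x0 : Rn) r : 0 <= r ->
  (lebesgueRn R n (eball x0 r) <= ((2 * r) ^+ n)%:E)%E.
Proof.
move=> r0; apply: (@le_trans _ _
    (lebesgueRn R n (obox (fun i => x0 ord0 i - r) (fun i => x0 ord0 i + r)))).
  apply: le_measure; rewrite ?inE; last exact: eball_obox.
  - exact: measurable_eball.
  - exact: measurable_obox.
rewrite lebesgueRn_obox; last by move=> i; rewrite lerD2l; lra.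
rewrite (eq_bigr (fun=> 2 * r)); last by move=> i _; ring.
by rewrite prodr_const card_ord.
Qed.

Lemma lebesgueRn_eball (x0 : Rn) r : 0 <= r -> lebesgueRn R n (eball x0 r) = (vol x0 r)%:E.
Proof.
move=> r0; rewrite /vol fineK// ge0_fin_numE//.
exact: le_lt_trans (lebesgueRn_eball_le x0 r0) (ltry _).
Qed.

Lemma vol_le (x0 : Rn) r : 0 <= r -> vol x0 r <= (2 * r) ^+ n.
Proof. by move=> r0; rewrite -lee_fin -lebesgueRn_eball//; exact: lebesgueRn_eball_le. Qed.

(** The cube of half side [r / n] lies in the ball, since [enorm] is at most the sum of the absolute
    values of the coordinates. Together with the circumscribed cube this gives the order of
    magnitude of the volume, which is all that the estimates use. *)
Lemma vol_ge (x0 : Rn) r : (0 < n)%N -> 0 < r -> (2 * r / n%:R) ^+ n <= vol x0 r.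
Proof.
move=> n0 r0; have n0' : 0 < n%:R :> R by rewrite ltr0n.
rewrite -lee_fin -lebesgueRn_eball ?(ltW r0)//.
have sub : obox (fun i => x0 ord0 i - r / n%:R) (fun i => x0 ord0 i + r / n%:R) `<=` eball x0 r.
  move=> x h; rewrite /= ; apply: le_lt_trans (enorm_le_sum _) _.
  apply: (@lt_le_trans _ _ (\sum_(i < n) (r / n%:R))).
    apply: ltr_sum; first by apply/hasP; exists (Ordinal n0) => //; rewrite mem_index_enum.
    by move=> i _; rewrite !mxE ltr_distl; exact: h.
  by rewrite sumr_const card_ord -[X in X <= _]mulr_natr mulfVK// gt_eqF.
apply: (@le_trans _ _ (lebesgueRn R n
    (obox (fun i => x0 ord0 i - r / n%:R) (fun i => x0 ord0 i + r / n%:R)))).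
  rewrite lebesgueRn_obox; last by move=> i; have := divr_gt0 r0 n0'; lra.
  rewrite (eq_bigr (fun=> 2 * r / n%:R)); last by move=> i _; field; rewrite gt_eqF.
  by rewrite prodr_const card_ord.
apply: le_measure; rewrite ?inE//.
- exact: measurable_obox.
- exact: measurable_eball.
Qed.

Lemma vol_gt0 (x0 : Rn) r : (0 < n)%N -> 0 < r -> 0 < vol x0 r.
Proof.
move=> n0 r0; apply: lt_le_trans (vol_ge x0 n0 r0).
by rewrite exprn_gt0// divr_gt0 ?mulr_gt0// ltr0n.
Qed.

End euclidean_norm.

Section tuple_tonelli.
Context d (T : measurableType d) (R : realType).
Variable mu : {sigma_finite_measure set T -> \bar R}.
Local Open Scope ereal_scope.

Lemma measurable_prod_tnth m (g : 'I_m -> T -> \bar R) :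
  (forall i, measurable_fun setT (g i)) ->
  measurable_fun setT (fun y : m.-tuple T => \prod_(i < m) g i (tnth y i)).
Proof.
move=> mg; elim: (index_enum _) => [|i s ih].
  by under eq_fun do rewrite big_nil; exact: measurable_cst.
under eq_fun do rewrite big_cons; apply: emeasurable_funM => //.
by apply: measurableT_comp => //; exact: measurable_tnth.
Qed.

Lemma integral_tuple_measureS m (f : m.+1.-tuple T -> \bar R) :
  measurable_fun setT f -> (forall y, 0 <= f y) ->
  \int[tuple_measure mu m.+1]_y f y =
  \int[mu]_x \int[tuple_measure mu m]_y f [tuple of x :: y].
Proof.
move=> mf f0 /=.
rewrite (@ge0_integral_pushforward _ _ _ _ _ _ (@measurable_tcons _ T m)
  (sf_product mu (tuple_measure mu m)) setT f)//= preimage_setT.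
exact: (@fubini_tonelli1 _ _ _ _ _ mu (tuple_measure mu m) (f \o @tcons _ T m)
  (measurableT_comp mf (@measurable_tcons _ T m)) (fun=> f0 _)).
Qed.

Lemma integral_prod_tnth m (g : 'I_m -> T -> \bar R) :
  (forall i, measurable_fun setT (g i)) -> (forall i x, 0 <= g i x) ->
  \int[tuple_measure mu m]_y (\prod_(i < m) g i (tnth y i)) =
  \prod_(i < m) \int[mu]_x g i x.
Proof.
elim: m g => [|m ih] g mg g0.
  rewrite big_ord0 /=; under eq_integral do rewrite big_ord0.
  by rewrite integral_cst//= diracT mul1e.
rewrite integral_tuple_measureS; last 2 first.
- exact: measurable_prod_tnth.
- by move=> y; rewrite prode_ge0.
rewrite big_ord_recl.
under eq_integral => x _.
  under eq_integral do (rewrite big_ord_recl tnth0; under eq_bigr do rewrite tnthS).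
  rewrite ge0_integralZl//; last 2 first.
  - exact: (measurable_prod_tnth (fun i => mg (lift ord0 i))).
  - by move=> y _; rewrite prode_ge0.
  rewrite (ih (fun i => g (lift ord0 i)))//.
  over.
rewrite ge0_integralZr//; by rewrite prode_ge0// => i _; exact: integral_ge0.
Qed.

End tuple_tonelli.

(** * Measurability of the kernel *)

Section kernel_measurability.
Context {R : realType} {n : nat}.
Local Notation Rn := 'rV[R]_n.

(** A preimage is a countable union of fibres of [h], whatever [g] is. This is how values of the
    kernel at grid points become measurable before the kernel itself is known to be. *)
Lemma measurable_comp_countable d d' (T : measurableType d) (Z : countType)
    (U : measurableType d') (h : T -> Z) (g : Z -> U) :
  (forall z, measurable (h @^-1` [set z])) -> measurable_fun setT (g \o h).
Proof.
move=> mh _ Y mY; rewrite setTI.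
rewrite (_ : _ @^-1` _ = \bigcup_k
    (if unpickle k is Some z then (if `[< Y (g z) >] then h @^-1` [set z] else set0) else set0)).
  apply: bigcup_measurable => k _; case: unpickle => // z; by case: ifP.
apply/seteqP; split => t /=.
  move=> Yt; exists (pickle (h t)) => //; rewrite pickleK.
  by rewrite (asboolT Yt).
by move=> [k _]; case: unpickle => // z; case: ifPn => // /asboolP Yz hz; rewrite hz.
Qed.

Definition grid_index (N : nat) m (y : m.-tuple Rn) : {ffun 'I_m * 'I_n -> int} :=
  [ffun ij => Num.floor (N.+1%:R * tnth y ij.1 ord0 ij.2)].

Definition grid_point (N : nat) m (z : {ffun 'I_m * 'I_n -> int}) : m.-tuple Rn :=
  [tuple \row_j ((z (i, j))%:~R / N.+1%:R) | i < m].

Lemma measurable_grid_index N m (z : {ffun 'I_m * 'I_n -> int}) :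
  measurable (@grid_index N m @^-1` [set z] : set (m.-tuple Rn)).
Proof.
rewrite (_ : _ @^-1` _ = \bigcap_(ij in [set` {: 'I_m * 'I_n}])
   ((fun y : m.-tuple Rn => N.+1%:R * tnth y ij.1 ord0 ij.2) @^-1`
     `[(z ij)%:~R, (z ij + 1)%:~R[%classic)).
  apply: fin_bigcap_measurable => // ij _.
  rewrite -[X in measurable X]setTI.
  have : measurable_fun setT (fun y : m.-tuple Rn => N.+1%:R * tnth y ij.1 ord0 ij.2).
    apply: measurable_funM => //.
    apply: (measurableT_comp (f := fun x : Rn => x ord0 ij.2)).
      exact: measurable_coord.
    exact: measurable_tnth.
  by apply.
apply/seteqP; split => y /=.
  move=> <- ij _ /=; rewrite in_itv/= ffunE.
  by rewrite floor_le floorD1_gt.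
move=> h; apply/ffunP => ij; rewrite ffunE; apply: floor_def.
by have := h ij erefl; rewrite /= in_itv.
Qed.

Lemma grid_point_near N m (y : m.-tuple Rn) i :
  enorm (tnth (grid_point N (grid_index N y)) i - tnth y i) <= n%:R / N.+1%:R.
Proof.
apply: le_trans (enorm_le_sum _) _.
apply: (@le_trans _ _ (\sum_(j < n) N.+1%:R^-1)); last first.
  by rewrite sumr_const card_ord -[X in X <= _]mulr_natl.
apply: ler_sum => j _; rewrite tnth_mktuple !mxE ffunE /=.
set t := tnth y i ord0 j; have N0 : 0 < N.+1%:R :> R by [].
have h1 := floor_le (N.+1%:R * t); have h2 := floorD1_gt (N.+1%:R * t).
move: (Num.floor _) h1 h2 => f h1; rewrite intrD => h2.
rewrite (_ : _ - t = (f%:~R - N.+1%:R * t) / N.+1%:R); last by field; rewrite gt_eqF.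
rewrite normrM [X in _ * X]ger0_norm ?invr_ge0 ?ler0n// -[leRHS]mul1r ler_pM2r ?invr_gt0//.
by rewrite ler_norml; apply/andP; split; lra.
Qed.

Lemma measurable_off_diagonal m :
  measurable [set y : m.+1.-tuple Rn | off_diagonal y].
Proof.
rewrite (_ : [set y | _] = \bigcup_(kl in [set` {: ('I_m.+1 * 'I_m.+1) * 'I_n}])
   ((fun y : m.+1.-tuple Rn => tnth y kl.1.1 ord0 kl.2 - tnth y kl.1.2 ord0 kl.2) @^-1` [set~ 0])).
  apply: fin_bigcup_measurable => // kl _.
  have mt i : measurable_fun setT (fun y : m.+1.-tuple Rn => tnth y i ord0 kl.2).
    apply: (measurableT_comp (f := fun x : Rn => x ord0 kl.2)).
      exact: measurable_coord.
    exact: measurable_tnth.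
  have : measurable_fun setT (fun y : m.+1.-tuple Rn =>
     tnth y kl.1.1 ord0 kl.2 - tnth y kl.1.2 ord0 kl.2) by exact: measurable_funB.
  rewrite -[X in measurable X]setTI; apply => //.
  by apply: measurableC; exact: measurable_set1.
apply/seteqP; split => y /=.
  move=> [k [l /eqP kl]].
  have [j /eqP hj] : exists j, tnth y k ord0 j != tnth y l ord0 j.
    apply: contrapT => /forallNP h; apply: kl; apply/rowP => j.
    by apply/eqP/negPn/negP; exact: h.
  exists ((k, l), j) => //= /eqP; by rewrite subr_eq0 => /eqP.
move=> [[[k l] j] _ /= h]; exists k, l; apply/negP => /eqP kl.
by apply: h; rewrite kl subrr.
Qed.

Variable m : nat.
Implicit Types (K : m.+1.-tuple Rn -> R).

(* Nothing is known about a CZ kernel on the diagonal, not even measurability. *)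
Definition off_diag_ext K (y : m.+1.-tuple Rn) : R :=
  if `[< off_diagonal y >] then K y else 0.

Lemma off_diag_extE K y : off_diagonal y -> off_diag_ext K y = K y.
Proof. by move=> h; rewrite /off_diag_ext asboolT. Qed.

Lemma sum_dist_ge (y : m.+1.-tuple Rn) k l : enorm (tnth y k - tnth y l) <= sum_dist y.
Proof.
rewrite /sum_dist (bigD1 k)//= (bigD1 l)//= -addrA lerDl addr_ge0//.
  by rewrite sumr_ge0// => i _; exact: enorm_ge0.
by rewrite sumr_ge0// => i _; rewrite sumr_ge0// => j _; exact: enorm_ge0.
Qed.

Lemma enorm_gt0 (x y : Rn) : x != y -> 0 < enorm (x - y).
Proof.
move=> xy; rewrite lt_neqAle enorm_ge0 andbT eq_sym; apply: contra_neq xy => h.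
by apply/eqP; rewrite -subr_eq0; apply/eqP; exact: enorm_eq0.
Qed.

Lemma enorm_gt0_neq (x y : Rn) : 0 < enorm (x - y) -> x != y.
Proof. by apply: contraTneq => ->; rewrite subrr enorm0 ltxx. Qed.

Section continuity.
Variables (K : m.+1.-tuple Rn -> R) (C eps : R) (y : m.+1.-tuple Rn) (k0 l0 : 'I_m.+1).
Hypotheses (C0 : 0 < C) (eps0 : 0 < eps).
Hypothesis K_reg : forall (i : 'I_m.+1) (y y' : m.+1.-tuple Rn), off_diagonal y ->
      (forall k, k != i -> tnth y' k = tnth y k) ->
      enorm (tnth y i - tnth y' i) <=
        2^-1 * \big[Num.max/0]_(k < m.+1) enorm (tnth y i - tnth y k) ->
      `|K y - K y'| <= C * enorm (tnth y i - tnth y' i) `^ eps /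
                       sum_dist y `^ ((m * n)%:R + eps).
Let D := enorm (tnth y k0 - tnth y l0).
Hypothesis D0 : 0 < D.

(** The regularity condition moves one point at a time. The path from [y] to [z] runs through the
    tuples [w j], whose first [j] points are those of [z]; the points [k0] and [l0] keep a distance
    of at least [D / 2] all along. *)
Lemma CZ_kernel_near (z : m.+1.-tuple Rn) (e : R) : 0 <= e -> e <= D / 8 ->
  (forall i, enorm (tnth z i - tnth y i) <= e) ->
  `|K y - K z| <= m.+1%:R * (C * e `^ eps / (D / 2) `^ ((m * n)%:R + eps)).
Proof.
move=> e0 eD ze.
pose w (j : nat) : m.+1.-tuple Rn := [tuple if (i < j)%N then tnth z i else tnth y i | i < m.+1].
have w0 : w 0%N = y by apply: eq_from_tnth => i; rewrite tnth_mktuple.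
have wm : w m.+1 = z by apply: eq_from_tnth => i; rewrite tnth_mktuple ltn_ord.
have wy j i : enorm (tnth (w j) i - tnth y i) <= e.
  by rewrite tnth_mktuple; case: ifP => // _; rewrite subrr enorm0.
have wD j : D / 2 <= enorm (tnth (w j) k0 - tnth (w j) l0).
  have h1 := enorm_dist_triangle (tnth (w j) k0) (tnth y k0) (tnth y l0).
  have h2 := enorm_dist_triangle (tnth (w j) l0) (tnth (w j) k0) (tnth y l0).
  rewrite [enorm (tnth y k0 - tnth (w j) k0)]enorm_distC -/D in h1.
  have := wy j k0; have := wy j l0; have := D0; lra.
have step (j : nat) : (j < m.+1)%N ->
    `|K (w j) - K (w j.+1)| <= C * e `^ eps / (D / 2) `^ ((m * n)%:R + eps).
  move=> jm; pose i := Ordinal jm.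
  have wji : tnth (w j) i = tnth y i by rewrite tnth_mktuple ltnn.
  have wj1i : tnth (w j.+1) i = tnth z i by rewrite tnth_mktuple ltnSn.
  have dle : enorm (tnth (w j) i - tnth (w j.+1) i) <= e.
    by rewrite wji wj1i enorm_distC.
  apply: le_trans (K_reg (i := i) _ _ _) _.
  - by exists k0, l0; apply: enorm_gt0_neq; have := wD j; have := D0; lra.
  - move=> k ki; rewrite !tnth_mktuple ltnS leq_eqVlt.
    by rewrite (_ : (k == j :> nat) = false)//; apply: contraNF ki => /eqP kj; apply/eqP/val_inj.
  (* One of the points [k0], [l0] of [w j] is at distance at least [D / 4] from the moving point, so
     a displacement up to [D / 8] is allowed: this is the bound on [e]. *)
  - apply: le_trans dle _.
    have h1 := @le_bigmax _ _ _ 0 (fun k => enorm (tnth (w j) i - tnth (w j) k)) k0.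
    have h2 := @le_bigmax _ _ _ 0 (fun k => enorm (tnth (w j) i - tnth (w j) k)) l0.
    have := enorm_dist_triangle (tnth (w j) i) (tnth (w j) k0) (tnth (w j) l0).
    rewrite [enorm (tnth (w j) k0 - tnth (w j) i)]enorm_distC.
    move: h1 h2; move: (\big[_/_]_(_ < _) _) => M /= h1 h2 h3; have := wD j; have := D0; lra.
  - apply: ler_pM.
    + by rewrite mulr_ge0 ?powR_ge0// ltW.
    + by rewrite invr_ge0 powR_ge0.
    + rewrite ler_pM2l//; apply: (ge0_ler_powR (ltW eps0)); rewrite ?nnegrE ?enorm_ge0//.
    + rewrite lef_pV2 ?posrE ?powR_gt0//; last 2 first.
      * by apply: lt_le_trans (sum_dist_ge _ k0 l0); have := wD j; have := D0; lra.
      * by have := D0; lra.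
      apply: ge0_ler_powR; rewrite ?nnegrE.
      * by rewrite addr_ge0 ?ler0n ?(ltW eps0).
      * by have := D0; lra.
      * by apply: le_trans (sum_dist_ge _ k0 l0); exact: enorm_ge0.
      * by apply: le_trans (sum_dist_ge _ k0 l0).
suff H j : (j <= m.+1)%N -> `|K y - K (w j)| <= j%:R * (C * e `^ eps / (D / 2) `^ ((m * n)%:R + eps)).
  by have := H m.+1 (leqnn _); rewrite wm.
elim: j => [|j ih] jm; first by rewrite w0 subrr normr0 mul0r.
rewrite -addn1 natrD mulrDl mul1r.
have -> : K y - K (w (j + 1)%N) = (K y - K (w j)) + (K (w j) - K (w j.+1)) by rewrite addn1; ring.
apply: le_trans (ler_normD _ _) _; apply: lerD; first by apply: ih; exact: ltnW.
exact: step.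
Qed.

End continuity.

(** Off the diagonal the kernel is continuous, so the extension is the pointwise limit of the values
    of [K] at grid points of mesh [1 / N.+1], cut off by the indicator of the off-diagonal set. A
    grid point may fall on the diagonal, but not once the mesh is small against [D]. *)
Lemma measurable_off_diag_ext K : CZ_kernel K -> measurable_fun setT (off_diag_ext K).
Proof.
move=> [C [eps [C0 eps0 _ K_reg]]].
pose h N (y : m.+1.-tuple Rn) : R := K (grid_point N (grid_index N y)) *
   \1_[set y : m.+1.-tuple Rn | off_diagonal y] y.
apply: (@measurable_fun_cvg _ _ _ _ h) => [N|y _].
  apply: measurable_funM.
    rewrite (_ : (fun y => _) = (K \o @grid_point N m.+1) \o @grid_index N m.+1)//.
    by apply: measurable_comp_countable => z; exact: measurable_grid_index.
  by apply: measurable_indic; exact: measurable_off_diagonal.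
rewrite /h /off_diag_ext indicE; case: asboolP => [yo|yo]; last first.
  by rewrite memNset//; under eq_fun do rewrite mulr0; exact: cvg_cst.
rewrite mem_set//; under eq_fun do rewrite mulr1.
have [k0 [l0 /enorm_gt0 D0]] := yo.
set D := enorm _ in D0.
pose e (N : nat) : R := n%:R / N.+1%:R.
have e_cvg : e N @[N --> \oo] --> 0.
  rewrite -[X in _ --> X](mulr0 n%:R); apply: cvgMl_tmp; exact: cvg_harmonic.
pose b N := m.+1%:R * (C * e N `^ eps / (D / 2) `^ ((m * n)%:R + eps)).
have b_cvg : b N @[N --> \oo] --> 0.
  rewrite -[X in _ --> X](mulr0 m.+1%:R); apply: cvgMl_tmp.
  rewrite -[X in _ --> X](mul0r ((D / 2) `^ ((m * n)%:R + eps))^-1); apply: cvgMr_tmp.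
  rewrite -[X in _ --> X](mulr0 C); apply: cvgMl_tmp.
  rewrite -[X in _ --> X](@powR0 _ eps) ?gt_eqF//; apply: cvg_powR => // N.
  by rewrite divr_ge0.
apply/cvgrPdist_le => d d0; near=> N.
apply: (@le_trans _ _ (b N)).
  apply: (@CZ_kernel_near K C eps y k0 l0) => //.
  - by rewrite divr_ge0.
  - near: N; apply: (cvgr_le 0) => //; exact: divr_gt0.
  - by move=> i; exact: grid_point_near.
near: N; exact: (cvgr_le 0).
Unshelve. all: by end_near.
Qed.

Lemma off_diag_ext_le K C : (forall y, off_diagonal y -> `|K y| <= C / sum_dist y ^+ (m * n)) ->
  0 < C -> forall (y : m.+1.-tuple Rn) k l (dl : R), 0 < dl ->
  dl <= enorm (tnth y k - tnth y l) -> `|off_diag_ext K y| <= C / dl ^+ (m * n).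
Proof.
move=> hK C0 y k l dl dl0 dle.
have yo : off_diagonal y by exists k, l; apply: enorm_gt0_neq; exact: lt_le_trans dle.
rewrite off_diag_extE//; apply: le_trans (hK y yo) _.
have S0 : dl <= sum_dist y by apply: le_trans dle (sum_dist_ge _ _ _).
rewrite ler_pM2l// lef_pV2 ?posrE ?exprn_gt0//; last exact: lt_le_trans S0.
by apply: lerXn2r => //; rewrite nnegrE ltW//; exact: lt_le_trans S0.
Qed.

End kernel_measurability.

Section parametric_integral.
Context d1 d2 (T1 : measurableType d1) (T2 : measurableType d2) (R : realType).
Variable m2 : {sigma_finite_measure set T2 -> \bar R}.

(** The positive and negative parts are measurable in [x] by Tonelli and [fine] is measurable, so
    the claim holds at all [x], integrable section or not. *)
Lemma measurable_Rintegral_param (G : T1 * T2 -> R) : measurable_fun setT G ->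
  measurable_fun setT (fun x => \int[m2]_y G (x, y)).
Proof.
move=> mG; rewrite /Rintegral.
apply: (measurableT_comp (f := @fine R)) => //.
under eq_fun do rewrite integralE.
have mE : measurable_fun setT (EFin \o G) by exact/measurable_EFinP.
apply: emeasurable_funB.
  rewrite (_ : (fun x => _) = fubini_F m2 ((EFin \o G)^\+)%E).
    apply: measurable_fun_fubini_tonelli_F; first exact: measurable_funepos.
    by move=> z; exact: funepos_ge0.
  by apply/funext => x; apply: eq_integral => y _; rewrite /= !funeposE.
rewrite (_ : (fun x => _) = fubini_F m2 ((EFin \o G)^\-)%E).
  apply: measurable_fun_fubini_tonelli_F; first exact: measurable_funeneg.
  by move=> z; exact: funeneg_ge0.
by apply/funext => x; apply: eq_integral => y _; rewrite /= !funenegE.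
Qed.

End parametric_integral.

(** * Functions whose integrals against all bumps vanish *)

Section fundamental_lemma.
Context {R : realType} {n : nat}.
Local Notation Rn := 'rV[R]_n.
Local Notation mu := (@lebesgueRn R n).
Variables (pa pb : 'I_n -> R) (D : Rn -> R).
Local Notation P := (obox pa pb).
Hypothesis mD : measurable_fun setT D.
Hypothesis iD : mu.-integrable P (EFin \o D).

Let iD1 : mu.-integrable setT (fun x => (`|D x| * \1_P x)%:E).
Proof.
have := iD; rewrite integrable_mkcond; last exact: measurable_obox.
move=> /integrable_abse; apply: eq_integrable => // x _ /=.
rewrite patchE indicE; case: (x \in P) => /=; first by rewrite mulr1.
by rewrite mulr0 normr0.
Qed.

Let iDg (g : Rn -> R) (M : R) : measurable_fun setT g ->(forall x, `|g x| <= M * \1_P x) ->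
  mu.-integrable setT (fun x => (D x * g x)%:E).
Proof.
move=> mg gM; apply: (le_integrable measurableT _ _ (integrableZl measurableT M iD1)).
  by apply/measurable_EFinP; exact: measurable_funM.
move=> x _ /=; rewrite lee_fin normrM mulrCA.
rewrite [leRHS]ger0_norm.
  by rewrite ler_wpM2l.
by rewrite mulr_ge0//; apply: le_trans (gM x).
Qed.

(** The functions [g] whose integral against [D] vanishes satisfy the hypotheses of the monotone
    class argument. So the sign of [D] on [P] is among them, and the integral of [|D|] over [P] is
    0. *)
Lemma fundamental_lemma :
  (forall a b k, obox a b `<=` P -> \int[mu]_x (D x * box_bump a b k x)%:E = 0)%E ->
  {ae mu, forall x, P x -> D x = 0}.
Proof.
move=> D_bump.
pose V (g : Rn -> R) := [/\ measurable_fun setT g,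
  exists M : R, forall x, `|g x| <= M * \1_P x &
  (\int[mu]_x (D x * g x)%:E = 0)%E].
have VV (g : Rn -> R) (M : R) : measurable_fun setT g -> (forall x, `|g x| <= M * \1_P x) -> V g.
  apply: bounded_monotone_class => {g M}.
  - move=> a b k sP; split; [exact: measurable_box_bump| |exact: D_bump].
    exists 1 => x; apply: le_trans (box_bump_norm_le1 _ _ _ _) _.
    rewrite mul1r !indicE ler_nat; case: (boolP (x \in obox a b)) => //.
    by move=> /set_mem/sP/mem_set ->.
  - move=> c g h [mg [M gM] g0] [mh [N hN] h0].
    have mcg : measurable_fun setT (fun x => c * g x) by exact: measurable_funM.
    have cgM x : `|c * g x| <= (`|c| * M) * \1_P x by rewrite normrM -mulrA ler_wpM2l.
    split; first exact: measurable_funD.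
      exists (`|c| * M + N) => x; rewrite mulrDl.
      by apply: le_trans (ler_normD _ _) _; rewrite lerD.
    rewrite (eq_integral (fun x => (c%:E * (D x * g x)%:E + (D x * h x)%:E)%E)); last first.
      by move=> x _; rewrite -EFinM -EFinD; congr EFin; ring.
    rewrite integralD//=; last 2 first.
    + exact: (integrableZl _ _ (iDg mg gM)).
    + exact: iDg mh hN.
    rewrite integralZl//; last exact: iDg mg gM.
    by rewrite g0 h0 mule0 adde0.
  - move=> g_ g M Vg gM gg.
    have mg_ k : measurable_fun setT (g_ k) by have [] := Vg k.
    have mg : measurable_fun setT g by apply: (measurable_fun_cvg mg_) => x _; exact: gg.
    split => //.
      exists M => x; have cx : `|g_ k x| @[k --> \oo] --> `|g x| by exact: cvg_norm.
      rewrite -(cvg_lim _ cx)//; apply: limr_le; [by apply/cvg_ex; exists (`|g x|)|].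
      by apply: nearW => k; exact: gM.
    have [] := @dominated_convergence _ _ _ mu setT measurableT
       (fun k x => (D x * g_ k x)%:E) (fun x => (D x * g x)%:E)
       (fun x => M%:E * (`|D x| * \1_P x)%:E)%E.
    + by move=> k; apply/measurable_EFinP; exact: measurable_funM.
    + by apply/measurable_EFinP; exact: measurable_funM.
    + apply: nearW => x _; apply: cvg_EFin; first exact: nearW.
      by apply: cvgMl_tmp; exact: gg.
    + exact: integrableZl.
    + apply: nearW => x k _; rewrite /= lee_fin normrM mulrCA.
      by rewrite ler_wpM2l.
    move=> _ _ h; rewrite -(cvg_lim _ h)//.
    rewrite (_ : [sequence _]_k = fun=> 0%E); first exact: lim_cst.
    by apply/funext => k /=; have [] := Vg k.
have [] := VV (fun x => Num.sg (D x) * \1_P x) 1.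
- apply: measurable_funM; last by apply: measurable_indic; exact: measurable_obox.
  rewrite (_ : (fun x => _) = (fun x => \1_(D @^-1` `]0, +oo[) x - \1_(D @^-1` `]-oo, 0[) x)).
    apply: measurable_funB; apply: measurable_indic; rewrite -[X in measurable X]setTI;
    by apply: mD.
  apply/funext => x; rewrite !indicE.
  have -> : (x \in D @^-1` `]0, +oo[%classic) = (0 < D x).
    by apply/idP/idP => [/set_mem|h]; [|apply/mem_set]; rewrite /= in_itv/= andbT.
  have -> : (x \in D @^-1` `]-oo, 0[%classic) = (D x < 0).
    by apply/idP/idP => [/set_mem|h]; [|apply/mem_set]; rewrite /= in_itv/=.
  by case: (ltgtP (D x) 0) => [h|h|->]; rewrite ?(ltr0_sg h) ?(gtr0_sg h) ?sgr0/= ?subr0 ?sub0r ?subrr.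
- move=> x; rewrite mul1r normrM normr_sg [X in _ * X]ger0_norm ?indicE ?ler0n//.
  by rewrite ler_piMl// ?ler0n// lern1 leq_b1.
move=> _ _ h.
have mDP : measurable_fun setT (fun x => (D x * (Num.sg (D x) * \1_P x))%:E).
  rewrite (_ : (fun x => _) = (fun x => (`|D x| * \1_P x)%:E)).
    by have /measurable_int := iD1.
  by apply/funext => x; rewrite mulrA normrEsg [D x * _]mulrC.
have /ae_eq_integral_abs := mDP; move=> /(_ mu measurableT)[+ _].
have -> : (\int[mu]_x `|(D x * (Num.sg (D x) * \1_P x))%:E| = 0)%E.
  rewrite -[RHS]h; apply: eq_integral => x _; rewrite gee0_abs// lee_fin.
  by rewrite mulrA [D x * _]mulrC -normrEsg mulr_ge0// indicE ler0n.
move=> /(_ erefl); apply: filterS => x /(_ I) [] + Px.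
rewrite indicE mem_set// mulr1 [D x * _]mulrC -normrEsg => /eqP.
by rewrite normr_eq0 => /eqP.
Qed.

End fundamental_lemma.

(** * Kernel representation of the extension *)

Section bounded_extension_tools.
Context {R : realType} {n m : nat}.
Local Notation Rn := 'rV[R]_n.
Local Notation mu := (@lebesgueRn R n).
Local Notation mum := (tuple_measure mu m).
Implicit Types f h : 'I_m -> Rn -> R.

Lemma in_Lp_Lp_le (s a : R) (f : Rn -> R) : 0 < s -> 0 <= a -> measurable_fun setT f ->
  Lp_le mu s^-1 setT f a <-> (Lnorm mu s%:E (EFin \o f) <= a%:E)%E.
Proof.
move=> s0 a0 mf; have := @Lp_leP _ _ _ mu s^-1 setT f a; rewrite invr_gt0 invrK patch_setT.
by apply.
Qed.

Lemma update_id f i g : update f i g i = g.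
Proof. by rewrite /update eqxx. Qed.

Lemma update_update f i g g' : update (update f i g) i g' = update f i g'.
Proof. by apply/funext => j; rewrite /update; case: eqP. Qed.

Lemma update_self f i : update f i (f i) = f.
Proof. by apply/funext => j; rewrite /update; case: eqP => // ->. Qed.

Variables (T : ('I_m -> Rn -> R) -> (Rn -> R) -> R) (Te : ('I_m -> Rn -> R) -> Rn -> R).
Hypothesis T_Te : bounded_extension T Te.

Lemma extension_bound (s : 'I_m -> R) : (0 < m)%N -> (forall i, 1 < s i) ->
  exists2 C : R, 0 < C & forall f (a : 'I_m -> R), (forall i, measurable_fun setT (f i)) ->
    (forall i, 0 <= a i) -> (forall i, Lp_le mu (s i)^-1 setT (f i) (a i)) ->
    measurable_fun setT (Te f) /\
    Lp_le mu (\sum_i (s i)^-1) setT (Te f) (C * \prod_i a i).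
Proof.
move=> m0 s1; have [_ /(_ s s1)[_ [C hC]]] := T_Te.
have S0 : 0 < \sum_i (s i)^-1.
  rewrite (bigD1 (Ordinal m0))//= ltr_pwDl ?invr_gt0 ?(lt_trans _ (s1 _))//.
  by rewrite sumr_ge0// => i _; rewrite invr_ge0 ltW// (lt_trans _ (s1 _)).
(* The constant in [bounded_extension] carries no sign. *)
exists (`|C| + 1); first by rewrite ltr_wpDl.
move=> f a mf a0 fa.
have fL i : (Lnorm mu (s i)%:E (EFin \o f i) <= (a i)%:E)%E.
  by apply/in_Lp_Lp_le => //; rewrite (lt_trans _ (s1 _)).
have fin i : in_Lp (s i) (f i) by split => //; exact: le_lt_trans (fL i) (ltry _).
have [[mTe Tefin] hb] := hC f fin; split => //.
rewrite -[X in Lp_le _ X]invrK; apply/in_Lp_Lp_le => //; first by rewrite invr_gt0.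
  by rewrite mulr_ge0 ?addr_ge0// prodr_ge0.
apply: le_trans hb _; rewrite lee_fin.
apply: (@le_trans _ _ (`|C| * \prod_i a i)); last first.
  by rewrite ler_wpM2r ?prodr_ge0// lerDl.
have P0 : 0 <= \prod_(i < m) fine (Lnorm mu (s i)%:E (EFin \o f i)).
  by apply: prodr_ge0 => i _; rewrite fine_ge0// Lnorm_ge0.
apply: (@le_trans _ _ (`|C| * \prod_(i < m) fine (Lnorm mu (s i)%:E (EFin \o f i)))).
  by rewrite ler_wpM2r// ler_norm.
rewrite ler_wpM2l//; apply: ler_prod => i _; rewrite fine_ge0 ?Lnorm_ge0//=.
rewrite -lee_fin fineK// ge0_fin_numE ?Lnorm_ge0//.
by have [] := fin i.
Qed.

Lemma extension_linear (s : 'I_m -> R) f i (a : R) (g g' : Rn -> R) :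
  (forall i, 1 < s i) -> (forall j, in_Lp (s j) (f j)) -> in_Lp (s i) g -> in_Lp (s i) g' ->
  {ae mu, forall x, Te (update f i (fun x => a * g x + g' x)) x =
    a * Te (update f i g) x + Te (update f i g') x}.
Proof.
move=> s1 fs gs gs'; have [_ /(_ s s1)[+ _]] := T_Te.
move=> /(_ (update f i g) i a g').
rewrite update_id !update_update; apply => // j.
by rewrite /update; case: eqP => // ->.
Qed.

End bounded_extension_tools.

Section representation_tools.
Context {R : realType} {n m : nat}.
Local Notation Rn := 'rV[R]_n.
Local Notation mu := (@lebesgueRn R n).
Local Notation mum := (tuple_measure mu m).
Implicit Types (h : 'I_m -> Rn -> R) (g : Rn -> R).

(** By [|g| <= |g|^s + 1] on a set of finite measure. *)
Lemma L1_of_Lp (s : R) (U : set Rn) g : 1 <= s -> measurable U -> (mu U < +oo)%E ->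
  measurable_fun setT g -> (\int[mu]_x (`|g x| `^ s)%:E < +oo)%E ->
  (\int[mu]_(x in U) `|g x|%:E < +oo)%E.
Proof.
move=> s1 mU Uf mg gs.
apply: (@le_lt_trans _ _ (\int[mu]_(x in U) ((`|g x| `^ s)%:E + 1)%E)%E).
  apply: ge0_le_integral_sup => // x Ux.
    by rewrite adde_ge0// lee_fin powR_ge0.
  rewrite -EFinD lee_fin; have [g1|g1] := leP `|g x| 1.
    by rewrite (le_trans g1)// lerDr powR_ge0.
  rewrite (@le_trans _ _ (`|g x| `^ s))// ?lerDl//.
  by rewrite -[X in X <= _]powRr1// ler_powR// ltW.
have mgU : measurable_fun U (fun x => (`|g x| `^ s)%:E).
  by apply: measurable_funTS; exact: measurable_power.
rewrite ge0_integralD//.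
rewrite lte_add_pinfty//; last by rewrite integral_cst// mul1e.
apply: le_lt_trans gs; apply: ge0_le_integral_sup => // x _; by rewrite lee_fin powR_ge0.
Qed.

Definition supported_Lp (s : R) (U : set Rn) g : Prop :=
  [/\ measurable_fun setT g, forall x, ~ U x -> g x = 0 &
      (\int[mu]_x (`|g x| `^ s)%:E < +oo)%E].

Lemma supported_Lp_L1 s U g : 1 < s -> measurable U -> (mu U < +oo)%E ->
  supported_Lp s U g -> (\int[mu]_x `|g x|%:E < +oo)%E.
Proof.
move=> s1 mU Uf [mg gU gs].
rewrite (_ : (\int[mu]_x _)%E = (\int[mu]_(x in U) `|g x|%:E)%E).
  exact: L1_of_Lp (ltW s1) mU Uf mg gs.
rewrite [RHS]integral_mkcond; apply: eq_integral => x _; rewrite patchE.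
by case: ifPn => // /negP xU; rewrite gU ?normr0// => Ux; apply: xU; rewrite mem_set.
Qed.

Lemma Lp_le_fine s g : 0 < s -> (\int[mu]_x (`|g x| `^ s)%:E < +oo)%E ->
  Lp_le mu s^-1 setT g (fine (\int[mu]_x (`|g x| `^ s)%:E) `^ s^-1).
Proof.
move=> s0 gf; have I0 : (0 <= \int[mu]_x (`|g x| `^ s)%:E)%E.
  by apply: integral_ge0 => x _; rewrite lee_fin powR_ge0.
rewrite /Lp_le invrK -powRrM mulVf ?gt_eqF// powRr1 ?fine_ge0// fineK//.
by rewrite ge0_fin_numE.
Qed.

Lemma supported_Lp_in_Lp s U g : 0 < s -> supported_Lp s U g -> in_Lp s g.
Proof.
move=> s0 [mg _ gs]; split; first exact: mg.
apply: (@le_lt_trans _ _ (fine (\int[mu]_x (`|g x| `^ s)%:E) `^ s^-1)%:E); last exact: ltry.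
apply/in_Lp_Lp_le; [exact: s0|exact: powR_ge0|exact: mg|exact: Lp_le_fine].
Qed.

Lemma bounded_supported_Lp s (U : set Rn) g (M : R) : 0 < s -> measurable U -> (mu U < +oo)%E ->
  measurable_fun setT g -> (forall x, `|g x| <= M * \1_U x) -> supported_Lp s U g.
Proof.
move=> s0 mU Uf mg gM; split => //.
  by move=> x Ux; apply/eqP; rewrite -normr_le0; apply: le_trans (gM x) _; rewrite indicE memNset ?mulr0.
apply: (@le_lt_trans _ _ (\int[mu]_(x in U) (`|M| `^ s)%:E)%E).
  rewrite [leRHS]integral_mkcond; apply: ge0_le_integral_sup => // x _.
    by rewrite patchE; case: ifP; rewrite ?lee_fin ?powR_ge0.
  have := gM x; rewrite patchE indicE; case: (x \in U) => /=; rewrite ?mulr1 ?mulr0.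
    move=> h; rewrite lee_fin; apply: ge0_ler_powR; rewrite ?nnegrE ?(ltW s0)//.
    exact: le_trans h (ler_norm _).
  by rewrite normr_le0 => /eqP ->; rewrite normr0 powR0// gt_eqF.
by rewrite integral_cst// lte_mul_pinfty ?lee_fin ?powR_ge0.
Qed.

Lemma prod_update h i g (y : m.-tuple Rn) :
  \prod_(j < m) update h i g j (tnth y j) =
  g (tnth y i) * \prod_(j < m | j != i) h j (tnth y j).
Proof.
rewrite (bigD1 i)//= update_id; congr (_ * _); apply: eq_bigr => j ji.
by rewrite /update (negbTE ji).
Qed.

Lemma measurable_prod_tnth_fin h : (forall i, measurable_fun setT (h i)) ->
  measurable_fun setT (fun y : m.-tuple Rn => \prod_(i < m) h i (tnth y i)).
Proof.
move=> mh; apply: measurable_prod => i _.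
by apply: measurableT_comp => //; exact: measurable_tnth.
Qed.

Lemma integral_prod_tnth_norm h (c : 'I_m -> R) : (forall i, measurable_fun setT (h i)) ->
  (forall i, \int[mu]_x `|h i x|%:E = (c i)%:E)%E ->
  (\int[mum]_y `|\prod_(i < m) h i (tnth y i)|%:E = (\prod_i c i)%:E)%E.
Proof.
move=> mh hc; rewrite -prodEFin -(eq_bigr _ (fun i _ => hc i)).
rewrite -(@integral_prod_tnth _ _ _ mu m (fun i x => `|h i x|%:E))//.
  by apply: eq_integral => y _; rewrite normr_prod prodEFin.
by move=> i; apply/measurable_EFinP; exact: measurableT_comp.
Qed.

Lemma integrable_prod_tnth h : (forall i, measurable_fun setT (h i)) ->
  (forall i, \int[mu]_x `|h i x|%:E < +oo)%E ->
  mum.-integrable setT (fun y => (\prod_(i < m) h i (tnth y i))%:E).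
Proof.
move=> mh hf; apply/integrableP; split.
  by apply/measurable_EFinP; exact: measurable_prod_tnth_fin.
rewrite (@integral_prod_tnth_norm h (fun i => fine (\int[mu]_x `|h i x|%:E)%E))// ?ltry// => i.
by rewrite fineK// ge0_fin_numE// integral_ge0.
Qed.

Variables (K : m.+1.-tuple Rn -> R).
Hypothesis CZ_K : CZ_kernel K.
Local Notation Kz := (off_diag_ext K).

Lemma kernel_bound : exists2 C : R, 0 < C & forall (x : Rn) (y : m.-tuple Rn) i (dl : R),
  0 < dl -> dl <= enorm (x - tnth y i) -> `|Kz [tuple of x :: y]| <= C / dl ^+ (m * n).
Proof.
have [C [eps [C0 _ hK _]]] := CZ_K; exists C => // x y i dl dl0 h.
apply: (@off_diag_ext_le _ _ _ K C hK C0 _ ord0 (lift ord0 i)) => //.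
by rewrite tnth0 tnthS.
Qed.

Lemma measurable_kernel_section x : measurable_fun setT (fun y : m.-tuple Rn => Kz [tuple of x :: y]).
Proof.
apply: (measurableT_comp (f := Kz)); first exact: measurable_off_diag_ext.
rewrite (_ : (fun y => _) = @tcons _ Rn m \o (fun y => (x, y)))//.
apply: measurableT_comp; first exact: measurable_tcons.
exact: measurable_fun_pair.
Qed.

Lemma measurable_kernel_joint : measurable_fun setT (fun z : Rn * m.-tuple Rn => Kz [tuple of z.1 :: z.2]).
Proof.
apply: (measurableT_comp (f := Kz) (g := @tcons _ Rn m)); first exact: measurable_off_diag_ext.
exact: measurable_tcons.
Qed.

Definition kint h (x : Rn) : R :=
  \int[mum]_y (Kz [tuple of x :: y] * \prod_(i < m) h i (tnth y i)).

Lemma measurable_kint h : (forall i, measurable_fun setT (h i)) -> measurable_fun setT (kint h).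
Proof.
move=> mh; apply: (@measurable_Rintegral_param _ _ _ _ _ mum
  (fun z : Rn * m.-tuple Rn => Kz [tuple of z.1 :: z.2] * \prod_(i < m) h i (tnth z.2 i))).
apply: measurable_funM; first exact: measurable_kernel_joint.
apply: (measurableT_comp (f := fun y : m.-tuple Rn => \prod_(i < m) h i (tnth y i))) => //.
exact: measurable_prod_tnth_fin.
Qed.

Section separated.
Variables (x : Rn) (j0 : 'I_m) (dl : R).
Hypothesis dl0 : 0 < dl.

(** A single variable at distance [dl] from [x] bounds the kernel, because [sum_dist] dominates each
    single distance; where [h j0] vanishes, both sides are 0. *)
Lemma separated_bound h : (forall y, h j0 y != 0 -> dl <= enorm (x - y)) ->
  forall C, (forall (y : m.-tuple Rn) i, dl <= enorm (x - tnth y i) ->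
     `|Kz [tuple of x :: y]| <= C / dl ^+ (m * n)) -> forall y : m.-tuple Rn,
  `|Kz [tuple of x :: y] * \prod_(i < m) h i (tnth y i)| <=
   C / dl ^+ (m * n) * `|\prod_(i < m) h i (tnth y i)|.
Proof.
move=> hsep C hC y; rewrite normrM.
have [h0|h0] := eqVneq (h j0 (tnth y j0)) 0.
  by rewrite (bigD1 j0)//= h0 mul0r normr0 !mulr0.
by rewrite ler_wpM2r//; apply: (hC y j0); exact: hsep.
Qed.

Lemma integrable_kint h : (forall i, measurable_fun setT (h i)) ->
  (forall i, \int[mu]_x `|h i x|%:E < +oo)%E ->
  (forall y, h j0 y != 0 -> dl <= enorm (x - y)) ->
  mum.-integrable setT (fun y => (Kz [tuple of x :: y] * \prod_(i < m) h i (tnth y i))%:E).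
Proof.
move=> mh hf hsep; have [C C0 hC] := kernel_bound.
apply: (le_integrable measurableT _ _ (integrableZl measurableT (C / dl ^+ (m * n))
   (integrable_prod_tnth mh hf))).
  apply/measurable_EFinP; apply: measurable_funM; first exact: measurable_kernel_section.
  exact: measurable_prod_tnth_fin.
move=> y _ /=; rewrite lee_fin.
apply: le_trans (separated_bound hsep (fun y i => hC x y i dl dl0) y) _.
by rewrite normrM ler_wpM2r// ler_norm.
Qed.

Lemma kint_linear h i (a : R) (g g' : Rn -> R) :
  (forall k, measurable_fun setT (h k)) -> measurable_fun setT g -> measurable_fun setT g' ->
  (forall k, \int[mu]_x `|h k x|%:E < +oo)%E ->
  (\int[mu]_x `|g x|%:E < +oo)%E -> (\int[mu]_x `|g' x|%:E < +oo)%E ->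
  (forall y, update h i g j0 y != 0 -> dl <= enorm (x - y)) ->
  (forall y, update h i g' j0 y != 0 -> dl <= enorm (x - y)) ->
  kint (update h i (fun z => a * g z + g' z)) x =
  a * kint (update h i g) x + kint (update h i g') x.
Proof.
move=> mh mg mg' hf gf gf' sg sg'.
have ig : mum.-integrable setT (fun y => (Kz [tuple of x :: y] * \prod_(j < m) update h i g j (tnth y j))%:E).
  by apply: integrable_kint => // j; rewrite /update; case: ifP.
have ig' : mum.-integrable setT (fun y => (Kz [tuple of x :: y] * \prod_(j < m) update h i g' j (tnth y j))%:E).
  by apply: integrable_kint => // j; rewrite /update; case: ifP.
rewrite /kint -RintegralZl// -RintegralD//; last exact: (integrableZl _ _ ig).
apply: eq_Rintegral => y _; rewrite !prod_update; ring.
Qed.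

(** Separation is asked of the majorant [w] and is inherited by every [g_ k]; the kernel is then
    bounded on the relevant set and a product with one factor [w] is an integrable majorant. *)
Lemma kint_dominated_cvg h i (g_ : nat -> Rn -> R) (g w : Rn -> R) :
  (forall k, measurable_fun setT (h k)) -> (forall k, measurable_fun setT (g_ k)) ->
  measurable_fun setT g -> measurable_fun setT w ->
  (forall k, \int[mu]_x `|h k x|%:E < +oo)%E -> (\int[mu]_x `|w x|%:E < +oo)%E ->
  (forall y, g_ k y @[k --> \oo] --> g y) -> (forall k y, `|g_ k y| <= w y) ->
  (forall y, update h i w j0 y != 0 -> dl <= enorm (x - y)) ->
  kint (update h i (g_ k)) x @[k --> \oo] --> kint (update h i g) x.
Proof.
move=> mh mg_ mg mw hf wf gc gw sw; have [C C0 hC] := kernel_bound.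
have mU u : measurable_fun setT u -> forall j, measurable_fun setT (update h i u j).
  by move=> mu0 j; rewrite /update; case: ifP.
have iw : mum.-integrable setT (fun y => (\prod_(j < m) update h i w j (tnth y j))%:E).
  by apply: integrable_prod_tnth; [exact: mU|move=> j; rewrite /update; case: ifP].
have [] := @dominated_convergence _ _ _ mum setT measurableT
  (fun k y => (Kz [tuple of x :: y] * \prod_(j < m) update h i (g_ k) j (tnth y j))%:E)
  (fun y => (Kz [tuple of x :: y] * \prod_(j < m) update h i g j (tnth y j))%:E)
  (fun y => (C / dl ^+ (m * n))%:E * `|(\prod_(j < m) update h i w j (tnth y j))%:E|)%E.
- move=> k; apply/measurable_EFinP; apply: measurable_funM; first exact: measurable_kernel_section.
  by apply: measurable_prod_tnth_fin; exact: mU.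
- apply/measurable_EFinP; apply: measurable_funM; first exact: measurable_kernel_section.
  by apply: measurable_prod_tnth_fin; exact: mU.
- apply: nearW => y _; apply: cvg_EFin; first exact: nearW.
  apply: cvgMl_tmp; under eq_fun do rewrite /= prod_update; rewrite prod_update.
  by apply: cvgMr_tmp; exact: gc.
- apply: integrableZl => //; exact: integrable_abse.
- apply: nearW => y k _; rewrite /= lee_fin.
  have gk_sep z : update h i (g_ k) j0 z != 0 -> dl <= enorm (x - z).
    move=> hz; apply: sw; move: hz; rewrite /update; case: (j0 =P i) => [_|//].
    by apply: contraNneq => w0; have := gw k z; rewrite w0 normr_le0.
  apply: le_trans (separated_bound gk_sep (fun y i => hC x y i dl dl0) y) _.
  rewrite ler_wpM2l ?divr_ge0 ?exprn_ge0 ?(ltW C0) ?(ltW dl0)// !prod_update !normrM ler_wpM2r//.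
  by apply: le_trans (gw k _) _; exact: ler_norm.
move=> icv _ cv; rewrite /kint /Rintegral.
apply: fine_cvg; rewrite fineK; first exact: cv.
by apply: integrable_fin_num.
Qed.

End separated.

End representation_tools.

Section representation.
Context {R : realType} {n m : nat}.
Local Notation Rn := 'rV[R]_n.
Local Notation mu := (@lebesgueRn R n).
Local Notation mum := (tuple_measure mu m).
Variables (K : m.+1.-tuple Rn -> R) (T : ('I_m -> Rn -> R) -> (Rn -> R) -> R)
  (Te : ('I_m -> Rn -> R) -> Rn -> R).
Hypotheses (m_gt0 : (0 < m)%N) (CZ_T : CZ_integral K T) (T_Te : bounded_extension T Te).
Let CZ_K : CZ_kernel K. Proof. by have [] := CZ_T. Qed.
Local Notation Kz := (off_diag_ext K).
Local Notation kint := (kint K).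

Lemma lebesgueRn_obox_lty (a b : 'I_n -> R) : (mu (obox a b) < +oo)%E.
Proof.
pose a' i := Num.min (a i) (b i); pose b' i := Num.max (a i) (b i).
apply: (@le_lt_trans _ _ (mu (obox a' b'))).
  apply: le_measure; rewrite ?inE; try exact: measurable_obox.
  move=> x h i; have /andP[h1 h2] := h i.
  by rewrite /a' /b' gt_min lt_max h1 h2 orbT.
rewrite lebesgueRn_obox ?ltry// => i.
by rewrite /a' /b' ge_min le_max lexx.
Qed.

Lemma supp_box_bump_sub (a b a' b' : 'I_n -> R) k : obox a b `<=` obox a' b' ->
  supp (box_bump a b k) `<=` cbox a' b'.
Proof.
move=> sub; rewrite /supp.
rewrite [X in _ `<=` X](iffLR (closure_id _) (@cbox_closed _ _ a' b')).
apply: closureS => x /= xab; apply: obox_cbox; apply: sub.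
by apply: contrapT => /box_bump_eq0 h; move: xab; rewrite h eqxx.
Qed.

Lemma box_bump_supported (s : R) (a b a' b' : 'I_n -> R) k : 0 < s ->
  obox a b `<=` obox a' b' -> supported_Lp s (obox a' b') (box_bump a b k).
Proof.
move=> s0 sub; apply: (@bounded_supported_Lp _ _ _ _ _ 1) => //.
- exact: measurable_obox.
- exact: lebesgueRn_obox_lty.
- exact: measurable_box_bump.
- move=> x; rewrite mul1r; apply: le_trans (box_bump_norm_le1 _ _ _ _) _.
  rewrite !indicE ler_nat; case: (boolP (x \in obox a b)) => //.
  by move=> /set_mem/sub/mem_set ->.
Qed.

Variables (s : 'I_m -> R).
Hypotheses (s_gt1 : forall i, 1 < s i) (s_sum : \sum_i (s i)^-1 <= 1).
Let s_gt0 i : 0 < s i. Proof. exact: lt_trans (s_gt1 i). Qed.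
Let s_sum_gt0 : 0 < \sum_i (s i)^-1.
Proof.
rewrite (bigD1 (Ordinal m_gt0))//= ltr_pwDl ?invr_gt0//.
by rewrite sumr_ge0// => i _; rewrite invr_ge0 ltW.
Qed.

Lemma supported_extension (U : 'I_m -> set Rn) (f : 'I_m -> Rn -> R) :
  (forall i, supported_Lp (s i) (U i) (f i)) ->
  measurable_fun setT (Te f) /\
  (\int[mu]_x (`|Te f x| `^ (\sum_i (s i)^-1)^-1)%:E < +oo)%E.
Proof.
move=> fU; have [C C0 hC] := extension_bound T_Te m_gt0 s_gt1.
have [] := hC f (fun i => fine (\int[mu]_x (`|f i x| `^ s i)%:E)%E `^ (s i)^-1).
- by move=> i; have [] := fU i.
- by move=> i; exact: powR_ge0.
- by move=> i; have [_ _ fi] := fU i; exact: Lp_le_fine.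
by move=> mTe h; split => //; apply: le_lt_trans h _; exact: ltry.
Qed.

Variables (pa pb : 'I_n -> R) (ua ub : 'I_m -> 'I_n -> R) (j0 : 'I_m) (dl : R).
Hypothesis dl0 : 0 < dl.
Hypothesis sep : forall x y, cbox pa pb x -> cbox (ua j0) (ub j0) y -> dl <= enorm (x - y).
Local Notation P := (obox pa pb).
Local Notation U i := (obox (ua i) (ub i)).

Let represented (f : 'I_m -> Rn -> R) := {ae mu, forall x, P x -> Te f x = kint f x}.

Let L1 i g : supported_Lp (s i) (U i) g -> (\int[mu]_x `|g x|%:E < +oo)%E.
Proof.
apply: supported_Lp_L1 => //; first exact: measurable_obox.
exact: lebesgueRn_obox_lty.
Qed.

Let sepx (x : Rn) (g : Rn -> R) : P x -> (forall y, ~ U j0 y -> g y = 0) -> forall y, g y != 0 -> dl <= enorm (x - y).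
Proof.
move=> Px gU y gy; apply: sep; apply: obox_cbox => //.
by apply: contrapT => /gU g0; move: gy; rewrite g0 eqxx.
Qed.

Let upd_supported h i g : (forall j, supported_Lp (s j) (U j) (h j)) ->
  supported_Lp (s i) (U i) g -> forall j, supported_Lp (s j) (U j) (update h i g j).
Proof.
move=> hh hg j; rewrite /update; case: (j =P i) => [->|_]; [exact: hg|exact: hh].
Qed.

(** On [P] both sides are integrable: [Te f] because its exponent is at least 1, the kernel integral
    because it is bounded by separation. Bumps inside [P] are test functions to which the
    distributional kernel formula applies, so [fundamental_lemma] identifies the two. *)
Let represented_bumps (a b : 'I_m -> 'I_n -> R) (k : 'I_m -> nat) :
  (forall i, obox (a i) (b i) `<=` U i) ->
  represented (fun i => box_bump (a i) (b i) (k i)).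
Proof.
move=> sub; set f := fun i => _.
have fU i : supported_Lp (s i) (U i) (f i) by exact: box_bump_supported.
have mf i : measurable_fun setT (f i) by exact: measurable_box_bump.
have fL1 i : (\int[mu]_x `|f i x|%:E < +oo)%E by exact: L1 (fU i).
have [mTe Tef] := supported_extension fU.
have mk : measurable_fun setT (kint f) by exact: measurable_kint.
have mP : measurable P by exact: measurable_obox.
have Pf : (mu P < +oo)%E by exact: lebesgueRn_obox_lty.
have iTe : mu.-integrable P (EFin \o Te f).
  apply/integrableP; split; first by apply/measurable_EFinP; exact: measurable_funTS.
  by apply: L1_of_Lp mTe Tef => //; rewrite invf_ge1.
have [C C0 hC] := kernel_bound CZ_K.
pose B := C / dl ^+ (m * n) * \prod_i fine (\int[mu]_x `|f i x|%:E)%E.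
have kB x : P x -> `|kint f x| <= B.
  move=> Px.
  have sx : forall y, f j0 y != 0 -> dl <= enorm (x - y) by apply: sepx => // y; have [_ + _] := fU j0; apply.
  have ik := integrable_kint CZ_K dl0 mf fL1 sx.
  apply: le_trans (le_normr_Rintegral measurableT ik) _.
  rewrite /Rintegral -lee_fin fineK; last first.
    by apply: integrable_fin_num => //; exact: (integrable_abse ik).
  apply: (@le_trans _ _ (\int[mum]_y ((C / dl ^+ (m * n))%:E * `|\prod_(i < m) f i (tnth y i)|%:E))%E).
    apply: ge0_le_integral_sup => // y _.
      by rewrite -EFinM lee_fin mulr_ge0// divr_ge0 ?exprn_ge0 ?ltW.
    rewrite -EFinM lee_fin.
    exact: (separated_bound sx (fun y i => hC x y i dl dl0)).
  rewrite ge0_integralZl_EFin//; last 2 first.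
  - by apply/measurable_EFinP; apply: measurableT_comp => //; exact: measurable_prod_tnth_fin.
  - by rewrite divr_ge0 ?exprn_ge0 ?ltW.
  rewrite (@integral_prod_tnth_norm _ _ _ f (fun i => fine (\int[mu]_x `|f i x|%:E)%E))//.
  by move=> i; rewrite fineK// ge0_fin_numE// integral_ge0.
have ik : mu.-integrable P (EFin \o kint f).
  apply/integrableP; split; first by apply/measurable_EFinP; exact: measurable_funTS.
  apply: (@le_lt_trans _ _ (\int[mu]_(x in P) `|B|%:E)%E).
    by apply: ge0_le_integral_sup => // x Px; rewrite lee_fin (le_trans (kB x Px))// ler_norm.
  by rewrite integral_cst// lte_mul_pinfty ?lee_fin.
suff : {ae mu, forall x, P x -> Te f x - kint f x = 0}.
  by apply: filterS => x /[apply] /eqP; rewrite subr_eq0 => /eqP.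
apply: fundamental_lemma.
- exact: measurable_funB.
- exact: (integrableB mP iTe ik).
move=> a' b' k' subP; set ph := box_bump a' b' k'.
have tf i : test_function (f i) by exact: test_function_box_bump.
have tph : test_function ph by exact: test_function_box_bump.
have [Sb _] := T_Te.
have [iTp TE] := Sb f ph (fun i => test_function_schwartz (tf i)) (test_function_schwartz tph).
have [_ _ _ /(_ f ph tf tph)] := CZ_T.
(* Supports are closures, contained in closed boxes, which is why [sep] speaks of closed boxes.
   Being apart from the [j0]-th support is enough to avoid the intersection of all supports. *)
have dis : supp ph `<=` ~` \bigcap_i supp (f i).
  move=> x xph /(_ j0 Logic.I) xf.
  have := sep (supp_box_bump_sub subP xph) (supp_box_bump_sub (sub j0) xf).
  by rewrite subrr enorm0 leNgt dl0.
move=> /(_ dis); rewrite TE.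
(* [K] and [Kz] differ only on the diagonal, where the integrand is 0: if [ph x] and [f j0] at
   [y_j0] are nonzero, then [x] and [y_j0] are at distance at least [dl]. *)
have -> : \int[mu]_x (ph x * \int[mum]_y (K [tuple of x :: y] * \prod_(i < m) f i (tnth y i))) =
          \int[mu]_x (ph x * kint f x).
  apply: eq_Rintegral => x _; have [px|px] := eqVneq (ph x) 0; first by rewrite px !mul0r.
  congr (_ * _); apply: eq_Rintegral => y _.
  have [fy|fy] := eqVneq (f j0 (tnth y j0)) 0.
    by rewrite (bigD1 j0)//= fy mul0r !mulr0.
  congr (_ * _); rewrite off_diag_extE//.
  exists ord0, (lift ord0 j0); rewrite tnth0 tnthS; apply: enorm_gt0_neq.
  apply: lt_le_trans dl0 _; apply: sepx fy => //.
    by apply: contrapT => Px; move: px; rewrite /ph box_bump_eq0 ?eqxx// => /subP.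
  by have [_ + _] := fU j0.
have ipk : mu.-integrable setT (EFin \o (fun x => ph x * kint f x)).
  have iB : mu.-integrable setT (fun x => (B%:E * (\1_P x)%:E)%E).
    apply: integrableZl => //; apply/integrableP; split.
      by apply/measurable_EFinP; exact: measurable_indic.
    by under eq_integral do rewrite gee0_abs ?lee_fin//; rewrite integral_indic// setIT.
  apply: (le_integrable measurableT _ _ iB).
    by apply/measurable_EFinP; apply: measurable_funM => //; exact: measurable_box_bump.
  move=> x _ /=; rewrite lee_fin normrM.
  have [Px|Px] := pselect (P x); last first.
    by rewrite /ph box_bump_eq0 ?normr0 ?mul0r// => /subP.
  rewrite indicE mem_set// mulr1 -[leLHS]mulr1 mulrAC mulr1.
  rewrite -[leRHS]mul1r; apply: ler_pM => //.
    by apply: le_trans (box_bump_norm_le1 _ _ _ _) _; rewrite indicE lern1 leq_b1.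
  exact: le_trans (kB x Px) (ler_norm _).
move=> E0.
rewrite (eq_integral (fun x => (Te f x * ph x)%:E - (ph x * kint f x)%:E)%E); last first.
  by move=> x _; rewrite -EFinB; congr EFin; ring.
rewrite integralB//.
have f1 := integrable_fin_num measurableT iTp; have f2 := integrable_fin_num measurableT ipk.
by rewrite -(fineK f1) -(fineK f2) -EFinB; congr EFin; apply/eqP; rewrite subr_eq0; apply/eqP.
Qed.

(** Boundedness of the extension turns convergence of [g_ k] to [g] in L^(s_i) into convergence of
    [Te] in the target space, while the kernel integrals converge pointwise on [P];
    [integral_eq0_lim] shows that the limits agree. *)
Let represented_lim h i (g_ : nat -> Rn -> R) (g w : Rn -> R) :
  (forall j, supported_Lp (s j) (U j) (h j)) ->
  (forall k, measurable_fun setT (g_ k)) -> measurable_fun setT g ->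
  supported_Lp (s i) (U i) w ->
  (forall y, g_ k y @[k --> \oo] --> g y) -> (forall k y, `|g_ k y| <= w y) ->
  (forall k, represented (update h i (g_ k))) -> represented (update h i g).
Proof.
move=> hU mg_ mg wU gc gw rep; have [mw w0 wf] := wU.
have w_ge0 y : 0 <= w y by apply: le_trans (gw 0%N y).
have le_w (u : Rn -> R) : measurable_fun setT u -> (forall y, `|u y| <= w y) -> supported_Lp (s i) (U i) u.
  move=> mu0 uw; split; first exact: mu0.
    by move=> y Uy; apply/eqP; rewrite -normr_le0 -(w0 y Uy).
  apply: le_lt_trans wf; apply: ge0_le_integral_sup => // y _; rewrite ?lee_fin ?powR_ge0//.
  apply: (ge0_ler_powR (ltW (s_gt0 i))); rewrite ?nnegrE//.
  exact: le_trans (uw y) (ler_norm _).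
have g_U k : supported_Lp (s i) (U i) (g_ k) by exact: le_w.
have gle y : `|g y| <= w y.
  have cx : `|g_ k y| @[k --> \oo] --> `|g y| by exact: cvg_norm.
  rewrite -(cvg_lim _ cx)//; apply: limr_le; [by apply/cvg_ex; exists (`|g y|)|].
  exact: nearW.
have gU : supported_Lp (s i) (U i) g by exact: le_w.
have in_LpS j u : supported_Lp (s j) (U j) u -> in_Lp (s j) u by exact: supported_Lp_in_Lp.
pose D k x := Te (update h i g) x - Te (update h i (g_ k)) x.
have mTe u : supported_Lp (s i) (U i) u -> measurable_fun setT (Te (update h i u)).
  move=> uU; have [] := supported_extension (U := fun j => U j) (upd_supported hU uU); by [].
(* Linearity holds almost everywhere and for combinations [a * g + g'], hence the difference is
   written with the coefficient -1. *)
have DE k : {ae mu, forall x, D k x = Te (update h i (fun x => -1 * g_ k x + g x)) x}.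
  have := extension_linear T_Te (-1) s_gt1 (fun j => in_LpS j _ (hU j)) (in_LpS i _ (g_U k)) (in_LpS i _ gU).
  by apply: filterS => x ->; rewrite /D mulN1r addrC.
have [C C0 hC] := extension_bound T_Te m_gt0 s_gt1.
pose N j := (fine (\int[mu]_x (`|h j x| `^ s j)%:E)%E) `^ (s j)^-1.
pose I k := (\int[mu]_x (`|g x - g_ k x| `^ s i)%:E)%E.
have I0 k : (0 <= I k)%E by apply: integral_ge0 => x _; rewrite lee_fin powR_ge0.
have Icvg : I k @[k --> \oo] --> 0%E.
  apply: (powR_dominated_cvg _ mg_ mg mw) => //.
(* [fine] sends an infinite value to 0, so the bound [e k] is meaningful only where [I k] is finite,
   that is for large [k]. *)
have Ifin : \forall k \near \oo, I k \is a fin_num by have /fine_cvgP[] := Icvg.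
pose S := \sum_j (s j)^-1.
pose e k := C * ((fine (I k) `^ (s i)^-1) * \prod_(j | j != i) N j).
have e0 k : 0 <= e k.
  by rewrite mulr_ge0 ?(ltW C0)// mulr_ge0 ?powR_ge0// prodr_ge0// => j _; exact: powR_ge0.
have Dle k : I k \is a fin_num -> (\int[mu]_x (`|D k x| `^ S^-1)%:E <= (e k `^ S^-1)%:E)%E.
  move=> If; set u := update h i (fun x => -1 * g_ k x + g x).
  have mh j : measurable_fun setT (h j) by have [] := hU j.
  have mgg : measurable_fun setT (fun x => -1 * g_ k x + g x).
    by apply: measurable_funD => //; exact: measurable_funM.
  have [] := hC u (fun j => if j == i then fine (I k) `^ (s i)^-1 else N j).
  - by move=> j; rewrite /u /update; case: ifP.
  - by move=> j; case: ifP => _; exact: powR_ge0.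
  - move=> j; rewrite /u /update; case: (j =P i) => [->|_]; last first.
      by have [_ _ hj] := hU j; exact: Lp_le_fine.
    have IkE : I k = (\int[mu]_x (`|-1 * g_ k x + g x| `^ s i)%:E)%E.
      by apply: eq_integral => x _; rewrite mulN1r addrC.
    rewrite IkE; apply: Lp_le_fine; first exact: s_gt0.
    by rewrite -IkE -ge0_fin_numE.
  have PE (A : R) : \prod_j (if j == i then A else N j) = A * \prod_(j | j != i) N j.
    by rewrite (bigD1 i)//= eqxx; congr (_ * _); apply: eq_bigr => j /negbTE ->.
  move=> mTu; rewrite PE => Tu.
  apply: (@Lp_le_ae _ _ _ mu S setT (D k) (Te u)) => //.
  - by apply: measurable_funB; [exact: (mTe _ gU)|exact: (mTe _ (g_U k))].
  - by apply: filterS (DE k).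
have ecvg : (e k `^ S^-1)%:E @[k --> \oo] --> 0%E.
  apply: cvg_EFin; first exact: nearW.
  rewrite -(@powR0 _ S^-1) ?gt_eqF ?invr_gt0//; apply: cvg_powR; rewrite ?invr_gt0//.
  rewrite -[X in _ --> X](mulr0 C); apply: cvgMl_tmp.
  rewrite -[X in _ --> X](mul0r (\prod_(j | j != i) N j)); apply: cvgMr_tmp.
  rewrite -(@powR0 _ (s i)^-1) ?gt_eqF ?invr_gt0//; apply: cvg_powR; rewrite ?invr_gt0//.
    by move=> k; exact: fine_ge0.
  by have /fine_cvgP[] := Icvg.
have Dcvg : (\int[mu]_x (`|D k x| `^ S^-1)%:E)%E @[k --> \oo] --> 0%E.
  apply: (squeeze_cvge _ (cvg_cst 0%E) ecvg); near=> k; apply/andP; split.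
    by apply: integral_ge0 => x _; rewrite lee_fin powR_ge0.
  by apply: Dle; near: k.
suff : {ae mu, forall x, P x -> Te (update h i g) x - kint (update h i g) x = 0}.
  by apply: filterS => x /[apply] /eqP; rewrite subr_eq0 => /eqP.
apply: (integral_eq0_lim (D_ := D) _ _ Dcvg); rewrite ?invr_gt0//.
  by move=> k; apply: measurable_funB; [exact: (mTe _ gU)|exact: (mTe _ (g_U k))].
have repn : {ae mu, forall x, forall k, P x -> Te (update h i (g_ k)) x = kint (update h i (g_ k)) x}.
  by apply: ae_foralln => k; exact: rep.
apply: filterS repn => x xrep Px; apply: cvgB; first exact: cvg_cst.
rewrite (_ : (fun k => _) = fun k => kint (update h i (g_ k)) x); last first.
  by apply/funext => k; exact: xrep.
apply: (@kint_dominated_cvg _ _ _ K CZ_K x j0 dl dl0 h i g_ g w) => //.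
- by move=> j; have [] := hU j.
- by move=> j; exact: L1 (hU j).
- exact: L1 wU.
- apply: sepx => // y; have [_ + _] := upd_supported hU wU j0; exact.
Unshelve. all: by end_near.
Qed.

Let represented_update_bounded h i (g : Rn -> R) (M : R) :
  (forall j, supported_Lp (s j) (U j) (h j)) ->
  (forall a b k, obox a b `<=` U i -> represented (update h i (box_bump a b k))) ->
  measurable_fun setT g -> (forall x, `|g x| <= M * \1_(U i) x) ->
  represented (update h i g).
Proof.
move=> hU hb mg gM.
(* The bound is part of [V]: it places [g] in L^(s_i), where [Te] is linear and the kernel integral
   converges. *)
pose V (g : Rn -> R) := [/\ measurable_fun setT g,
  exists M : R, forall x, `|g x| <= M * \1_(U i) x & represented (update h i g)].
have mUi : measurable (U i) by exact: measurable_obox.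
have Uif := lebesgueRn_obox_lty (ua i) (ub i).
have bS (u : Rn -> R) : measurable_fun setT u -> (exists M : R, forall x, `|u x| <= M * \1_(U i) x) ->
    supported_Lp (s i) (U i) u.
  by move=> mu0 [N uN]; exact: bounded_supported_Lp uN.
suff [] : V g by [].
apply: bounded_monotone_class mg gM => {g M}.
- move=> a b k sub; split; [exact: measurable_box_bump| |exact: hb].
  exists 1 => x; apply: le_trans (box_bump_norm_le1 _ _ _ _) _.
  rewrite mul1r !indicE ler_nat; case: (boolP (x \in obox a b)) => //.
  by move=> /set_mem/sub/mem_set ->.
- move=> c g g' [mg bg rg] [mg' bg' rg'].
  have gS := bS g mg bg; have gS' := bS g' mg' bg'.
  split; first by apply: measurable_funD => //; exact: measurable_funM.
    have [M gM] := bg; have [N gN] := bg'.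
    exists (`|c| * M + N) => x; rewrite mulrDl.
    by apply: le_trans (ler_normD _ _) _; rewrite lerD// normrM -mulrA ler_wpM2l.
  have in_LpS j u : supported_Lp (s j) (U j) u -> in_Lp (s j) u by exact: supported_Lp_in_Lp.
  have lin := extension_linear T_Te c s_gt1 (fun j => in_LpS j _ (hU j)) (in_LpS i _ gS) (in_LpS i _ gS').
  apply: filterS3 lin rg rg' => x -> hg hg' Px; rewrite hg// hg'//.
  rewrite (kint_linear CZ_K dl0 (j0 := j0))//.
  + by move=> j; have [] := hU j.
  + by move=> j; exact: L1 (hU j).
  + exact: L1 gS.
  + exact: L1 gS'.
  + by apply: sepx => // y; have [_ + _] := upd_supported hU gS j0; exact.
  + by apply: sepx => // y; have [_ + _] := upd_supported hU gS' j0; exact.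
- move=> g_ g M Vg gM gg.
  have mg_ k : measurable_fun setT (g_ k) by have [] := Vg k.
  have mg : measurable_fun setT g by apply: (measurable_fun_cvg mg_) => x _; exact: gg.
  have mw : measurable_fun setT (fun x => M * \1_(U i) x : R).
    by apply: measurable_funM => //; exact: measurable_indic.
  split => //.
    exists M => x; have cx : `|g_ k x| @[k --> \oo] --> `|g x| by exact: cvg_norm.
    rewrite -(cvg_lim _ cx)//; apply: limr_le; [by apply/cvg_ex; exists (`|g x|)|].
    by apply: nearW => k; exact: gM.
  apply: (represented_lim (w := fun x => M * \1_(U i) x) hU mg_ mg) => //; last first.
    by move=> k; have [] := Vg k.
  apply: bS => //; exists `|M| => x; rewrite normrM [X in _ * X <= _]ger0_norm//.
Qed.

(** The truncations to [|g| <= k] are bounded, dominated by [|g|], and at each point equal to [g]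
    from some [k] on. *)
Let represented_update h i (g : Rn -> R) :
  (forall j, supported_Lp (s j) (U j) (h j)) ->
  (forall a b k, obox a b `<=` U i -> represented (update h i (box_bump a b k))) ->
  supported_Lp (s i) (U i) g -> represented (update h i g).
Proof.
move=> hU hb gU; have [mg g0 gf] := gU.
pose g_ k x := g x * \1_(g @^-1` `[- k%:R, k%:R]) x.
have mg_ k : measurable_fun setT (g_ k).
  apply: measurable_funM => //; apply: measurable_indic.
  by rewrite -[X in measurable X]setTI; exact: mg.
apply: (@represented_lim h i g_ g (fun x => `|g x|) hU mg_ mg).
- split; first exact: measurableT_comp.
    by move=> x /g0 ->; rewrite normr0.
  by under eq_integral do rewrite normr_id.
- move=> y; apply: cvg_near_cst; near=> k; rewrite /g_ indicE mem_set ?mulr1//=.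
  rewrite in_itv/= -ler_norml; near: k; exact: nbhs_infty_ger.
- move=> k y; rewrite /g_ normrM [X in _ * X]ger0_norm ?indicE ?ler0n//.
  by rewrite ler_piMr// lern1 leq_b1.
- move=> k; apply: (@represented_update_bounded h i _ k%:R) => // x.
  have [Ux|Ux] := pselect (U i x); last by rewrite /g_ g0// mul0r normr0 indicE memNset// mulr0.
  rewrite /g_ [X in _ <= _ * X]indicE mem_set// mulr1 normrM indicE.
  case: (boolP (x \in g @^-1` _)) => [/set_mem /=|_]; last by rewrite normr0 mulr0.
  by rewrite in_itv/= -ler_norml normr1 mulr1.
Unshelve. all: by end_near.
Qed.

(** Induction on the list [r] of indices that may carry an arbitrary function, the others carrying
    bumps. The head of the list is first filled with bumps, where the induction hypothesis applies,
    and then with its own function by [represented_update]. *)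
Lemma representation_box h : (forall i, supported_Lp (s i) (U i) (h i)) -> represented h.
Proof.
suff H (r : seq 'I_m) h' : (forall i, supported_Lp (s i) (U i) (h' i)) ->
    (forall i, i \notin r -> exists a b k, obox a b `<=` U i /\ h' i = box_bump a b k) ->
    represented h'.
  move=> hU; apply: (H (index_enum 'I_m)) => // i; by rewrite mem_index_enum.
elim: r h' => [|i r ih] h' hU hb.
  have /choice[a /choice[b /choice[k abk]]] : forall i, exists a b k,
      obox a b `<=` U i /\ h' i = box_bump a b k by move=> i; exact: hb.
  have -> : h' = fun i => box_bump (a i) (b i) (k i) by apply/funext => i; have [] := abk i.
  by apply: represented_bumps => i; have [] := abk i.
rewrite -(update_self h' i); apply: represented_update => // a b k sub.
apply: ih.
  by apply: upd_supported => //; exact: box_bump_supported.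
move=> j jr; rewrite /update; case: eqP => [->|/eqP ji]; first by exists a, b, k.
by apply: hb; rewrite inE negb_or ji.
Qed.

End representation.

(** * From separated boxes to a ball and the complement of its double *)

Section representation_ball.
Context {R : realType} {n m : nat}.
Local Notation Rn := 'rV[R]_n.
Local Notation mu := (@lebesgueRn R n).
Local Notation mum := (tuple_measure mu m).
Variables (K : m.+1.-tuple Rn -> R) (T : ('I_m -> Rn -> R) -> (Rn -> R) -> R)
  (Te : ('I_m -> Rn -> R) -> Rn -> R).
Hypotheses (n_gt0 : (0 < n)%N) (m_gt0 : (0 < m)%N).
Hypotheses (CZ_T : CZ_integral K T) (T_Te : bounded_extension T Te).
Let CZ_K : CZ_kernel K. Proof. by have [] := CZ_T. Qed.
Local Notation Kz := (off_diag_ext K).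
Local Notation kint := (kint K).
Variables (s : 'I_m -> R).
Hypotheses (s_gt1 : forall i, 1 < s i) (s_sum : \sum_i (s i)^-1 <= 1).
Let s_gt0 i : 0 < s i. Proof. exact: lt_trans (s_gt1 i). Qed.

Lemma supported_Lp_sub (t : R) (U V : set Rn) (g h : Rn -> R) : 0 < t ->
  measurable_fun setT h -> (forall x, ~ V x -> h x = 0) -> (forall x, `|h x| <= `|g x|) ->
  supported_Lp t U g -> supported_Lp t V h.
Proof.
move=> t0 mh hV hg [mg _ gf]; split; [exact: mh|exact: hV|].
apply: le_lt_trans gf; apply: ge0_le_integral_sup => [//|x _|x _|x _]; rewrite ?lee_fin ?powR_ge0//.
by apply: (ge0_ler_powR (ltW t0)); rewrite ?nnegrE.
Qed.

Lemma measurable_patch_set (g : Rn -> R) (A : set Rn) : measurable A -> measurable_fun setT g ->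
  measurable_fun setT (g \_ A).
Proof. by move=> mA mg; apply/(measurable_restrictT _ mA); exact: measurable_funTS. Qed.

Lemma norm_patch_le (g : Rn -> R) (A : set Rn) x : `|(g \_ A) x| <= `|g x|.
Proof. by rewrite patchE; case: ifP => // _; rewrite normr0. Qed.

Lemma patch_eq0 (g : Rn -> R) (A : set Rn) x : ~ A x -> (g \_ A) x = 0.
Proof. by move=> Ax; rewrite patchE memNset. Qed.

Lemma lebesgueRn_eball_lty (x0 : Rn) (r : R) : (mu (eball x0 r) < +oo)%E.
Proof.
apply: (@le_lt_trans _ _ (mu (eball x0 `|r|))).
  apply: le_measure; rewrite ?inE; try exact: measurable_eball.
  by apply: le_eball; exact: ler_norm.
exact: le_lt_trans (lebesgueRn_eball_le _ (normr_ge0 _)) (ltry _).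
Qed.

Section cell.
Variables (x0 : Rn) (r rho : R) (h : 'I_m -> Rn -> R) (j0 : 'I_m) (c : 'I_n -> R).
Hypotheses (r_gt0 : 0 < r).
Hypothesis hS : forall i, supported_Lp (s i) (eball x0 rho) (h i).
(** If [y] is outside the ball of radius [2r] and some point of the cell is in the ball of radius
    [r], then a coordinate of the two differs by at least [r / n = 8 dl]. The cell has half side
    [dl], so [y] is beyond [2 dl] from its centre in that coordinate. *)
Let dl := r / (8 * n%:R).
Let dl_gt0 : 0 < dl.
Proof. by rewrite divr_gt0// mulr_gt0// ltr0n. Qed.
Local Notation P := (obox (fun l => c l - dl) (fun l => c l + dl)).
(** The complement of a ball is not a box. For each coordinate and each side ([true] is above,
    [false] below) [U p] is the part of the cube around [x0] at more than [2 dl] from the centre [c]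
    in that direction; these boxes are separated from the cell and cover what is needed. *)
Let ua (p : 'I_n * bool) l := if (l == p.1) && p.2 then c l + 2 * dl else x0 ord0 l - rho.
Let ub (p : 'I_n * bool) l := if (l == p.1) && ~~ p.2 then c l - 2 * dl else x0 ord0 l + rho.
Local Notation U p := (obox (ua p) (ub p)).

Let sep p x y : cbox (fun l => c l - dl) (fun l => c l + dl) x -> cbox (ua p) (ub p) y ->
  dl <= enorm (x - y).
Proof.
move=> Px Uy; apply: le_trans (coord_le_enorm _ p.1); rewrite !mxE.
have := Px p.1; have := Uy p.1; rewrite /ua /ub eqxx /=.
case: p.2 => /= /andP[h1 h2] /andP[h3 h4].
  by rewrite distrC ger0_norm; lra.
by rewrite ger0_norm; lra.
Qed.

Let h_L1 i (g : Rn -> R) : supported_Lp (s i) (eball x0 rho) g -> (\int[mu]_x `|g x|%:E < +oo)%E.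
Proof.
apply: supported_Lp_L1; [exact: s_gt1|exact: measurable_eball|exact: lebesgueRn_eball_lty].
Qed.

(** The boxes overlap, so they are removed one by one: [g] is cut into its part on the first box and
    a rest carried by the remaining ones, and linearity of both sides adds the pieces up. *)
Let cell_pieces (L : seq ('I_n * bool)) (g : Rn -> R) :
  supported_Lp (s j0) (eball x0 rho) g ->
  (forall y, g y != 0 -> exists2 p, p \in L & U p y) ->
  {ae mu, forall x, P x -> Te (update h j0 g) x = kint (update h j0 g) x}.
Proof.
have in_box p (g' : Rn -> R) : supported_Lp (s j0) (eball x0 rho) g' ->
    (forall y, ~ U p y -> g' y = 0) ->
    {ae mu, forall x, P x -> Te (update h j0 g') x = kint (update h j0 g') x}.
  move=> gS gU.
  apply: (@representation_box _ _ _ K T Te m_gt0 CZ_T T_Te s s_gt1 s_sum _ _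
    (fun j => if j == j0 then ua p else fun l => x0 ord0 l - rho)
    (fun j => if j == j0 then ub p else fun l => x0 ord0 l + rho) j0 dl dl_gt0).
    by rewrite eqxx; exact: sep.
  move=> i; rewrite /update; case: (i =P j0) => [->|_].
    by have [mg _ gf] := gS; split.
  have [mh hb hf] := hS i; split; [exact: mh| |exact: hf].
  by move=> x xU; apply: hb => /eball_obox.
elim: L g => [|p L ih] g gS gL.
  (* With no box left [g] is 0, and any box will do. *)
  apply: (in_box (Ordinal n_gt0, true)) => // y _.
  by apply/eqP/negPn/negP => /gL[].
have mUp : measurable (U p) by exact: measurable_obox.
have [mg gb gf] := gS.
pose g1 := g \_ (U p); pose g2 := g \_ (~` U p).
have mg1 : measurable_fun setT g1 by exact: measurable_patch_set.
have mg2 : measurable_fun setT g2 by apply: measurable_patch_set => //; exact: measurableC.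
have g1S : supported_Lp (s j0) (eball x0 rho) g1.
  apply: (supported_Lp_sub (s_gt0 j0) mg1 _ (norm_patch_le _ _) gS) => x xb.
  by rewrite /g1 patchE gb//; case: ifP.
have g2S : supported_Lp (s j0) (eball x0 rho) g2.
  apply: (supported_Lp_sub (s_gt0 j0) mg2 _ (norm_patch_le _ _) gS) => x xb.
  by rewrite /g2 patchE gb//; case: ifP.
have gE : g = fun x => 1 * g1 x + g2 x.
  apply/funext => x; rewrite mul1r /g1 /g2 !patchE in_setC.
  by case: (x \in U p); rewrite /= ?addr0 ?add0r.
have sg (g' : Rn -> R) : (forall y, `|g' y| <= `|g y|) -> forall x, P x -> forall y,
    update h j0 g' j0 y != 0 -> dl <= enorm (x - y).
  move=> g'g x Px y; rewrite update_id => g'y.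
  have /gL[q _ qy] : g y != 0.
    by apply: contra_neq g'y => gy; apply/eqP; rewrite -normr_le0; have := g'g y; rewrite gy normr0.
  exact: (sep (obox_cbox Px) (obox_cbox qy)).
have r1 := in_box p g1 g1S (fun y yU => patch_eq0 g yU).
have r2 : {ae mu, forall x, P x -> Te (update h j0 g2) x = kint (update h j0 g2) x}.
  apply: ih g2S _ => y g2y.
  have yU : ~ U p y by move=> yU; move: g2y; rewrite /g2 patch_eq0 ?eqxx// => /(_ yU).
  have /gL[q] : g y != 0.
    by apply: contra_neq g2y => gy; rewrite /g2 patchE gy; case: ifP.
  by rewrite inE => /orP[/eqP -> //|qL Uq]; exists q.
have in_LpS i (u : Rn -> R) : supported_Lp (s i) (eball x0 rho) u -> in_Lp (s i) u.
  exact: supported_Lp_in_Lp.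
have lin := extension_linear T_Te 1 s_gt1 (fun j => in_LpS j _ (hS j)) (in_LpS j0 _ g1S) (in_LpS j0 _ g2S).
rewrite -gE in lin.
have klin x : P x -> kint (update h j0 g) x = 1 * kint (update h j0 g1) x + kint (update h j0 g2) x.
  move=> Px; rewrite [in LHS]gE; apply: (kint_linear CZ_K dl_gt0 (j0 := j0)).
  - by move=> i; have [] := hS i.
  - exact: mg1.
  - exact: mg2.
  - by move=> i; exact: h_L1 (hS i).
  - exact: h_L1 g1S.
  - exact: h_L1 g2S.
  - by apply: sg => // y; exact: norm_patch_le.
  - by apply: sg => // y; exact: norm_patch_le.
apply: filterS3 lin r1 r2 => x lx h1 h2 Px.
by rewrite lx klin// h1// h2.
Qed.

Lemma representation_cell : (forall y, eball x0 (2 * r) y -> h j0 y = 0) ->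
  {ae mu, forall x, P x -> eball x0 r x -> Te h x = kint h x}.
Proof.
move=> h0; have [[x1 [Px1 xr1]]|nx] := pselect (exists x1, P x1 /\ eball x0 r x1); last first.
  by apply: nearW => x Px xr; case: nx; exists x.
suff : {ae mu, forall x, P x -> Te (update h j0 (h j0)) x = kint (update h j0 (h j0)) x}.
  by rewrite update_self; apply: filterS => x + Px _; exact.
apply: (cell_pieces (L := enum {: 'I_n * bool})); first exact: hS.
move=> y hy.
have yb : eball x0 rho y.
  by apply: contrapT => yb; have [_ + _] := hS j0 => /(_ y yb) hy0; move: hy; rewrite hy0 eqxx.
have y2r : 2 * r <= enorm (y - x0).
  by rewrite leNgt; apply/negP => y2; move: hy; rewrite h0 ?eqxx.
have yx1 : r <= enorm (y - x1).
  have := enorm_dist_triangle x1 y x0; move: xr1; rewrite /eball /=; lra.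
have [l hl] : exists l, r / n%:R <= `|y ord0 l - x1 ord0 l|.
  apply: contrapT => /forallNP nl.
  have : enorm (y - x1) < r.
    apply: le_lt_trans (enorm_le_sum _) _.
    apply: (@lt_le_trans _ _ (\sum_(l < n) (r / n%:R))).
      apply: ltr_sum; first by apply/hasP; exists (Ordinal n_gt0) => //; rewrite mem_index_enum.
      by move=> l _; rewrite !mxE ltNge; apply/negP; exact: nl.
    by rewrite sumr_const card_ord -[X in X <= _]mulr_natr mulfVK// gt_eqF// ltr0n.
  by rewrite ltNge yx1.
have rE : r / n%:R = 8 * dl.
  by rewrite /dl; field; rewrite pnatr_eq0 -lt0n.
have /andP[p1 p2] := Px1 l; rewrite rE in hl.
have bb i : x0 ord0 i - rho < y ord0 i < x0 ord0 i + rho by exact: (eball_obox yb).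
have d0 := dl_gt0.
have [yl|yl] := leP (x1 ord0 l) (y ord0 l).
  rewrite ger0_norm ?subr_ge0// in hl.
  exists (l, true); first by rewrite mem_enum.
  move=> i; have /andP[b1 b2] := bb i; rewrite /ua /ub /= andbT andbF b2 andbT.
  by case: (i =P l) => [->|//]; lra.
rewrite ltr0_norm ?subr_lt0// in hl.
exists (l, false); first by rewrite mem_enum.
move=> i; have /andP[b1 b2] := bb i; rewrite /ua /ub /= andbF andbT b1 /=.
by case: (i =P l) => [->|//]; lra.
Qed.

End cell.

(** Cells centred on a grid of step [dl] cover the space. Coding their centres by natural numbers
    leaves countably many null sets to unite. *)
Lemma representation_ball (x0 : Rn) (r rho : R) (h : 'I_m -> Rn -> R) (j0 : 'I_m) : 0 < r ->
  (forall i, supported_Lp (s i) (eball x0 rho) (h i)) ->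
  (forall y, eball x0 (2 * r) y -> h j0 y = 0) ->
  {ae mu, forall x, eball x0 r x -> Te h x = kint h x}.
Proof.
move=> r0 hS h0; pose dl := r / (8 * n%:R).
have dl0 : 0 < dl by rewrite divr_gt0// mulr_gt0// ltr0n.
have : {ae mu, forall x, forall k : nat,
    forall z : {ffun 'I_n -> int}, unpickle k = Some z ->
    obox (fun l => (z l)%:~R * dl - dl) (fun l => (z l)%:~R * dl + dl) x ->
    eball x0 r x -> Te h x = kint h x}.
  apply: ae_foralln => k; case: unpickle => [z|]; last exact: nearW.
  have := representation_cell (fun l => (z l)%:~R * dl) r0 hS h0.
  by apply: filterS => x hx z' [<-]; exact: hx.
apply: filterS => x hx xr.
pose z : {ffun 'I_n -> int} := [ffun l => Num.floor (x ord0 l / dl)].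
apply: (hx (pickle z) z) => //; first exact: pickleK.
move=> l; rewrite ffunE; have h1 := floor_le (x ord0 l / dl).
have h2 := floorD1_gt (x ord0 l / dl); rewrite intrD in h2.
move: (Num.floor _) h1 h2 => q; rewrite ler_pdivlMr// ltr_pdivrMr// => h1 h2.
by apply/andP; split; lra.
Qed.

Definition prod_diff (h : 'I_m -> Rn -> R) (x0 : Rn) (r : R) (y : m.-tuple Rn) :=
  \prod_(i < m) h i (tnth y i) - \prod_(i < m) (h i \_ (eball x0 (2 * r))) (tnth y i).

(** The functions are restricted to the double ball one after the other, [H k] having the first [k]
    restricted. Each change is by linearity a value of [Te] at a tuple with one entry vanishing on
    the double ball, hence a kernel integral, and the integrands telescope to [prod_diff]. *)
Lemma extension_diff (x0 : Rn) (r rho : R) (h : 'I_m -> Rn -> R) : 0 < r ->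
  (forall i, supported_Lp (s i) (eball x0 rho) (h i)) ->
  {ae mu, forall x, eball x0 r x ->
    mum.-integrable setT (fun y => (Kz [tuple of x :: y] * prod_diff h x0 r y)%:E) /\
    Te h x - Te (fun i => h i \_ (eball x0 (2 * r))) x =
    \int[mum]_y (Kz [tuple of x :: y] * prod_diff h x0 r y)}.
Proof.
move=> r0 hS; set B2 := eball x0 (2 * r).
have mB2 : measurable B2 by exact: measurable_eball.
pose H (k : nat) (i : 'I_m) : Rn -> R := if (i < k)%N then h i \_ B2 else h i.
have patchS i A : measurable A -> supported_Lp (s i) (eball x0 rho) (h i \_ A).
  move=> mA; have [mh hb hf] := hS i.
  apply: (supported_Lp_sub (s_gt0 i) _ _ (norm_patch_le _ _) (hS i)).
    exact: measurable_patch_set.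
  by move=> x xb; rewrite patchE hb//; case: ifP.
have HS k i : supported_Lp (s i) (eball x0 rho) (H k i).
  by rewrite /H; case: ifP => _; [exact: patchS|exact: hS].
have in_LpS i (u : Rn -> R) : supported_Lp (s i) (eball x0 rho) u -> in_Lp (s i) u.
  exact: supported_Lp_in_Lp.
have H0 : H 0%N = h by apply/funext => i; rewrite /H.
have Hm : H m = fun i => h i \_ B2 by apply/funext => i; rewrite /H ltn_ord.
suff /(_ m (leqnn _)) : forall k, (k <= m)%N ->
    {ae mu, forall x, eball x0 r x ->
    mum.-integrable setT (fun y => (Kz [tuple of x :: y] *
       (\prod_(i < m) h i (tnth y i) - \prod_(i < m) H k i (tnth y i)))%:E) /\
    Te h x - Te (H k) x = \int[mum]_y (Kz [tuple of x :: y] *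
       (\prod_(i < m) h i (tnth y i) - \prod_(i < m) H k i (tnth y i)))} by rewrite Hm.
elim=> [|k ih] km.
  apply: nearW => x _; rewrite H0 subrr.
  have E0 (y : m.-tuple Rn) : Kz [tuple of x :: y] * (\prod_(i < m) h i (tnth y i) - \prod_(i < m) h i (tnth y i)) = 0.
    by rewrite subrr mulr0.
  split; first by under eq_fun do rewrite E0; exact: integrable0.
  by under eq_Rintegral do rewrite E0; rewrite /Rintegral integral0.
pose i0 := Ordinal km; pose g := update (H k) i0 (h i0 \_ (~` B2)).
have mC : measurable (~` B2) by exact: measurableC.
have gS i : supported_Lp (s i) (eball x0 rho) (g i).
  by rewrite /g /update; case: (i =P i0) => [->|_]; [exact: patchS|exact: HS].
have hE : h i0 = fun x => 1 * (h i0 \_ (~` B2)) x + (h i0 \_ B2) x.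
  apply/funext => x; rewrite mul1r !patchE in_setC.
  by case: (x \in B2); rewrite /= ?addr0 ?add0r.
have HkE : H k = update (H k) i0 (h i0).
  by rewrite -[LHS](update_self _ i0); congr update; rewrite /H ltnn.
have Hk1E : H k.+1 = update (H k) i0 (h i0 \_ B2).
  apply/funext => i; rewrite /H /update ltnS leq_eqVlt.
  case: (i =P i0) => [->|ii0]; first by rewrite eqxx.
  by rewrite (_ : (i == k :> nat) = false)//; apply/eqP => ik; apply: ii0; apply/val_inj.
have lin := extension_linear T_Te 1 s_gt1 (fun j => in_LpS j _ (HS k j))
   (in_LpS i0 _ (patchS i0 _ mC)) (in_LpS i0 _ (patchS i0 _ mB2)).
rewrite -hE -HkE -Hk1E in lin.
have rep : {ae mu, forall x, eball x0 r x -> Te g x = kint g x}.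
  apply: (representation_ball (j0 := i0) r0 gS) => y yB.
  by rewrite /g update_id patch_eq0//; exact.
apply: filterS3 lin rep (ih (ltnW km)) => x lx gx hx xr.
have [ik ek] := hx xr.
have ig : mum.-integrable setT (fun y => (Kz [tuple of x :: y] * \prod_(i < m) g i (tnth y i))%:E).
  apply: (integrable_kint CZ_K r0 (j0 := i0)).
  - by move=> i; have [] := gS i.
  - move=> i; apply: supported_Lp_L1 (gS i); [exact: s_gt1|exact: measurable_eball|exact: lebesgueRn_eball_lty].
  - move=> y; rewrite /g update_id patchE; case: ifPn => [|_]; last by rewrite eqxx.
    rewrite in_setC => /negP yB _.
    have : 2 * r <= enorm (y - x0) by rewrite leNgt; apply/negP => yr; apply: yB; rewrite mem_set.
    have := enorm_dist_triangle x y x0; rewrite [enorm (y - x)]enorm_distC.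
    move: xr; rewrite /eball /=; lra.
have pE (y : m.-tuple Rn) : Kz [tuple of x :: y] * (\prod_(i < m) h i (tnth y i) - \prod_(i < m) H k.+1 i (tnth y i)) =
   Kz [tuple of x :: y] * (\prod_(i < m) h i (tnth y i) - \prod_(i < m) H k i (tnth y i)) +
   Kz [tuple of x :: y] * \prod_(i < m) g i (tnth y i).
  have hEt : h i0 (tnth y i0) = (h i0 \_ (~` B2)) (tnth y i0) + (h i0 \_ B2) (tnth y i0).
    by rewrite [in LHS]hE mul1r.
  have P1 := prod_update (H k) i0 (h i0 \_ B2) y; rewrite -Hk1E in P1.
  have P2 := prod_update (H k) i0 (h i0 \_ (~` B2)) y.
  have P3 := prod_update (H k) i0 (h i0) y; rewrite -HkE hEt in P3.
  by rewrite P1 P3 [X in _ + _ * X]P2; ring.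
split.
  under eq_fun do rewrite pE EFinD; exact: integrableD.
under eq_Rintegral do rewrite pE.
rewrite RintegralD// -ek; move: (gx xr); rewrite /kint => <-.
by rewrite lx mul1r /g; ring.
Qed.

End representation_ball.

(** * Campanato functions *)

Section limits.
Context {R : realType}.

Lemma le_prod_limit (I : finType) (a : I -> R) (x c : R) :
  (forall e, 0 < e -> x <= c * \prod_i (a i + e)) -> x <= c * \prod_i a i.
Proof.
move=> h.
have cv : c * \prod_i (a i + k.+1%:R^-1) @[k --> \oo] --> c * \prod_i a i.
  apply: cvgMl_tmp; elim: (index_enum I) => [|i r ih].
    by under eq_fun do rewrite big_nil; rewrite big_nil; exact: cvg_cst.
  under eq_fun do rewrite big_cons; rewrite big_cons; apply: cvgM => //.
  rewrite -[X in _ --> X](addr0 (a i)); apply: cvgD; first exact: cvg_cst.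
  exact: cvg_harmonic.
rewrite -(cvg_lim _ cv)//; apply: limr_ge; first by apply/cvg_ex; eexists; exact: cv.
by apply: nearW => k; apply: h; rewrite invr_gt0.
Qed.

End limits.

Section power_bound0.
Context d (T : measurableType d) (R : realType) (mu : {measure set T -> \bar R}).
Implicit Types (E : set T) (g h : T -> R) (th a b : R).

(** The bounds [a i] may be 0, for instance for a constant [b_i]; the positive case is applied to
    [a i + e] and [e] tends to 0. *)
Lemma Lp_le_prod0 (I : finType) (th : I -> R) E (g : I -> T -> R) (a : I -> R) :
  (forall i, 0 < th i) -> 0 < \sum_i th i -> measurable E ->
  (forall i, measurable_fun E (g i)) -> (forall i, 0 <= a i) ->
  (forall i, Lp_le mu (th i) E (g i) (a i)) ->
  Lp_le mu (\sum_i th i) E (fun x => \prod_i g i x) (\prod_i a i).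
Proof.
move=> th0 S0 mE mg a0 ga.
have He e : 0 < e -> Lp_le mu (\sum_i th i) E (fun x => \prod_i g i x) (\prod_i (a i + e)).
  move=> e0; apply: Lp_le_prod => // i; first by rewrite ltr_wpDl.
  apply: (Lp_le_sub (@subset_refl _ E) (th0 i) _ _ (ga i)); last by [].
  by rewrite a0 lerDl ltW.
rewrite /Lp_le in He *; set J := (\int[mu]_(x in E) _)%E in He *.
have J0 : (0 <= J)%E by apply: integral_ge0 => x _; rewrite lee_fin powR_ge0.
have Jf : J \is a fin_num.
  by rewrite ge0_fin_numE//; apply: le_lt_trans (He 1 ltr01) _; exact: ltry.
rewrite -(fineK Jf) lee_fin.
have f0 : 0 <= fine J by exact: fine_ge0.
have h : fine J `^ (\sum_i th i) <= 1 * \prod_i a i.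
  apply: le_prod_limit => e e0; rewrite mul1r.
  have p0 : 0 <= \prod_i (a i + e) by apply: prodr_ge0 => i _; rewrite addr_ge0// ltW.
  have -> : \prod_i (a i + e) = ((\prod_i (a i + e)) `^ (\sum_i th i)^-1) `^ (\sum_i th i).
    by rewrite -powRrM mulVf ?gt_eqF// powRr1.
  apply: (ge0_ler_powR (ltW S0)); rewrite ?nnegrE ?powR_ge0//.
  by rewrite -lee_fin fineK//; exact: He.
rewrite mul1r in h.
have -> : fine J = (fine J `^ (\sum_i th i)) `^ (\sum_i th i)^-1.
  by rewrite -powRrM mulfV ?gt_eqF// powRr1.
by apply: ge0_ler_powR; rewrite ?nnegrE ?powR_ge0 ?invr_ge0 ?(ltW S0) ?prodr_ge0.
Qed.

Lemma Lp_leM0 th1 th2 E g h a b : 0 < th1 -> 0 < th2 -> measurable E ->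
  measurable_fun E g -> measurable_fun E h -> 0 <= a -> 0 <= b ->
  Lp_le mu th1 E g a -> Lp_le mu th2 E h b ->
  Lp_le mu (th1 + th2) E (fun x => g x * h x) (a * b).
Proof.
move=> t1 t2 mE mg mh a0 b0 ga hb.
have := @Lp_le_prod0 bool (fun i => if i then th1 else th2) E
   (fun i => if i then g else h) (fun i => if i then a else b).
rewrite !big_bool/= /Lp_le; under eq_integral do rewrite big_bool/=.
by apply => //; try case=> //; exact: addr_gt0.
Qed.

(** Hoelder's inequality against the constant 1: the exponent goes down from [1/th] to [1/(th + dl)]
    at the price of a power of the volume. *)
Lemma Lp_le_lower0 th dl E g a (v : R) : 0 < th -> 0 < dl -> measurable E ->
  measurable_fun E g -> 0 <= a -> 0 <= v -> (mu E <= v%:E)%E ->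
  Lp_le mu th E g a -> Lp_le mu (th + dl) E g (a * v `^ dl).
Proof.
move=> th0 dl0 mE mg a0 v0 muE ga.
have := Lp_leM0 th0 dl0 mE mg (measurable_cst (1 : R)) a0 (powR_ge0 _ _) ga
  (Lp_le_cst1 mE dl0 v0 muE).
by rewrite /Lp_le; under eq_integral do rewrite mulr1.
Qed.

(** Turns a norm bound for a constant function into a bound for the number; this is how differences
    of means are estimated. *)
Lemma Lp_le_cst_inv th E (c a v : R) : 0 < th -> measurable E -> 0 <= v -> 0 <= a ->
  (v%:E <= mu E)%E -> Lp_le mu th E (fun=> c) a -> `|c| * v `^ th <= a.
Proof.
move=> th0 mE v0 a0 vE; rewrite /Lp_le integral_cst// => h.
have {}h : `|c| `^ th^-1 * v <= a `^ th^-1.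
  rewrite -lee_fin; apply: le_trans h; rewrite EFinM.
  by apply: lee_wpmul2l => //; rewrite lee_fin powR_ge0.
have := ge0_ler_powR (ltW th0) _ _ h; rewrite !nnegrE mulr_ge0 ?powR_ge0// => /(_ isT isT).
by rewrite powRM ?powR_ge0// -!powRrM mulVf ?gt_eqF// !powRr1.
Qed.

End power_bound0.

Section campanato_constants.
Context {R : realType} (n : nat) (q lam : R).
(** The upper volume bound [(2t)^n] gives [dev_const]. In [mean_const] the deviations on balls of
    radius [t] and [2t] are added and divided by the lower volume bound. In [campanato_const] the
    difference of means is put back under the norm, which costs another upper volume bound. *)
Definition dev_const : R := 2 `^ (n%:R * (q^-1 + lam)).
Definition mean_const : R :=
  (dev_const + dev_const * 2 `^ (n%:R * (q^-1 + lam))) / (2 / n%:R) `^ (n%:R * q^-1).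
Definition campanato_const : R := dev_const + mean_const * 2 `^ (n%:R * q^-1).

Lemma dev_const_gt0 : 0 < dev_const. Proof. exact: powR_gt0. Qed.

Lemma mean_const_gt0 : (0 < n)%N -> 0 < mean_const.
Proof.
move=> n0; have d0 := dev_const_gt0.
by rewrite divr_gt0 ?powR_gt0 ?divr_gt0 ?ltr0n// addr_gt0// mulr_gt0// powR_gt0.
Qed.

Lemma campanato_const_gt0 : (0 < n)%N -> 0 < campanato_const.
Proof.
move=> n0; rewrite addr_gt0 ?dev_const_gt0// mulr_gt0 ?powR_gt0//.
exact: mean_const_gt0.
Qed.
End campanato_constants.

Section campanato.
Context {R : realType} {n : nat}.
Local Notation Rn := 'rV[R]_n.
Local Notation mu := (@lebesgueRn R n).
Hypothesis n_gt0 : (0 < n)%N.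
Variable x0 : Rn.
Local Notation B := (eball x0).

Lemma vol_powR_le (t th : R) : 0 < t -> 0 <= th -> vol x0 t `^ th <= 2 `^ (n%:R * th) * t `^ (n%:R * th).
Proof.
move=> t0 th0; rewrite -powRM ?(ltW t0)// powRrM powR_mulrn ?mulr_ge0 ?(ltW t0)//.
apply: (ge0_ler_powR th0); rewrite ?nnegrE ?exprn_ge0 ?mulr_ge0 ?(ltW t0)//.
  by rewrite ltW// vol_gt0.
by apply: vol_le; exact: ltW.
Qed.

Lemma vol_powR_ge (t th : R) : 0 < t -> 0 <= th ->
  (2 / n%:R) `^ (n%:R * th) * t `^ (n%:R * th) <= vol x0 t `^ th.
Proof.
move=> t0 th0; have n0 : 0 < n%:R :> R by rewrite ltr0n.
rewrite -powRM ?(ltW t0) ?divr_ge0// powRrM powR_mulrn ?mulr_ge0 ?divr_ge0 ?(ltW t0)//.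
apply: (ge0_ler_powR th0); rewrite ?nnegrE ?exprn_ge0 ?mulr_ge0 ?divr_ge0 ?(ltW t0)//.
  by rewrite ltW// vol_gt0.
by rewrite mulrAC; exact: vol_ge.
Qed.

Lemma mu_eball_le t : 0 < t -> (mu (B t) <= (vol x0 t)%:E)%E.
Proof. by move=> t0; rewrite lebesgueRn_eball// ltW. Qed.

Lemma mu_eball_ge t : 0 < t -> ((vol x0 t)%:E <= mu (B t))%E.
Proof. by move=> t0; rewrite lebesgueRn_eball// ltW. Qed.

Section one_function.
Variables (b : Rn -> R) (q lam N : R).
Hypotheses (mb : measurable_fun setT b) (q_gt1 : 1 < q) (lam_gt0 : 0 < lam) (N_ge0 : 0 <= N).
Hypothesis bN : (campanato_norm q lam x0 b <= N%:E)%E.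
Local Notation mean t := (ball_mean b x0 t).
Let q_gt0 : 0 < q. Proof. exact: lt_trans q_gt1. Qed.
Let q01 : 0 < q^-1 <= 1. Proof. by rewrite invr_gt0 q_gt0 invf_le1// ltW. Qed.
Local Notation c1 := (dev_const n q lam).
Let ex := n%:R * (q^-1 + lam).
Let mbc (E : set Rn) (c : R) : measurable_fun E (fun x => b x - c).
Proof. by apply: measurable_funTS; exact: measurable_funB. Qed.

Let dev_bound0 t : 0 < t -> Lp_le mu q^-1 (B t) (fun x => b x - mean t) (N * vol x0 t `^ (q^-1 + lam)).
Proof.
move=> t0; have V0 : 0 < vol x0 t by exact: vol_gt0.
have : ((((vol x0 t `^ (1 + lam * q))^-1)%:E *
    \int[mu]_(y in B t) (`|b y - mean t| `^ q)%:E) `^ q^-1 <= N%:E)%E.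
  by apply: le_trans bN; apply: ereal_sup_ubound; exists t.
rewrite /Lp_le invrK; set J := (\int[mu]_(y in B t) _)%E.
have J0 : (0 <= J)%E by apply: integral_ge0 => x _; rewrite lee_fin powR_ge0.
have a0 : 0 < vol x0 t `^ (1 + lam * q) by exact: powR_gt0.
have pr0 : (0 <= ((vol x0 t `^ (1 + lam * q))^-1)%:E * J)%E.
  by rewrite mule_ge0// lee_fin invr_ge0 powR_ge0.
move=> h.
have : (((((vol x0 t `^ (1 + lam * q))^-1)%:E * J) `^ q^-1) `^ q <= N%:E `^ q)%E.
  by apply: (gt0_ler_poweR (ltW q_gt0)) => //; rewrite in_itv/= leey andbT ?poweR_ge0// lee_fin.
rewrite -poweRrM mulVf ?gt_eqF// poweRe1// poweR_EFin.
rewrite muleC lee_pdivrMr// -EFinM => {}h; apply: le_trans h _.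
rewrite lee_fin powRM ?powR_ge0// -[X in _ <= _ * X]powRrM mulrDl mulVf ?gt_eqF//.
Qed.

Let dev_bound t : 0 < t -> Lp_le mu q^-1 (B t) (fun x => b x - mean t) (c1 * N * t `^ ex).
Proof.
move=> t0; have := dev_bound0 t0.
have /andP[q0 _] := q01.
apply: Lp_le_sub => //; rewrite mulr_ge0 ?powR_ge0//= [c1 * N]mulrC -mulrA ler_wpM2l//.
by apply: vol_powR_le => //; rewrite addr_ge0 ?(ltW q0) ?(ltW lam_gt0).
Qed.

Local Notation c2 := (mean_const n q lam).
Let c1_gt0 : 0 < c1 := dev_const_gt0 n q lam.
Let c2_gt0 : 0 < c2 := mean_const_gt0 q lam n_gt0.

(** On the smaller ball the constant is the difference of the deviations of [b] from its two means,
    both of which the Campanato norm controls there. *)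
Let mean_step t : 0 < t -> `|mean (2 * t) - mean t| <= c2 * N * t `^ (n%:R * lam).
Proof.
move=> t0; have /andP[q0 _] := q01.
have t20 : 0 < 2 * t by rewrite mulr_gt0.
have mB : measurable (B t) by exact: measurable_eball.
have h1 : Lp_le mu q^-1 (B t) (fun x => -1 * (b x - mean (2 * t))) (`|-1| * (c1 * N * (2 * t) `^ ex)).
  apply: Lp_leZ => //; first by rewrite !mulr_ge0 ?powR_ge0// ltW.
  apply: (Lp_le_sub _ q0 _ _ (dev_bound t20)) => //.
    by apply: le_eball; rewrite ler_peMl// ?ler1n// ltW.
  by rewrite !mulr_ge0 ?powR_ge0 ?(ltW c1_gt0)//= lexx.
have /Lp_le_cst_inv : Lp_le mu q^-1 (B t) (fun=> mean (2 * t) - mean t)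
    (c1 * N * t `^ ex + `|-1| * (c1 * N * (2 * t) `^ ex)).
  have := Lp_leD q01 mB (@mbc (B t) (mean t)) _ _ _ (dev_bound t0) h1.
  rewrite (_ : (fun x => b x - mean t + _) = fun=> mean (2 * t) - mean t); last first.
    by apply/funext => x; ring.
  apply.
  - by apply: measurable_funM => //; exact: (@mbc (B t)).
  - by rewrite !mulr_ge0 ?powR_ge0 ?(ltW c1_gt0).
  - by rewrite !mulr_ge0 ?powR_ge0 ?(ltW c1_gt0).
move=> /(_ (vol x0 t) q0 mB); rewrite ltW ?vol_gt0//.
have p0 : 0 <= c1 * N * t `^ ex + `|-1| * (c1 * N * (2 * t) `^ ex).
  by rewrite addr_ge0// !mulr_ge0 ?powR_ge0// ltW.
move=> /(_ isT p0 (mu_eball_ge t0)) h.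
rewrite /mean_const -/ex -mulrA mulrAC ler_pdivlMr ?powR_gt0 ?divr_gt0 ?ltr0n//.
have tt : 0 < t `^ (n%:R * q^-1) by exact: powR_gt0.
rewrite -(ler_pM2r tt) -mulrA.
apply: le_trans (le_trans (ler_wpM2l (normr_ge0 _) (vol_powR_ge t0 (ltW q0))) h) _.
rewrite normrN1 mul1r powRM ?(ltW t0)//.
have -> : (c1 + c1 * 2 `^ ex) * (N * t `^ (n%:R * lam)) * t `^ (n%:R * q^-1) =
  (c1 + c1 * 2 `^ ex) * N * (t `^ (n%:R * lam) * t `^ (n%:R * q^-1)) by ring.
rewrite -powRD; last by rewrite (gt_eqF t0) implybT.
have exE : ex = n%:R * lam + n%:R * q^-1 by rewrite /ex; ring.
rewrite -exE le_eqVlt; apply/orP; left; apply/eqP; ring.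
Qed.

Local Notation c4 := (campanato_const n q lam).

(** Telescoping; each of the [k] steps is bounded by the last one since [n lam] is positive, which
    is where the factor [k] comes from. *)
Lemma mean_dyadic k r : 0 < r ->
  `|mean (2 ^+ k * r) - mean r| <= c2 * N * k%:R * (2 ^+ k * r) `^ (n%:R * lam).
Proof.
move=> r0; elim: k => [|k ih]; first by rewrite expr0 mul1r subrr normr0 mulr0 mul0r.
have k0 : 0 < 2 ^+ k * r by rewrite mulr_gt0 ?exprn_gt0.
have st := mean_step k0; rewrite mulrA -exprS in st.
have -> : mean (2 ^+ k.+1 * r) - mean r = (mean (2 ^+ k.+1 * r) - mean (2 ^+ k * r)) + (mean (2 ^+ k * r) - mean r) by ring.
apply: le_trans (ler_normD _ _) _.
apply: le_trans (lerD st ih) _.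
have mono : (2 ^+ k * r) `^ (n%:R * lam) <= (2 ^+ k.+1 * r) `^ (n%:R * lam).
  apply: ge0_ler_powR; rewrite ?nnegrE ?mulr_ge0 ?exprn_ge0 ?(ltW r0) ?(ltW lam_gt0)//.
  by rewrite exprS -mulrA ler_peMl ?ler1n// ltW.
rewrite (_ : k.+1%:R = k%:R + 1 :> R); last by rewrite natr1.
rewrite [c2 * N * (_ + _)]mulrDr mulr1 mulrDl [leRHS]addrC.
have c20 := ltW c2_gt0.
have h1 : 0 <= c2 * N by exact: mulr_ge0.
have h2 : 0 <= c2 * N * k%:R by exact: mulr_ge0.
by apply: (lerD (ler_wpM2l h1 mono)); exact: ler_wpM2l.
Qed.

(** The factor [k.+1] counts the [k] steps between the means and the deviation on the large ball
    itself. *)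
Lemma campanato_dyadic k r : 0 < r ->
  Lp_le mu q^-1 (B (2 ^+ k * r)) (fun x => b x - mean r)
    (c4 * N * k.+1%:R * (2 ^+ k * r) `^ (n%:R * (q^-1 + lam))).
Proof.
have /andP[q0 _] := q01.
move=> r0; set t := 2 ^+ k * r.
have t0 : 0 < t by rewrite mulr_gt0 ?exprn_gt0.
have mB : measurable (B t) by exact: measurable_eball.
have h1 := dev_bound t0.
have h2 : Lp_le mu q^-1 (B t) (fun x => (mean t - mean r) * 1) (`|mean t - mean r| * vol x0 t `^ q^-1).
  apply: Lp_leZ => //; first exact: powR_ge0.
  by apply: (Lp_le_cst1 mB q0 _ (mu_eball_le t0)); rewrite ltW// vol_gt0.
have := Lp_leD q01 mB (@mbc (B t) (mean t)) (measurable_cst _) _ _ h1 h2.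
have a1 : 0 <= c1 * N * t `^ ex by rewrite !mulr_ge0 ?powR_ge0// ltW.
have a2 : 0 <= `|mean t - mean r| * vol x0 t `^ q^-1 by rewrite mulr_ge0// powR_ge0.
move=> /(_ a1 a2); apply: Lp_le_sub => //.
  rewrite addr_ge0//= /campanato_const.
  have -> : (c1 + c2 * 2 `^ (n%:R * q^-1)) * N * k.+1%:R * t `^ (n%:R * (q^-1 + lam)) =
    c1 * N * t `^ ex * k.+1%:R + (c2 * N * k.+1%:R * 2 `^ (n%:R * q^-1)) * t `^ ex by rewrite -/ex; ring.
  apply: lerD; first by rewrite ler_peMr// ler1n.
  apply: (@le_trans _ _ ((c2 * N * k%:R * t `^ (n%:R * lam)) * (2 `^ (n%:R * q^-1) * t `^ (n%:R * q^-1)))).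
    apply: ler_pM => //; [exact: powR_ge0|exact: mean_dyadic|].
    by apply: vol_powR_le => //; exact: ltW.
  rewrite /ex mulrDr powRD; last by rewrite (gt_eqF t0) implybT.
  rewrite (_ : _ * _ * (_ * _) = (c2 * N * k%:R * 2 `^ (n%:R * q^-1)) * (t `^ (n%:R * q^-1) * t `^ (n%:R * lam))); last by ring.
  rewrite ler_wpM2r ?mulr_ge0 ?powR_ge0// ler_wpM2r ?powR_ge0// ler_wpM2l ?ler_nat//.
  by rewrite mulr_ge0// ltW.
by move=> x _; rewrite mulr1; have -> : b x - mean t + (mean t - mean r) = b x - mean r by ring.
Qed.

End one_function.
End campanato.

(** * Dyadic sums and weights *)

Section weights_sum.
Context {R : realType}.
Local Notation lambda := (@lebesgue_measure R).

(** The set []-oo, t]] is null for the measure restricted to []t, +oo[], so values of [g] up to [t]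
    do not matter. *)
Lemma ess_inf_after_ge (g : R -> R) (t y : R) : (forall s, t < s -> y <= g s) ->
  (y%:E <= ess_inf_after g t)%E.
Proof.
move=> yg; apply/ess_infP; exists `]-oo, t]%classic; split.
- exact: measurable_itv.
- have e0 : (`]-oo, t]%classic `&` `]t, +oo[%classic = set0 :> set R).
    apply/seteqP; split => // s [] /=; rewrite !in_itv/= andbT => h1 h2.
    by have := le_lt_trans h1 h2; rewrite ltxx.
  by change (lambda (`]-oo, t]%classic `&` `]t, +oo[%classic) = 0%E); rewrite e0 measure0.
- move=> s /= h; rewrite in_itv/= leNgt; apply/negP => ts; apply: h.
  by rewrite lee_fin; exact: yg.
Qed.

Lemma ln2_gt0 : 0 < ln 2 :> R. Proof. by rewrite ln_gt0// ltr1n. Qed.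

Lemma ln2_le1 : ln 2 <= 1 :> R.
Proof. by have := @le_ln1Dx R 1; apply; lra. Qed.

(** The inverse of what is lost when the weight on []t_j, 2 t_j[] is replaced by its size at [t_j]:
    [ln 2] for each logarithm, and the minimum of [(t / t_j)^(e - 1)] over ratios between 1 and 2,
    whichever sign [e - 1] has. *)
Definition weight_const (m : nat) (e : R) : R := (ln 2 ^+ m * Num.min 1 (2 `^ (e - 1)))^-1.

Lemma weight_const_gt0 m e : 0 < weight_const m e.
Proof.
by rewrite invr_gt0 mulr_gt0 ?exprn_gt0 ?ln2_gt0// lt_min ltr01 powR_gt0.
Qed.

(** On the disjoint intervals []t_j, 2 t_j[] the integrand is at least [c j], and the length [t_j]
    turns [t_j^(e - 1)] into [t_j^e]. The essential infimum after [t > t_j] is at least [F j / A],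
    since every later [s] satisfies [F j <= A * g s]. *)
Lemma weight_sum (m : nat) (e r M A : R) (g : R -> R) (F : nat -> R) : 0 < r ->
  (forall s, 0 < s -> 0 <= g s) -> 0 <= A -> (forall j, 0 <= F j) ->
  (forall j s, 2 ^+ j.+2 * r < s -> F j <= A * g s) ->
  (\int[lambda]_(t in `]r, +oo[)
     (((1 + ln (t / r)) ^+ m * t `^ (e - 1))%:E * ess_inf_after g t) <= M%:E)%E ->
  forall J, \sum_(j < J) (j.+3%:R ^+ m * (2 ^+ j.+2 * r) `^ e * F j) <=
    A * M * weight_const m e.
Proof.
move=> r0 g0 A0 F0 FA hM J.
have W0 t : r < t -> (0 <= ((1 + ln (t / r)) ^+ m * t `^ (e - 1))%:E * ess_inf_after g t)%E.
  move=> rt; have t0 := lt_trans r0 rt.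
  apply: mule_ge0.
    rewrite lee_fin mulr_ge0 ?powR_ge0// exprn_ge0// addr_ge0// ln_ge0//.
    by rewrite ler_pdivlMr// mul1r ltW.
  by apply: ess_inf_after_ge => s ts; apply: g0; exact: lt_trans t0 ts.
(* The comparison divides by [A]; if [A] is 0, all [F j] are 0. *)
have [A00|A00] := eqVneq A 0.
  have F00 j : F j = 0.
    apply/eqP; rewrite eq_le F0 andbT; have := FA j (2 ^+ j.+2 * r + 1).
    by rewrite A00 mul0r; apply; rewrite ltrDl.
  by rewrite big1 ?A00 ?mul0r// => j _; rewrite F00 mulr0.
have {A00}A_gt0 : 0 < A by rewrite lt_neqAle eq_sym A00.
pose t_ j : R := 2 ^+ j.+2 * r.
have t_gt0 j : 0 < t_ j by rewrite mulr_gt0 ?exprn_gt0.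
pose mn : R := Num.min 1 (2 `^ (e - 1)).
have mn0 : 0 < mn by rewrite lt_min ltr01 powR_gt0.
pose c j : R := (ln 2 * j.+3%:R) ^+ m * (mn * t_ j `^ (e - 1)) * (F j / A).
have c0 j : 0 <= c j.
  by rewrite !mulr_ge0 ?invr_ge0 ?exprn_ge0 ?mulr_ge0 ?powR_ge0 ?(ltW ln2_gt0) ?(ltW mn0).
pose I_ j : set R := `]t_ j, (2 * t_ j)[%classic.
have mI j : measurable (I_ j) by exact: measurable_itv.
have t_r j : r < t_ j.
  by rewrite /t_ ltr_pMl// exprn_egt1// ltr1n.
have key : (\int[lambda]_(t in `]r, +oo[) (\sum_(j < J) ((c j)%:E * (\1_(I_ j) t)%:E)) <= M%:E)%E.
  apply: le_trans hM; apply: ge0_le_integral_sup => // t.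
  - by move=> _; rewrite sume_ge0// => j _; rewrite mule_ge0 ?lee_fin.
  - by rewrite /= in_itv/= andbT => /W0.
  - rewrite /= in_itv/= andbT => rt.
    have [[j0 tI]|nI] := pselect (exists j : 'I_J, I_ j t); last first.
      rewrite big1; first exact: W0.
      by move=> j _; rewrite indicE memNset ?mule0// => tI; apply: nI; exists j.
    rewrite (bigD1 j0)//= big1 ?adde0; last first.
      move=> j jj0; rewrite indicE memNset ?mule0// => tj.
      move: tI tj; rewrite /I_ /= !in_itv/= => /andP[h1 h2] /andP[h3 h4].
      have tS i : 2 * t_ i = t_ i.+1 by rewrite /t_ mulrA -exprS.
      have mono i k : (i <= k)%N -> t_ i <= t_ k.
        by move=> ik; rewrite /t_ ler_pM2r// ler_eXn2l ?ltr1n// !ltnS.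
      case: (ltngtP j j0) => [jj|jj|jj]; last by move/eqP: jj0; apply; exact/val_inj.
        have := mono _ _ jj; rewrite -tS => h5.
        by have := lt_trans h1 (lt_le_trans h4 h5); rewrite ltxx.
      have := mono _ _ jj; rewrite -tS => h5.
      by have := lt_trans h3 (lt_le_trans h2 h5); rewrite ltxx.
    rewrite indicE mem_set// mule1.
    move: tI; rewrite /I_ /= in_itv/= => /andP[h1 h2].
    have t0 : 0 < t by exact: lt_trans r0 rt.
    rewrite /c EFinM; apply: lee_pmul.
    + by rewrite lee_fin mulr_ge0 ?exprn_ge0 ?mulr_ge0 ?powR_ge0 ?(ltW ln2_gt0) ?(ltW mn0).
    + by rewrite lee_fin divr_ge0.
    + rewrite lee_fin; apply: ler_pM.
      * by rewrite exprn_ge0 ?mulr_ge0 ?(ltW ln2_gt0).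
      * by rewrite mulr_ge0 ?powR_ge0 ?(ltW mn0).
      * apply: lerXn2r; rewrite ?nnegrE ?mulr_ge0 ?(ltW ln2_gt0)//.
          rewrite addr_ge0// ln_ge0//.
          by rewrite ler_pdivlMr// mul1r ltW.
        (* From [t > 2^(j+2) r] the logarithm is at least [(j+2) ln 2], and the added 1 is at least
           [ln 2]: together [(j+3) ln 2]. *)
        have l1 : ln (2 ^+ j0.+2) <= ln (t / r) :> R.
          rewrite ler_ln ?posrE ?exprn_gt0 ?divr_gt0//.
          by rewrite ler_pdivlMr// ltW.
        rewrite lnXn // in l1.
        rewrite -[X in X <= ln _]mulr_natr in l1.
        have E3 : j0.+3%:R = j0.+2%:R + 1 :> R by rewrite natr1.
        by rewrite E3 mulrDr mulr1 addrC lerD ?ln2_le1.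
      * have -> : t `^ (e - 1) = (t / t_ j0) `^ (e - 1) * t_ j0 `^ (e - 1).
          by rewrite -powRM ?divr_ge0 ?(ltW t0) ?(ltW (t_gt0 _))// mulfVK// gt_eqF.
        rewrite ler_wpM2r ?powR_ge0//.
        have u1 : 1 <= t / t_ j0 by rewrite ler_pdivlMr// mul1r ltW.
        have u2 : t / t_ j0 <= 2 by rewrite ler_pdivrMr// ltW.
        rewrite ge_min; have [e1|e1] := leP 1 e.
          by rewrite -[X in X <= _](powRr0 (t / t_ j0)) ler_powR ?subr_ge0.
        apply/orP; right.
        rewrite -[e - 1]opprB !powRN lef_pV2 ?posrE ?powR_gt0 ?(lt_le_trans ltr01 u1)//.
        apply: ge0_ler_powR; rewrite ?nnegrE ?subr_ge0 ?(ltW e1)//.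
        exact: le_trans u1.
    + apply: ess_inf_after_ge => s ts; rewrite ler_pdivrMr// mulrC; apply: FA.
      exact: lt_trans h1 ts.
rewrite ge0_integral_sum// in key; last 2 first.
- move=> j; apply/measurable_EFinP; apply: measurable_funM; first exact: measurable_cst.
  by apply: measurable_funTS; exact: (measurable_indic (mI j)).
- by move=> j t _; rewrite mule_ge0 ?lee_fin.
have kE : (\sum_(j < J) \int[lambda]_(t in `]r, +oo[) ((c j)%:E * (\1_(I_ j) t)%:E) =
    (\sum_(j < J) c j * t_ j)%:E)%E.
  rewrite -sumEFin; apply: eq_bigr => j _.
  rewrite ge0_integralZl_EFin//; last first.
    by apply/measurable_EFinP; apply: measurable_funTS; exact: (measurable_indic (mI j)).
  rewrite integral_indic//; last exact: measurable_itv.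
  rewrite (_ : _ `&` _ = I_ j); last first.
    apply/setIidl => t; rewrite /I_ /= !in_itv/= andbT => /andP[h _].
    exact: lt_trans (t_r j) h.
  have muI : lambda (I_ j) = (t_ j)%:E.
    rewrite /I_ lebesgue_measure_itv/= lte_fin ltr_pMl ?ltr1n//.
    by rewrite -EFinB; congr EFin; ring.
  by transitivity ((c j)%:E * (t_ j)%:E)%E; [congr (_ * _)%E; exact: muI|rewrite EFinM].
rewrite kE lee_fin in key.
rewrite /weight_const -/mn ler_pdivlMr ?mulr_gt0 ?exprn_gt0 ?ln2_gt0//.
rewrite mulr_suml -ler_pdivrMl// mulrC mulr_suml.
apply: le_trans key; rewrite le_eqVlt; apply/orP; left; apply/eqP.
apply: eq_bigr => j _; rewrite /c.
have -> : (2 ^+ j.+2 * r) `^ e = t_ j `^ (e - 1) * t_ j.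
  have tE : t_ j = t_ j `^ 1 by rewrite powRr1// ltW.
  rewrite [X in _ = _ * X]tE -powRD ?subrK//.
  by rewrite (gt_eqF (t_gt0 j)) implybT.
by rewrite exprMn; ring.
Qed.

End weights_sum.

(** One summand for each part of [b(x) - b(y)], split at the mean of [b] over the small ball. The
    exponents of 2 come from the volume factors met on the way down to L^1, from [1/p] for [f] alone
    and from [1/q + 1/p] for the product with the deviation of [b]. *)
Definition tail_const {R : realType} (n : nat) (p q lam : R) : R :=
  2 `^ (n%:R * (1 - p^-1)) +
  campanato_const n q lam * 2 `^ (n%:R * (1 - (q^-1 + p^-1))).

Section tail_factor.
Context {R : realType} {n : nat}.
Local Notation Rn := 'rV[R]_n.
Local Notation mu := (@lebesgueRn R n).
Hypothesis n_gt0 : (0 < n)%N.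
Variable x0 : Rn.
Local Notation B := (eball x0).

(* [N] stands for the Campanato norm of [b]. *)
Definition oscillation (b : Rn -> R) (lam N r : R) (x : Rn) : R :=
  `|b x - ball_mean b x0 r| * r `^ (- (n%:R * lam)) + N.

Lemma tail_const_gt0 (p q lam : R) : 0 < tail_const n p q lam.
Proof. by rewrite addr_gt0 ?mulr_gt0 ?powR_gt0 ?campanato_const_gt0. Qed.

Lemma oscillation_ge0 b lam N r x : 0 <= N -> 0 <= oscillation b lam N r x.
Proof. by move=> N0; rewrite addr_ge0// mulr_ge0 ?powR_ge0. Qed.

(** [b(x) - b(y) = (b(x) - me) - (b(y) - me)] with [me] the mean over the ball of radius [r]. The
    first part is a constant times [f]; the second is Hoelder's inequality with [campanato_dyadic],
    the source of [k.+1]. *)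
Lemma tail_factor (b f : Rn -> R) (p q lam N a r : R) k (x : Rn) :
  1 < p -> 1 < q -> q^-1 + p^-1 < 1 -> 0 < lam -> 0 <= N -> 0 <= a -> 0 < r ->
  measurable_fun setT b -> measurable_fun setT f ->
  (campanato_norm q lam x0 b <= N%:E)%E ->
  Lp_le mu p^-1 (B (2 ^+ k * r)) f a ->
  (\int[mu]_(y in B (2 ^+ k * r)) `|(b x - b y) * f y|%:E <=
   (tail_const n p q lam * oscillation b lam N r x *
     (k.+1%:R * (2 ^+ k * r) `^ (n%:R * lam + n%:R - n%:R * p^-1) * a))%:E)%E.
Proof.
move=> p1 q1 pq1 lam0 N0 a0 r0 mb mf bN fa.
set t := 2 ^+ k * r; set me := ball_mean b x0 r.
have t0 : 0 < t by rewrite mulr_gt0 ?exprn_gt0.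
have rt : r <= t by rewrite ler_peMl ?(ltW r0)// exprn_ege1// ler1n.
have p0 : 0 < p^-1 by rewrite invr_gt0; lra.
have q0 : 0 < q^-1 by rewrite invr_gt0; lra.
have mE : measurable (B t) by exact: measurable_eball.
have mbx : measurable_fun (B t) (fun y => b y - me).
  by apply: measurable_funB; [exact: measurable_funTS|exact: measurable_cst].
have mfB : measurable_fun (B t) f by exact: measurable_funTS.
pose dl : R := 1 - (q^-1 + p^-1).
have v0 : 0 <= vol x0 t by rewrite ltW// vol_gt0.
have H1 : Lp_le mu 1 (B t) f (a * vol x0 t `^ (1 - p^-1)).
  have := @Lp_le_lower0 _ _ _ mu p^-1 (1 - p^-1) (B t) f a (vol x0 t) p0.
  rewrite (_ : p^-1 + (1 - p^-1) = 1); last by ring.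
  by apply=> //; [lra|exact: mu_eball_le].
have H1' := Lp_leZ (b x - me) ltr01 mE mfB (mulr_ge0 a0 (powR_ge0 _ _)) H1.
have H2 := campanato_dyadic n_gt0 mb q1 lam0 N0 bN k r0.
rewrite -/t -/me in H2.
set c4 := campanato_const n q lam in H2.
have c40 : 0 < c4 by exact: campanato_const_gt0.
have ga0 : 0 <= c4 * N * k.+1%:R * t `^ (n%:R * (q^-1 + lam)).
  by rewrite !mulr_ge0 ?powR_ge0 ?(ltW c40).
have H3 := Lp_leM0 q0 p0 mE mbx mfB ga0 a0 H2 fa.
have H4 : Lp_le mu 1 (B t) (fun y => (b y - me) * f y)
   (c4 * N * k.+1%:R * t `^ (n%:R * (q^-1 + lam)) * a * vol x0 t `^ dl).
  have := @Lp_le_lower0 _ _ _ mu (q^-1 + p^-1) dl (B t) (fun y => (b y - me) * f y) _ (vol x0 t) _ _ mE _ _ v0 (mu_eball_le x0 t0) H3.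
  rewrite (_ : q^-1 + p^-1 + dl = 1); last by rewrite /dl; ring.
  apply.
  - by rewrite addr_gt0.
  - by rewrite subr_gt0.
  - exact: measurable_funM.
  - by rewrite mulr_ge0.
have H4' := Lp_leZ (-1) ltr01 mE (measurable_funM mbx mfB)
  (mulr_ge0 (mulr_ge0 ga0 a0) (powR_ge0 _ _)) H4.
have m1 : measurable_fun (B t) (fun y => (b x - me) * f y).
  by apply: measurable_funM => //; exact: measurable_cst.
have m2 : measurable_fun (B t) (fun y => -1 * ((b y - me) * f y)).
  by apply: measurable_funM; [exact: measurable_cst|exact: measurable_funM].
have l01 : (0 < (1 : R) <= 1) by rewrite ltr01 lexx.
have g1 : 0 <= `|b x - me| * (a * vol x0 t `^ (1 - p^-1)).
  by rewrite !mulr_ge0 ?powR_ge0.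
have g2 : 0 <= `|-1| * (c4 * N * k.+1%:R * t `^ (n%:R * (q^-1 + lam)) * a * vol x0 t `^ dl).
  by rewrite mulr_ge0// mulr_ge0 ?powR_ge0// mulr_ge0.
have := Lp_leD l01 mE m1 m2 g1 g2 H1' H4'.
rewrite Lp_le1; last exact: addr_ge0.
under eq_integral do rewrite mulN1r -mulrBl opprB addrA subrK.
move=> H; apply: le_trans H _; rewrite lee_fin normrN1 mul1r.
set ex := n%:R * lam + n%:R - n%:R * p^-1.
have V1 : vol x0 t `^ (1 - p^-1) <= 2 `^ (n%:R * (1 - p^-1)) * t `^ (n%:R * (1 - p^-1)).
  by apply: vol_powR_le => //; lra.
have V2 : vol x0 t `^ dl <= 2 `^ (n%:R * dl) * t `^ (n%:R * dl).
  by apply: vol_powR_le => //; rewrite /dl; lra.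
have tt0 : (t == 0) = false by rewrite gt_eqF.
have E1 : t `^ (n%:R * (1 - p^-1)) = t `^ ex * t `^ (- (n%:R * lam)).
  by rewrite -powRD ?tt0 ?implybT//; congr (_ `^ _); rewrite /ex; ring.
have E2 : t `^ (n%:R * (q^-1 + lam)) * t `^ (n%:R * dl) = t `^ ex.
  by rewrite -powRD ?tt0 ?implybT//; congr (_ `^ _); rewrite /ex /dl; ring.
(* The first part has a surplus factor [t^(- n lam)]. As [r <= t], it is at most the weight
   [r^(- n lam)] built into [oscillation], and both parts then carry the same power of [t]. *)
have tr : t `^ (- (n%:R * lam)) <= r `^ (- (n%:R * lam)).
  rewrite !powRN lef_pV2 ?posrE ?powR_gt0//.
  by apply: ge0_ler_powR; rewrite ?nnegrE ?(ltW r0) ?(ltW t0)// mulr_ge0 ?(ltW lam0).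
have k1 : 1 <= k.+1%:R :> R by rewrite ler1n.
have c4E : campanato_const n q lam = c4 by [].
set A := `|b x - me|; have A0 : 0 <= A by exact: normr_ge0.
have B1 : A * (a * vol x0 t `^ (1 - p^-1)) <=
   2 `^ (n%:R * (1 - p^-1)) * (A * r `^ (- (n%:R * lam))) * (k.+1%:R * t `^ ex * a).
  apply: (@le_trans _ _ (A * (a * (2 `^ (n%:R * (1 - p^-1)) * (t `^ ex * r `^ (- (n%:R * lam))))))).
    apply: ler_wpM2l => //; apply: ler_wpM2l => //; apply: (le_trans V1).
    by rewrite E1; apply: ler_wpM2l; rewrite ?powR_ge0//; apply: ler_wpM2l; rewrite ?powR_ge0.
  rewrite (_ : _ * (_ * (_ * (_ * _))) = 2 `^ (n%:R * (1 - p^-1)) * (A * r `^ (- (n%:R * lam))) * (1 * t `^ ex * a)); last by ring.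
  apply: ler_wpM2l; first by rewrite !mulr_ge0 ?powR_ge0.
  by apply: ler_wpM2r => //; apply: ler_wpM2r; rewrite ?powR_ge0.
have B2 : c4 * N * k.+1%:R * t `^ (n%:R * (q^-1 + lam)) * a * vol x0 t `^ dl <=
   c4 * 2 `^ (n%:R * dl) * N * (k.+1%:R * t `^ ex * a).
  rewrite -E2.
  rewrite (_ : c4 * 2 `^ (n%:R * dl) * N * _ = c4 * N * k.+1%:R * t `^ (n%:R * (q^-1 + lam)) * a * (2 `^ (n%:R * dl) * t `^ (n%:R * dl))); last by ring.
  by apply: ler_wpM2l V2; rewrite mulr_ge0.
apply: (le_trans (lerD B1 B2)); rewrite -mulrDl; apply: ler_wpM2r.
  by rewrite !mulr_ge0 ?powR_ge0.
rewrite /tail_const /oscillation -/me -/A c4E -/dl; clearbody c4.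
set u := 2 `^ _; set v := 2 `^ _; set w := r `^ _.
have u0 : 0 <= u by exact: powR_ge0.
have vv0 : 0 <= v by exact: powR_ge0.
have w0 : 0 <= w by exact: powR_ge0.
rewrite [leRHS](_ : _ = u * (A * w) + c4 * v * N + (u * N + c4 * v * (A * w))); last by ring.
rewrite lerDl addr_ge0 ?mulr_ge0 ?(ltW c40)//.
Qed.

End tail_factor.

(** * The kernel integral away from the double ball *)

Section tail_bound.
Context {R : realType} {n m : nat}.
Local Notation Rn := 'rV[R]_n.
Local Notation mu := (@lebesgueRn R n).
Local Notation mum := (tuple_measure mu m).

Lemma prod_powR (I : finType) (t : R) (a : I -> R) : 0 < t ->
  \prod_i t `^ a i = t `^ (\sum_i a i).
Proof.
move=> t0; apply: (big_ind2 (fun u v => u = t `^ v)) => [|u u' v v' -> ->|//].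
  by rewrite powRr0.
by rewrite powRD ?(gt_eqF t0) ?implybT.
Qed.

Lemma lee_prod (I : finType) (x y : I -> \bar R) : (forall i, 0 <= x i)%E ->
  (forall i, x i <= y i)%E -> (\prod_i x i <= \prod_i y i)%E.
Proof.
move=> x0 xy; suff : (0 <= \prod_i x i /\ \prod_i x i <= \prod_i y i)%E by case.
apply: (big_ind2 (fun u v => 0 <= u /\ u <= v)%E) => // u u' v v' [u0 uu'] [v0 vv'].
by split; [exact: mule_ge0|exact: lee_pmul].
Qed.

(** Take the least [j] for which all points lie in the ball of radius [2^(j+2) r]: by minimality
    some point is outside the next smaller ball, and for [j = 0] this is the hypothesis. *)
Lemma dyadic_annulus (x0 : Rn) (r : R) (y : m.-tuple Rn) : 0 < r ->
  (exists i, 2 * r <= enorm (tnth y i - x0)) ->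
  exists j, (forall i, eball x0 (2 ^+ j.+2 * r) (tnth y i)) /\
    exists i, 2 ^+ j.+1 * r <= enorm (tnth y i - x0).
Proof.
move=> r0 [i0 hi0].
pose P j := [forall i, enorm (tnth y i - x0) < 2 ^+ j.+2 * r].
have exP : exists j, P j.
  pose M : R := \sum_i enorm (tnth y i - x0).
  have M0 : 0 <= M by apply: sumr_ge0 => i _; exact: enorm_ge0.
  exists (Num.truncn (M / r)); apply/forallP => i.
  have h1 : enorm (tnth y i - x0) <= M.
    by rewrite /M (bigD1 i)//= lerDl sumr_ge0// => j _; exact: enorm_ge0.
  apply: (le_lt_trans h1); rewrite -ltr_pdivrMr//.
  have := truncnS_gt (M / r); set N := Num.truncn _ => h.
  apply: (lt_le_trans h); rewrite -natrX ler_nat.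
  by apply: (leq_trans _ (leq_pexp2l _ (leqnSn N.+1))) => //; rewrite ltnW// ltn_expl.
have [j Pj minj] := ex_minnP exP.
exists j; split; first by move=> i; have /forallP := Pj; apply.
case: j Pj minj => [|j] Pj minj; first by exists i0; rewrite expr1.
have /forallPn[i hi] : ~~ P j by apply/negP => /minj; rewrite ltnn.
by exists i; rewrite leNgt.
Qed.

Variables (K : m.+1.-tuple Rn -> R) (CK : R).
Local Notation Kz := (off_diag_ext K).
Hypothesis CK_gt0 : 0 < CK.
Hypothesis CK_bound : forall (x : Rn) (y : m.-tuple Rn) i (dl : R),
  0 < dl -> dl <= enorm (x - tnth y i) -> `|Kz [tuple of x :: y]| <= CK / dl ^+ (m * n).
Hypothesis n_gt0 : (0 < n)%N.
Variables (x0 : Rn) (ps qs lam : 'I_m -> R).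
Hypotheses (ps_gt1 : forall i, 1 < ps i) (qs_gt1 : forall i, 1 < qs i)
  (pqs : forall i, (qs i)^-1 + (ps i)^-1 < 1) (lam_gt0 : forall i, 0 < lam i).
Local Notation B := (eball x0).
Let e := n%:R * (\sum_i lam i) - n%:R * (\sum_i (ps i)^-1).

(** On the [j]-th annulus the kernel is at most [c j]; enlarging the annulus to a product of balls
    leaves a product of functions of one variable, whose integral factors into those of
    [tail_factor]. [G] is general so as to cover the gathered far integral as well as each single
    term of the splitting. *)
Lemma tail_bound (b f : 'I_m -> Rn -> R) (N : 'I_m -> R) (F : 'I_m -> nat -> R)
    (r S : R) (x : Rn) (G : m.-tuple Rn -> R) :
  0 < r -> (forall i, measurable_fun setT (b i)) -> (forall i, measurable_fun setT (f i)) ->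
  (forall i, 0 <= N i) -> (forall i, campanato_norm (qs i) (lam i) x0 (b i) <= (N i)%:E)%E ->
  (forall i j, 0 <= F i j) ->
  (forall i j, Lp_le mu (ps i)^-1 (B (2 ^+ j.+2 * r)) (f i) (F i j)) ->
  (forall J, \sum_(j < J) (j.+3%:R ^+ m * (2 ^+ j.+2 * r) `^ e * \prod_i F i j) <= S) ->
  B r x ->
  (forall y, `|G y| <= \prod_i `|(b i x - b i (tnth y i)) * f i (tnth y i)|) ->
  (forall y, G y != 0 -> exists i, 2 * r <= enorm (tnth y i - x0)) ->
  (\int[mum]_y `|Kz [tuple of x :: y] * G y|%:E <=
   (CK * 4 ^+ (m * n) * \prod_i tail_const n (ps i) (qs i) (lam i) *
    S * \prod_i oscillation x0 (b i) (lam i) (N i) r x)%:E)%E.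
Proof.
move=> r0 mb mf N0 bN F0 fF FS Bx Gle Gfar.
pose g j i (z : Rn) : \bar R := (`|(b i x - b i z) * f i z| * \1_(B (2 ^+ j.+2 * r)) z)%:E.
have g0 j i z : (0 <= g j i z)%E by rewrite lee_fin mulr_ge0.
have mg j i : measurable_fun setT (g j i).
  apply/measurable_EFinP; apply: measurable_funM; last first.
    exact: (measurable_indic (measurable_eball _ _)).
  apply: measurableT_comp => //; apply: measurable_funM => //.
  by apply: measurable_funB => //; exact: measurable_cst.
pose c j : R := CK / (2 ^+ j * r) ^+ (m * n).
have c0 j : 0 <= c j by rewrite divr_ge0 ?(ltW CK_gt0)// exprn_ge0// mulr_ge0 ?(ltW r0)// exprn_ge0.
pose h j (y : m.-tuple Rn) : \bar R := ((c j)%:E * \prod_i g j i (tnth y i))%E.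
have h0 j y : (0 <= h j y)%E by rewrite mule_ge0 ?lee_fin// prode_ge0.
have mh j : measurable_fun setT (h j).
  by apply: emeasurable_funM; [exact: measurable_cst|exact: measurable_prod_tnth].
have le1 : (\int[mum]_y `|Kz [tuple of x :: y] * G y|%:E <=
    \int[mum]_y (\sum_(0 <= j <oo) h j y))%E.
  apply: ge0_le_integral_sup => //.
  - by move=> y _; exact: nneseries_ge0.
  - move=> y _; have [->|Gy] := eqVneq (G y) 0.
      by rewrite mulr0 normr0; exact: nneseries_ge0.
    have [j [yB [i yi]]] := dyadic_annulus r0 (Gfar _ Gy).
    (* Here [y_i] is at distance at least [2^(j+1) r] from [x0], and [x] at distance less than
       [r <= 2^j r]. *)
    have xy : 2 ^+ j * r <= enorm (x - tnth y i).
      have := enorm_dist_triangle x (tnth y i) x0; rewrite [enorm (tnth y i - x)]enorm_distC.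
      have : enorm (x - x0) < r by exact: Bx.
      have : r <= 2 ^+ j * r by rewrite ler_peMl ?(ltW r0)// exprn_ege1// ler1n.
      by move: yi; rewrite exprS -mulrA; set u := 2 ^+ j * r; lra.
    have hle : (`|Kz [tuple of x :: y] * G y|%:E <= h j y)%E.
      rewrite /h /g (_ : (\prod_i _)%E = (\prod_i `|(b i x - b i (tnth y i)) * f i (tnth y i)|)%:E); last first.
        rewrite -prodEFin; apply: eq_bigr => k _.
        by rewrite indicE mem_set ?mulr1//; exact: yB.
      rewrite -EFinM lee_fin normrM; apply: ler_pM => //.
      by apply: CK_bound xy; rewrite mulr_gt0 ?exprn_gt0.
    apply: (le_trans hle); apply: (@le_trans _ _ (\sum_(0 <= k < j.+1) h k y)%E).
      by rewrite big_nat_recr//= leeDr// sume_ge0.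
    by apply: nneseries_lim_ge => // k _; exact: h0.
apply: (le_trans le1); rewrite integral_nneseries//.
apply: lime_le; first by apply: is_cvg_nneseries => k _ _; exact: integral_ge0.
apply: nearW => J.
set D := \prod_i tail_const _ _ _ _; set W := \prod_i oscillation _ _ _ _ _ _.
have D0 : 0 <= D by apply: prodr_ge0 => i _; exact/ltW/tail_const_gt0.
have W0 : 0 <= W by apply: prodr_ge0 => i _; exact: oscillation_ge0.
have term j : (\int[mum]_y h j y <=
   (CK * 4 ^+ (m * n) * D * W * (j.+3%:R ^+ m * (2 ^+ j.+2 * r) `^ e * \prod_i F i j))%:E)%E.
  set t := 2 ^+ j.+2 * r.
  have t0 : 0 < t by rewrite mulr_gt0 ?exprn_gt0.
  rewrite /h ge0_integralZl_EFin//; [|by move=> y _; exact: prode_ge0|exact: measurable_prod_tnth].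
  rewrite integral_prod_tnth//.
  have le2 : (\prod_i \int[mu]_z g j i z <= \prod_i (tail_const n (ps i) (qs i) (lam i) *
      oscillation x0 (b i) (lam i) (N i) r x *
     (j.+3%:R * t `^ (n%:R * lam i + n%:R - n%:R * (ps i)^-1) * F i j))%:E)%E.
    apply: lee_prod => i; first exact: integral_ge0.
    rewrite (_ : \int[mu]_z g j i z = \int[mu]_(z in B t) `|(b i x - b i z) * f i z|%:E)%E.
      exact: tail_factor.
    rewrite [RHS]integral_mkcond; apply: eq_integral => z _.
    rewrite patchE /g indicE; case: ifP => _; first by rewrite mulr1.
    by rewrite mulr0.
  apply: (le_trans (lee_wpmul2l _ le2)); first by rewrite lee_fin.
  rewrite prodEFin -EFinM lee_fin !big_split/= -/D -/W prodr_const card_ord.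
  (* The summands [n] of the exponents add up to [m n], and since [t = 4 * 2^j r] the power
     [t^(m n)] cancels the denominator of the kernel bound up to [4^(m n)]. *)
  rewrite prod_powR// (_ : \sum_i _ = e + (m * n)%:R); last first.
    rewrite /e !mulr_sumr -sumrB !big_split/= sumrN sumr_const card_ord.
    by rewrite -[n%:R *+ m]mulr_natl natrM; ring.
  rewrite powRD ?(gt_eqF t0) ?implybT// powR_mulrn ?(ltW t0)//.
  have -> : t = 4 * (2 ^+ j * r) by rewrite /t !exprS; ring.
  rewrite [(4 * _) ^+ (m * n)]exprMn /c.
  set v := (2 ^+ j * r) ^+ (m * n); set u := (4 * _) `^ e.
  have v0 : v != 0 by rewrite expf_neq0// mulf_neq0 ?expf_neq0 ?gt_eqF.
  by rewrite le_eqVlt; apply/orP; left; apply/eqP; field.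
apply: (@le_trans _ _ (\sum_(0 <= j < J) (CK * 4 ^+ (m * n) * D * W * (j.+3%:R ^+ m * (2 ^+ j.+2 * r) `^ e * \prod_i F i j))%:E)%E).
  by apply: lee_sum => j _; exact: term.
rewrite big_mkord sumEFin lee_fin -mulr_sumr.
rewrite [leRHS](_ : _ = CK * 4 ^+ (m * n) * D * W * S); last by ring.
apply: ler_wpM2l (FS J); rewrite !mulr_ge0 ?(ltW CK_gt0) ?exprn_ge0//.
Qed.

End tail_bound.

(** * Local norms and Morrey functions *)

Section local_norm.
Context {R : realType} {n : nat}.
Local Notation Rn := 'rV[R]_n.
Local Notation mu := (@lebesgueRn R n).
Hypothesis n_gt0 : (0 < n)%N.
Variables (x0 : Rn) (p : R).
Hypothesis p_gt1 : 1 < p.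
Local Notation B := (eball x0).

Definition local_norm (f : Rn -> R) (t : R) : R :=
  fine (\int[mu]_(x in B t) (`|f x| `^ p)%:E) `^ p^-1.

Lemma local_norm_ge0 f t : 0 <= local_norm f t.
Proof. exact: powR_ge0. Qed.

Lemma Lp_le_lty (E : set Rn) f a : Lp_le mu p^-1 E f a -> (\int[mu]_(x in E) (`|f x| `^ p)%:E < +oo)%E.
Proof. by rewrite /Lp_le invrK => h; apply: (le_lt_trans h); rewrite ltry. Qed.

Lemma Lp_le_local_norm f t : (\int[mu]_(x in B t) (`|f x| `^ p)%:E < +oo)%E ->
  Lp_le mu p^-1 (B t) f (local_norm f t).
Proof.
move=> h; have p0 : p != 0 by rewrite gt_eqF// (lt_trans ltr01).
have i0 : (0 <= \int[mu]_(x in B t) (`|f x| `^ p)%:E)%E.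
  by apply: integral_ge0 => x _; rewrite lee_fin powR_ge0.
rewrite /Lp_le /local_norm invrK -powRrM mulVf// powRr1 ?fine_ge0//.
by rewrite fineK// ge0_fin_numE.
Qed.

Lemma local_norm_le f t s a : t <= s -> 0 <= a -> Lp_le mu p^-1 (B s) f a -> local_norm f t <= a.
Proof.
move=> ts a0 fa.
have p0 : 0 < p^-1 by rewrite invr_gt0 (lt_trans ltr01).
have a00 : (0 <= a <= a) by rewrite a0 lexx.
have fat : Lp_le mu p^-1 (B t) f a.
  by apply: (Lp_le_sub _ p0 a00 _ fa) => //; exact: le_eball.
have i0 : (0 <= \int[mu]_(x in B t) (`|f x| `^ p)%:E)%E.
  by apply: integral_ge0 => x _; rewrite lee_fin powR_ge0.
rewrite /local_norm; have pE : a = (a `^ p) `^ p^-1.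
  by rewrite -powRrM mulfV ?powRr1// gt_eqF// (lt_trans ltr01).
rewrite [leRHS]pE; apply: ge0_ler_powR; rewrite ?nnegrE ?(ltW p0) ?fine_ge0 ?powR_ge0//.
have := Lp_le_lty fat; move: fat; rewrite /Lp_le invrK => h1 h2.
by rewrite -lee_fin fineK// ge0_fin_numE.
Qed.

Lemma morrey_local (phi : Rn -> R -> R) f s : measurable_fun setT f ->
  (forall r, 0 < r -> 0 < phi x0 r) -> (morrey_norm p phi x0 f < +oo)%E -> 0 < s ->
  0 <= fine (morrey_norm p phi x0 f) /\
  Lp_le mu p^-1 (B s) f (fine (morrey_norm p phi x0 f) * 2 `^ (n%:R / p) * (phi x0 s * s `^ (n%:R / p))).
Proof.
move=> mf phi0 foo s0.
have p0 : 0 < p^-1 by rewrite invr_gt0 (lt_trans ltr01).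
have v0 : 0 < vol x0 s by exact: vol_gt0.
have [N0 NE] : 0 <= fine (morrey_norm p phi x0 f) /\ (fine (morrey_norm p phi x0 f))%:E = morrey_norm p phi x0 f.
  have h : (0 <= morrey_norm p phi x0 f)%E.
    apply: (@le_trans _ _ (((phi x0 s)^-1 * vol x0 s `^ (- p^-1))%:E *
                  Lnorm mu p%:E (EFin \o (f \_ (eball x0 s))))%E).
      by rewrite mule_ge0 ?Lnorm_ge0// lee_fin mulr_ge0 ?invr_ge0 ?powR_ge0 ?(ltW (phi0 _ s0)).
    by apply: ereal_sup_ubound; exists s.
  by split; [exact: fine_ge0|rewrite fineK// ge0_fin_numE].
split=> //; set A := fine _ in N0 NE *.
have := ereal_sup_ubound (S := [set (((phi x0 r)^-1 * vol x0 r `^ (- p^-1))%:E *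
                  Lnorm mu p%:E (EFin \o (f \_ (eball x0 r))))%E | r in [set r | 0 < r]]).
move=> /(_ (((phi x0 s)^-1 * vol x0 s `^ (- p^-1))%:E *
                  Lnorm mu p%:E (EFin \o (f \_ (eball x0 s))))%E) h.
have {}h : (((phi x0 s)^-1 * vol x0 s `^ (- p^-1))%:E *
                  Lnorm mu p%:E (EFin \o (f \_ (eball x0 s))) <= A%:E)%E.
  by rewrite NE; apply: h; exists s.
have ph0 := phi0 _ s0.
have h' : Lp_le mu p^-1 (B s) f (A * phi x0 s * vol x0 s `^ p^-1).
  apply/Lp_leP => //.
    by rewrite !mulr_ge0 ?powR_ge0 ?(ltW ph0).
  rewrite invrK.
  have c0 : 0 < (phi x0 s)^-1 * vol x0 s `^ (- p^-1) by rewrite mulr_gt0 ?invr_gt0 ?powR_gt0.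
  rewrite -(lee_pmul2l _ (_ : (0 < ((phi x0 s)^-1 * vol x0 s `^ (- p^-1))%:E)%E))//.
  apply: (le_trans h); rewrite -EFinM lee_fin powRN le_eqVlt; apply/orP; left; apply/eqP.
  by field; rewrite !gt_eqF ?powR_gt0.
apply: (Lp_le_sub (h := f) _ p0 _ _ h') => //.
rewrite !mulr_ge0 ?powR_ge0 ?(ltW ph0)//=.
have := vol_powR_le n_gt0 x0 s0 (ltW p0) => h2.
rewrite (_ : _ * (phi x0 s * _) = A * phi x0 s * (2 `^ (n%:R / p) * s `^ (n%:R / p))); last by ring.
by apply: ler_wpM2l h2; rewrite mulr_ge0 ?(ltW ph0).
Qed.

End local_norm.

(** * The commutator on a ball *)

Section locally_Lp.
Context {R : realType} {n : nat}.
Local Notation Rn := 'rV[R]_n.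
Local Notation mu := (@lebesgueRn R n).
Variable x0 : Rn.
Local Notation B := (eball x0).

(** Balls around [x0] instead of compact sets, the form in which all estimates come; both directions
    of the translation to [in_Lp_loc] follow. *)
Definition locally_Lp (s : R) (g : Rn -> R) : Prop :=
  measurable_fun setT g /\
  forall t, (\int[mu]_(x in B t) (`|g x| `^ s)%:E < +oo)%E.

Lemma locally_LpP (s : R) (g : Rn -> R) : 1 < s -> locally_Lp s g <->
  measurable_fun setT g /\ forall t, exists2 a, 0 <= a & Lp_le mu s^-1 (B t) g a.
Proof.
move=> s1; split=> -[mg h]; split=> // t.
- by exists (local_norm x0 s g t); [exact: local_norm_ge0|exact: Lp_le_local_norm].
- by have [a _ /Lp_le_lty] := h t.
Qed.

Lemma locally_Lp_supported (s : R) (g : Rn -> R) t : 1 < s -> locally_Lp s g ->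
  supported_Lp s (B t) (g \_ (B t)).
Proof.
move=> s1 [mg h]; have s0 : 0 < s by exact: lt_trans s1.
split; [|by move=> x Bx; exact: patch_eq0|by rewrite integral_power_patch].
exact: measurable_patch_set (measurable_eball x0 t) mg.
Qed.

Lemma in_Lp_loc_locally (s : R) (g : Rn -> R) : in_Lp_loc s g -> locally_Lp s g.
Proof.
move=> [mg h]; split=> // t.
set A := cbox (fun i => x0 ord0 i - t) (fun i => x0 ord0 i + t).
have BA : B t `<=` A.
  move=> x /eball_obox xB; rewrite /A /cbox /= => i; have /= := xB i.
  by move=> /andP[h1 h2]; rewrite (ltW h1) (ltW h2).
apply: le_lt_trans (h A (@cbox_compact _ _ _ _)).
by apply: ge0_le_integral_sup => // x _; rewrite lee_fin powR_ge0.
Qed.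

Lemma locally_Lp_in_Lp_loc (s : R) (g : Rn -> R) : locally_Lp s g -> in_Lp_loc s g.
Proof.
move=> [mg h]; split=> // A cA.
have [M [_ hM]] := compact_bounded cA.
have M1 : M < M + 1 by rewrite ltrDl.
pose t := n%:R * `|M + 1| + `|\sum_i `|x0 ord0 i| | + 1.
have AB : A `<=` B t.
  move=> y Ay; rewrite /eball /=; apply: (le_lt_trans (enorm_le_sum _)).
  apply: (@le_lt_trans _ _ (\sum_(i < n) (`|M + 1| + `|x0 ord0 i|))).
    apply: ler_sum => i _; rewrite !mxE; apply: (le_trans (ler_normB _ _)).
    rewrite lerD2r; have /= := hM (M + 1) M1 y Ay.
    move=> hy; apply: le_trans (ler_norm _); apply: le_trans hy.
    change (`|y ord0 i| <= mx_norm y); rewrite mx_normrE.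
    exact: (le_bigmax _ (fun ij : 'I_1 * 'I_n => `|y ij.1 ij.2|) (ord0, i)).
  rewrite big_split/= sumr_const card_ord -[_ *+ n]mulr_natl /t.
  by rewrite -addrA ltrD2l; apply: (le_lt_trans (ler_norm _)); rewrite ltrDl.
apply: le_lt_trans (h t).
by apply: ge0_le_integral_sup => // x _; rewrite lee_fin powR_ge0.
Qed.

Lemma locally_Lp_mul (q p : R) (b f : Rn -> R) : 1 < q -> 1 < p -> q^-1 + p^-1 < 1 ->
  locally_Lp q b -> locally_Lp p f -> locally_Lp (q^-1 + p^-1)^-1 (b \* f).
Proof.
move=> q1 p1 pq1 hb hf; have s1 : 1 < (q^-1 + p^-1)^-1.
  by rewrite invf_gt1// addr_gt0// invr_gt0 (lt_trans ltr01).
move: hb hf; rewrite !locally_LpP// => -[mb hb] [mf hf].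
split=> [|t]; first exact: measurable_funM.
have [a a0 ba] := hb t; have [c c0 fc] := hf t; exists (a * c); first exact: mulr_ge0.
rewrite invrK; apply: Lp_leM0 => //; rewrite ?invr_gt0 ?(lt_trans ltr01)//.
- exact: measurable_eball.
- exact: measurable_funTS.
- exact: measurable_funTS.
Qed.

(** Places [f] in the space that contains [b \* f], so that a single tuple of exponents serves for
    all [sigma] when the commutator is expanded. *)
Lemma locally_Lp_lower (q p : R) (f : Rn -> R) : 1 < q -> 1 < p -> q^-1 + p^-1 < 1 ->
  locally_Lp p f -> locally_Lp (q^-1 + p^-1)^-1 f.
Proof.
move=> q1 p1 pq1; have s1 : 1 < (q^-1 + p^-1)^-1.
  by rewrite invf_gt1// addr_gt0// invr_gt0 (lt_trans ltr01).
rewrite !locally_LpP// => -[mf hf]; split=> // t.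
have [c c0 fc] := hf t.
have v0 : 0 <= fine (mu (B t)) by exact: fine_ge0.
exists (c * fine (mu (B t)) `^ q^-1); first by rewrite mulr_ge0 ?powR_ge0.
rewrite invrK addrC; apply: Lp_le_lower0 => //; rewrite ?invr_gt0 ?(lt_trans ltr01)//.
- exact: measurable_eball.
- exact: measurable_funTS.
- by rewrite fineK// ge0_fin_numE// lebesgueRn_eball_lty.
Qed.

Lemma locally_Lp_subC (q c : R) (b : Rn -> R) : 1 < q -> locally_Lp q b ->
  locally_Lp q (fun x => b x - c).
Proof.
move=> q1; have q0 : 0 < q^-1 by rewrite invr_gt0 (lt_trans ltr01).
move=> /(locally_LpP _ q1)[mb hb]; apply/(locally_LpP _ q1); split=> [|t].
  by apply: measurable_funB => //; exact: measurable_cst.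
have [a a0 ba] := hb t; set v := fine (mu (B t)).
have v0 : 0 <= v by exact: fine_ge0.
have mE : measurable (B t) by exact: measurable_eball.
have m1 : measurable_fun (B t) (fun=> 1 : R) by exact: measurable_cst.
have mb' : measurable_fun (B t) b by exact: measurable_funTS.
have h1 : Lp_le mu q^-1 (B t) (fun=> 1) (v `^ q^-1).
  apply: Lp_le_cst1 => //.
  by rewrite fineK// ge0_fin_numE// lebesgueRn_eball_lty.
have h2 := Lp_leZ (- c) q0 mE m1 (powR_ge0 _ _) h1.
have a1 : 0 <= `|- c| * v `^ q^-1 by rewrite mulr_ge0 ?powR_ge0.
have q01 : 0 < q^-1 <= 1 by rewrite q0 invf_le1 ?(ltW q1)// (lt_trans ltr01).
have m2 : measurable_fun (B t) (fun=> - c * 1) by exact: measurable_cst.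
exists (a + `|- c| * v `^ q^-1); first exact: addr_ge0.
have := Lp_leD q01 mE mb' m2 a0 a1 ba h2.
by rewrite (_ : (fun x => b x + _) = (fun x => b x - c))//; apply/funext => x; rewrite mulr1.
Qed.

End locally_Lp.

Section subset_sums.

Lemma sum_subset_pair (I : finType) (i0 : I) (V : zmodType) (F : {set I} -> V) :
  \sum_sigma F sigma = \sum_(sigma : {set I} | i0 \notin sigma) (F sigma + F (i0 |: sigma)%SET).
Proof.
rewrite (bigID (fun sigma : {set I} => i0 \in sigma))/= addrC big_split/=; congr +%R.
rewrite (reindex_onto (fun sigma => i0 |: sigma)%SET (fun sigma => sigma :\ i0)%SET)/=; last first.
  by move=> sigma h; rewrite finset.setD1K.
apply: eq_bigl => sigma; rewrite finset.setU11/=.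
apply/eqP/idP => [<-|h]; first by rewrite finset.setD11.
by rewrite finset.setU1K.
Qed.

(** The expansion that defines [commutator_cpt], at the level of integrands; it resums the kernel
    integrals obtained for the separate [sigma]. *)
Lemma prod_sub_expand (R : comPzRingType) (I : finType) (beta b g : I -> R) :
  \sum_(sigma : {set I}) (-1) ^+ #|sigma| * (\prod_(i | i \notin sigma) beta i) *
    \prod_i (if i \in sigma then b i * g i else g i) =
  \prod_i ((beta i - b i) * g i).
Proof.
under [RHS]eq_bigr do rewrite mulrBl addrC.
rewrite bigA_distr; apply: eq_bigr => sigma _.
rewrite -prodr_const [X in X * _ * _]big_mkcond [X in _ * X * _]big_mkcond -!big_split/=.
by apply: eq_bigr => i _; case: ifP => _; rewrite ?mulN1r ?mulNr ?mul1r ?mulr1.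
Qed.

End subset_sums.

Section power_product.
Context d (T : measurableType d) (R : realType) (mu : {measure set T -> \bar R}).

Lemma Lp_le_mul_prod (I : Type) (L : seq I) (P : pred I) (th : I -> R) (th0 a0 : R) E
    (g0 : T -> R) (g : I -> T -> R) (a : I -> R) : 0 < th0 -> (forall i, 0 < th i) ->
  measurable E -> measurable_fun E g0 -> (forall i, measurable_fun E (g i)) ->
  0 <= a0 -> (forall i, 0 <= a i) -> Lp_le mu th0 E g0 a0 ->
  (forall i, P i -> Lp_le mu (th i) E (g i) (a i)) ->
  Lp_le mu (th0 + \sum_(i <- L | P i) th i) E
    (fun x => g0 x * \prod_(i <- L | P i) g i x) (a0 * \prod_(i <- L | P i) a i).
Proof.
move=> th00 thp mE mg0 mg a00 ap h0 h; elim: L => [|i L ih].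
  rewrite !big_nil addr0 mulr1.
  by under [X in Lp_le _ _ _ X]eq_fun do rewrite big_nil mulr1.
rewrite !big_cons; case: ifP => Pi; last first.
  by under [X in Lp_le _ _ _ X]eq_fun do rewrite big_cons Pi.
rewrite addrCA mulrCA; under [X in Lp_le _ _ _ X]eq_fun do rewrite big_cons Pi mulrCA.
apply: Lp_leM0 => //.
- by rewrite ltr_wpDr// sumr_ge0// => j _; rewrite ltW.
- apply: measurable_funM => //.
  elim: L {ih} => [|j L ihL].
    by under eq_fun do rewrite big_nil; exact: measurable_cst.
  under eq_fun do rewrite big_cons; case: (P j) => //.
  exact: measurable_funM.
- by rewrite mulr_ge0// prodr_ge0.
- exact: h.
Qed.

End power_product.

(** * Invariance of the commutator under constants added to the [b_i] *)

Section commutator_shift.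
Context {R : realType} {n m : nat}.
Local Notation Rn := 'rV[R]_n.
Local Notation mu := (@lebesgueRn R n).
Variables (T : ('I_m -> Rn -> R) -> (Rn -> R) -> R) (Te : ('I_m -> Rn -> R) -> Rn -> R).
Hypothesis T_Te : bounded_extension T Te.
Implicit Types (b g : 'I_m -> Rn -> R) (sigma : {set 'I_m}).

Definition comm_arg b g sigma : 'I_m -> Rn -> R :=
  fun i => if i \in sigma then b i \* g i else g i.

(** Written for a [beta] that may differ from [b] at [i0], with [beta i0] confined to the last
    bracket, so that two commutators differing there can be compared term by term. *)
Lemma commutator_cpt_pair b beta g i0 x : (forall i, i != i0 -> beta i = b i) ->
  commutator_cpt Te beta g x = \sum_(sigma : {set 'I_m} | i0 \notin sigma)
    (-1) ^+ #|sigma| * (\prod_(i | (i \notin sigma) && (i != i0)) b i x) *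
    (beta i0 x * Te (update (comm_arg b g sigma) i0 (g i0)) x -
     Te (update (comm_arg b g sigma) i0 (beta i0 \* g i0)) x).
Proof.
move=> bb; rewrite /commutator_cpt (sum_subset_pair i0); apply: eq_bigr => sigma i0s.
rewrite cardsU1 i0s add1n exprS [X in _ * X * _ + _](bigD1 i0)//=.
rewrite (_ : (fun i => if i \in sigma then beta i \* g i else g i) =
  update (comm_arg b g sigma) i0 (g i0)); last first.
  apply/funext => i; rewrite /update /comm_arg; case: (i =P i0) => [->|/eqP ii0].
    by rewrite (negbTE i0s).
  by rewrite bb.
rewrite (_ : (fun i => if i \in (i0 |: sigma)%SET then beta i \* g i else g i) =
  update (comm_arg b g sigma) i0 (beta i0 \* g i0)); last first.
  apply/funext => i; rewrite /update /comm_arg finset.in_setU1; case: (i =P i0) => [->//|/eqP ii0].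
  by rewrite /= bb.
rewrite (eq_bigr (fun i => b i x)); last by move=> i /andP[_ /bb ->].
rewrite [X in _ + _ * X * _](eq_big (fun i => (i \notin sigma) && (i != i0)) (fun i => b i x)).
- by ring.
- by move=> i; rewrite finset.in_setU1 negb_or andbC.
- by move=> i; rewrite finset.in_setU1 negb_or => /andP[/bb ->].
Qed.

Variable s : 'I_m -> R.
Hypothesis s_gt1 : forall i, 1 < s i.

(* Grouping sigma with i0 |: sigma, the terms in c cancel by linearity of Te. *)
Lemma commutator_cpt_shift1 b g i0 (c : R) : (forall i, in_Lp (s i) (g i)) ->
  (forall i, in_Lp (s i) (b i \* g i)) ->
  {ae mu, forall x, commutator_cpt Te (update b i0 (fun x => b i0 x - c)) g x =
    commutator_cpt Te b g x}.
Proof.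
move=> hg hbg.
have lin : {ae mu, forall x, forall sigma : {set 'I_m},
   Te (update (comm_arg b g sigma) i0 (fun x => - c * g i0 x + (b i0 \* g i0) x)) x =
   - c * Te (update (comm_arg b g sigma) i0 (g i0)) x +
   Te (update (comm_arg b g sigma) i0 (b i0 \* g i0)) x}.
  apply: filter_forall => sigma; apply: (extension_linear T_Te) => //.
  by move=> j; rewrite /comm_arg; case: ifP.
apply: filterS lin => x lin.
rewrite (@commutator_cpt_pair b b g i0)// (@commutator_cpt_pair b _ g i0); last first.
  by move=> i ii0; rewrite /update (negbTE ii0).
apply: eq_bigr => sigma _; congr (_ * _).
rewrite update_id (_ : (fun x => b i0 x - c) \* g i0 = fun x => - c * g i0 x + (b i0 \* g i0) x).
  by rewrite lin; ring.
by apply/funext => z /=; ring.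
Qed.

(** The shifts are made one index at a time; the list has no repetition, so each shift acts on the
    original [b i0]. *)
Lemma commutator_cpt_shift b g (c : 'I_m -> R) : (forall i, in_Lp (s i) (g i)) ->
  (forall i, in_Lp (s i) (b i \* g i)) ->
  (forall i, in_Lp (s i) ((fun x => b i x - c i) \* g i)) ->
  {ae mu, forall x, commutator_cpt Te (fun i x => b i x - c i) g x =
    commutator_cpt Te b g x}.
Proof.
move=> hg hbg hcg.
pose bL (L : seq 'I_m) i x := if i \in L then b i x - c i else b i x.
suff H L : uniq L -> {ae mu, forall x, commutator_cpt Te (bL L) g x = commutator_cpt Te b g x}.
  have := H (enum 'I_m) (enum_uniq _); rewrite (_ : bL _ = fun i x => b i x - c i)//.
  by apply/funext => i; apply/funext => x; rewrite /bL mem_enum.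
elim: L => [_|i0 L ih /=/andP[i0L uL]]; first exact: nearW.
have hL i : in_Lp (s i) (bL L i \* g i).
  by have := hbg i; have := hcg i; rewrite /bL; case: (i \in L).
apply: filterS2 (commutator_cpt_shift1 i0 (c i0) hg hL) (ih uL) => x + <- => <-.
congr (commutator_cpt Te _ g x); apply/funext => i; apply/funext => z.
rewrite /update /bL inE; case: (i =P i0) => [->|//=].
by rewrite (negbTE i0L).
Qed.

End commutator_shift.

Section Rintegral_sums.
Context d (T : measurableType d) (R : realType) (mu : {measure set T -> \bar R}).

Lemma Rintegral_lin_comb (I : finType) (P : pred I) (c : I -> R) (F : I -> T -> R) :
  (forall i, P i -> mu.-integrable setT (EFin \o F i)) ->
  mu.-integrable setT (EFin \o (fun y => \sum_(i | P i) c i * F i y)) /\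
  \int[mu]_y (\sum_(i | P i) c i * F i y) = \sum_(i | P i) c i * \int[mu]_y F i y.
Proof.
move=> iF.
have icF i : P i -> mu.-integrable setT (fun y => (c i * F i y)%:E).
  by move=> /iF h; apply: (integrableZl measurableT (c i) h).
suff H (L : seq I) : mu.-integrable setT (fun y => (\sum_(i <- L | P i) c i * F i y)%:E) /\
  \int[mu]_y (\sum_(i <- L | P i) c i * F i y) = \sum_(i <- L | P i) c i * \int[mu]_y F i y.
  by have := H (index_enum I).
elim: L => [|i L [ih1 ih2]].
  under eq_fun do rewrite big_nil; under eq_Rintegral do rewrite big_nil.
  by rewrite big_nil Rintegral_cst// mul0r; split=> //; exact: integrable0.
rewrite big_cons; under eq_fun do rewrite big_cons.
under eq_Rintegral do rewrite big_cons.
case: (boolP (P i)) => Pi; last by split.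
split; last first.
  rewrite -ih2 RintegralD//; last exact: icF.
  by rewrite RintegralZl//; exact: iF.
by under eq_fun do rewrite EFinD; apply: integrableD => //; exact: icF.
Qed.

End Rintegral_sums.

Section commutator_ball.
Context {R : realType} {n m : nat}.
Local Notation Rn := 'rV[R]_n.
Local Notation mu := (@lebesgueRn R n).
Local Notation mum := (tuple_measure mu m).
Hypotheses (n_gt0 : (0 < n)%N) (m_gt0 : (0 < m)%N).
Variables (K : m.+1.-tuple Rn -> R) (T : ('I_m -> Rn -> R) -> (Rn -> R) -> R)
  (Te : ('I_m -> Rn -> R) -> Rn -> R).
Hypotheses (CZ_T : CZ_integral K T) (T_Te : bounded_extension T Te).
Let CZ_K : CZ_kernel K. Proof. by case: CZ_T. Qed.
Local Notation Kz := (off_diag_ext K).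
Variables (x0 : Rn) (ps qs lam : 'I_m -> R).
Hypotheses (ps_gt1 : forall i, 1 < ps i) (qs_gt1 : forall i, 1 < qs i)
  (pqs : \sum_i ((qs i)^-1 + (ps i)^-1) < 1) (lam_gt0 : forall i, 0 < lam i).
Local Notation B := (eball x0).
Let s i := ((qs i)^-1 + (ps i)^-1)^-1.

Let psV_gt0 i : 0 < (ps i)^-1. Proof. by rewrite invr_gt0 (lt_trans ltr01). Qed.
Let qsV_gt0 i : 0 < (qs i)^-1. Proof. by rewrite invr_gt0 (lt_trans ltr01). Qed.

Lemma pair_lt1 i : (qs i)^-1 + (ps i)^-1 < 1.
Proof.
apply: le_lt_trans pqs; rewrite (bigD1 i)//= lerDl sumr_ge0// => j _.
by rewrite addr_ge0 ?(ltW (psV_gt0 _)) ?(ltW (qsV_gt0 _)).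
Qed.

Let s_gt1 i : 1 < s i.
Proof. by rewrite /s invf_gt1 ?addr_gt0// pair_lt1. Qed.

Let s_sum : \sum_i (s i)^-1 <= 1.
Proof. by rewrite (eq_bigr (fun i => (qs i)^-1 + (ps i)^-1)) ?(ltW pqs)// => i _; rewrite /s invrK. Qed.

Let s_gt0 i : 0 < s i := lt_trans ltr01 (s_gt1 i).

Variables (b f : 'I_m -> Rn -> R) (N : 'I_m -> R).
Hypotheses (hb : forall i, locally_Lp x0 (qs i) (b i))
  (hf : forall i, locally_Lp x0 (ps i) (f i)) (N_ge0 : forall i, 0 <= N i)
  (bN : forall i, (campanato_norm (qs i) (lam i) x0 (b i) <= (N i)%:E)%E).
Let mb i : measurable_fun setT (b i) := (hb i).1.
Let mf i : measurable_fun setT (f i) := (hf i).1.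

Lemma mul_patch (g h : Rn -> R) (A : set Rn) : g \* (h \_ A) = (g \* h) \_ A.
Proof.
by apply/funext => x; rewrite /= !patchE; case: ifP => // _; rewrite mulr0.
Qed.

Lemma patch_patch (h : Rn -> R) (A A' : set Rn) : A `<=` A' -> (h \_ A') \_ A = h \_ A.
Proof.
move=> AA'; apply/funext => x; rewrite !patchE; case: ifP => // xA.
by rewrite mem_set//; apply: AA'; exact: set_mem.
Qed.

Lemma comm_arg_patch (g h : 'I_m -> Rn -> R) sigma i (A : set Rn) :
  comm_arg g h sigma i \_ A = comm_arg g (fun i => h i \_ A) sigma i.
Proof. by rewrite /comm_arg; case: ifP => // _; rewrite mul_patch. Qed.

Local Notation fB r := (fun i => f i \_ (B r)).

Lemma fB_supported r i : supported_Lp (s i) (B r) (f i \_ (B r)).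
Proof.
apply: locally_Lp_supported => //.
by apply: locally_Lp_lower => //; exact: pair_lt1.
Qed.

Lemma bfB_supported (g : 'I_m -> Rn -> R) r i : (forall i, locally_Lp x0 (qs i) (g i)) ->
  supported_Lp (s i) (B r) (g i \* (f i \_ (B r))).
Proof.
move=> hg; rewrite mul_patch; apply: locally_Lp_supported => //.
by apply: locally_Lp_mul => //; exact: pair_lt1.
Qed.

Lemma comm_arg_supported (g : 'I_m -> Rn -> R) sigma r i : (forall i, locally_Lp x0 (qs i) (g i)) ->
  supported_Lp (s i) (B r) (comm_arg g (fB r) sigma i).
Proof.
move=> hg; rewrite /comm_arg; case: ifP => _; first exact: bfB_supported.
exact: fB_supported.
Qed.

Lemma split_at0 r : split_at x0 r finset.set0 f = fB (2 * r).
Proof. by apply/funext => i; rewrite /split_at finset.in_set0. Qed.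

Definition off_ball_factor (r : R) (x : Rn) (y : m.-tuple Rn) : R :=
  \prod_i (b i x - b i (tnth y i)) * prod_diff f x0 r y.

(* The sum over alpha of the integrals of [is_commutator], gathered in one. *)
Definition commutator_ball (r : R) (x : Rn) : R :=
  commutator_cpt Te b (fB (2 * r)) x +
  \int[mum]_y (Kz [tuple of x :: y] * off_ball_factor r x y).

Lemma prod_patch_eq0 (g : 'I_m -> Rn -> R) (A : set Rn) (y : m.-tuple Rn) i :
  ~ A (tnth y i) -> \prod_i (g i \_ A) (tnth y i) = 0.
Proof. by move=> Ay; rewrite (bigD1 i)//= patch_eq0// mul0r. Qed.

(** As soon as one [y_i] leaves the double ball the restricted product vanishes and the full one
    remains. One dichotomy thus replaces the distinction of all nonempty [alpha]. *)
Lemma prod_diffP r (y : m.-tuple Rn) :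
  prod_diff f x0 r y = 0 \/
  prod_diff f x0 r y = \prod_i f i (tnth y i) /\ exists i, 2 * r <= enorm (tnth y i - x0).
Proof.
rewrite /prod_diff.
have [[i hi]|h] := pselect (exists i, 2 * r <= enorm (tnth y i - x0)).
  right; split; last by exists i.
  by rewrite (@prod_patch_eq0 f _ y i) ?subr0//; apply/negP; rewrite -leNgt.
left; apply/eqP; rewrite subr_eq0; apply/eqP; apply: eq_bigr => i _.
rewrite patchE mem_set// /eball /= ltNge; apply/negP => hi.
by apply: h; exists i.
Qed.

Lemma off_ball_factor_bound r x (y : m.-tuple Rn) :
  `|off_ball_factor r x y| <= \prod_i `|(b i x - b i (tnth y i)) * f i (tnth y i)|.
Proof.
rewrite /off_ball_factor; case: (prod_diffP r y) => [->|[-> _]].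
  by rewrite mulr0 normr0 prodr_ge0.
by rewrite -big_split/= normr_prod.
Qed.

Lemma off_ball_factor_far r x (y : m.-tuple Rn) : off_ball_factor r x y != 0 ->
  exists i, 2 * r <= enorm (tnth y i - x0).
Proof.
rewrite /off_ball_factor; case: (prod_diffP r y) => [->|[] //].
by rewrite mulr0 eqxx.
Qed.

Lemma measurable_off_ball_factor_joint r :
  measurable_fun setT (fun z : Rn * m.-tuple Rn => off_ball_factor r z.1 z.2).
Proof.
apply: measurable_funM.
  apply: measurable_prod => i _; apply: measurable_funB.
    by apply: (measurableT_comp (mb i)); exact: measurable_fst.
  apply: (measurableT_comp (mb i)); apply: (measurableT_comp (measurable_tnth i)).
  exact: measurable_snd.
apply: (measurableT_comp (f := prod_diff f x0 r)); last exact: measurable_snd.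
apply: measurable_funB; first exact: measurable_prod_tnth_fin.
apply: (measurable_prod_tnth_fin (h := fun i => f i \_ (B (2 * r)))) => i.
exact: measurable_patch_set (measurable_eball _ _) (mf i).
Qed.

Lemma measurable_off_ball_factor r x : measurable_fun setT (off_ball_factor r x).
Proof.
apply: (measurableT_comp (measurable_off_ball_factor_joint r) (g := fun y => (x, y))).
exact: measurable_pair1.
Qed.

Lemma measurable_commutator_cpt (g : 'I_m -> Rn -> R) r : (forall i, locally_Lp x0 (qs i) (g i)) ->
  measurable_fun setT (commutator_cpt Te g (fB r)).
Proof.
move=> hg; apply: measurable_sum => sigma; apply: measurable_funM.
  apply: measurable_funM; first exact: measurable_cst.
  under eq_fun do rewrite big_mkcond; apply: measurable_prod => i _.
  by case: (i \notin sigma); [exact: (hg i).1|exact: measurable_cst].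
by have [] := supported_extension m_gt0 T_Te s_gt1 (comm_arg_supported sigma r ^~ hg).
Qed.

Lemma measurable_commutator_ball r : measurable_fun setT (commutator_ball r).
Proof.
apply: measurable_funD; first exact: measurable_commutator_cpt.
apply: (measurable_Rintegral_param mum (G := fun z => Kz [tuple of z.1 :: z.2] * off_ball_factor r z.1 z.2)).
by apply: measurable_funM; [exact: measurable_kernel_joint|exact: measurable_off_ball_factor_joint].
Qed.

Let e := n%:R * (\sum_i lam i) - n%:R * (\sum_i (ps i)^-1).

Definition tail_sum (r : R) (J : nat) : R := \sum_(j < J) (j.+3%:R ^+ m *
  (2 ^+ j.+2 * r) `^ e * \prod_i local_norm x0 (ps i) (f i) (2 ^+ j.+2 * r)).

Variable S : R -> R.
Hypothesis f_tail : forall r, 0 < r -> forall J, tail_sum r J <= S r.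

Variable CK : R.
Hypothesis CK_gt0 : 0 < CK.
Hypothesis CK_bound : forall (x : Rn) (y : m.-tuple Rn) i (dl : R),
  0 < dl -> dl <= enorm (x - tnth y i) -> `|Kz [tuple of x :: y]| <= CK / dl ^+ (m * n).

Definition kernel_const : R := CK * 4 ^+ (m * n) * \prod_i tail_const n (ps i) (qs i) (lam i).

Lemma kernel_integral_le r x (G : m.-tuple Rn -> R) : 0 < r -> B r x ->
  (forall y, `|G y| <= \prod_i `|(b i x - b i (tnth y i)) * f i (tnth y i)|) ->
  (forall y, G y != 0 -> exists i, 2 * r <= enorm (tnth y i - x0)) ->
  (\int[mum]_y `|Kz [tuple of x :: y] * G y|%:E <=
   (kernel_const * S r * \prod_i oscillation x0 (b i) (lam i) (N i) r x)%:E)%E.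
Proof.
move=> r0 Bx Gle Gfar; rewrite /kernel_const.
apply: (tail_bound CK_gt0 CK_bound n_gt0 ps_gt1 qs_gt1 pair_lt1 lam_gt0 (f := f)
  (F := fun i j => local_norm x0 (ps i) (f i) (2 ^+ j.+2 * r))) => //.
- by move=> i j; exact: local_norm_ge0.
- by move=> i j; apply: Lp_le_local_norm => //; exact: (hf i).2.
- exact: f_tail.
Qed.

Lemma kernel_integrable r x (G : m.-tuple Rn -> R) : 0 < r -> B r x -> measurable_fun setT G ->
  (forall y, `|G y| <= \prod_i `|(b i x - b i (tnth y i)) * f i (tnth y i)|) ->
  (forall y, G y != 0 -> exists i, 2 * r <= enorm (tnth y i - x0)) ->
  mum.-integrable setT (EFin \o (fun y : m.-tuple Rn => Kz [tuple of x :: y] * G y)).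
Proof.
move=> r0 Bx mG Gle Gfar; apply/integrableP; split.
  apply/measurable_EFinP; apply: measurable_funM => //.
  exact: measurable_kernel_section.
apply: le_lt_trans (ltry _); exact: kernel_integral_le Gle Gfar.
Qed.

Lemma off_ball_integrable r x : 0 < r -> B r x ->
  mum.-integrable setT (EFin \o (fun y : m.-tuple Rn => Kz [tuple of x :: y] * off_ball_factor r x y)).
Proof.
move=> r0 Bx; apply: (kernel_integrable r0 Bx (measurable_off_ball_factor r x)).
- exact: off_ball_factor_bound.
- exact: off_ball_factor_far.
Qed.

(** By [extension_diff], for each [sigma] the two local parts differ by a kernel integral. Summed
    over [sigma], the integrands recombine through [prod_sub_expand] into the difference of the two
    off-ball integrands. *)
Lemma commutator_ball_consistent r r' : 0 < r -> r <= r' ->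
  {ae mu, forall x, B r x -> commutator_ball r' x = commutator_ball r x}.
Proof.
move=> r0 rr'.
have r2 : B (2 * r) `<=` B (2 * r') by apply: le_eball; rewrite ler_pM2l.
pose h sigma := comm_arg b (fB (2 * r')) sigma.
have hS sigma i : supported_Lp (s i) (B (2 * r')) (h sigma i) by exact: comm_arg_supported.
have hE sigma : (fun i => h sigma i \_ (B (2 * r))) = comm_arg b (fB (2 * r)) sigma.
  by apply/funext => i; rewrite comm_arg_patch; congr (comm_arg b _ sigma i); apply/funext => j; rewrite patch_patch.
have key : {ae mu, forall x, forall sigma : {set 'I_m}, B r x ->
    mum.-integrable setT (fun y => (Kz [tuple of x :: y] * prod_diff (h sigma) x0 r y)%:E) /\
    Te (h sigma) x - Te (comm_arg b (fB (2 * r)) sigma) x =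
    \int[mum]_y (Kz [tuple of x :: y] * prod_diff (h sigma) x0 r y)}.
  apply: filter_forall => sigma; rewrite -hE.
  exact: (extension_diff n_gt0 m_gt0 CZ_T T_Te s_gt1 s_sum r0 (hS sigma)).
apply: filterS key => x key Bx.
have Bx' : B r' x by exact: le_eball Bx.
pose c (sigma : {set 'I_m}) := (-1) ^+ #|sigma| * \prod_(i | i \notin sigma) b i x.
have cptE : commutator_cpt Te b (fB (2 * r')) x - commutator_cpt Te b (fB (2 * r)) x =
    \int[mum]_y (\sum_(sigma : {set 'I_m}) c sigma * (Kz [tuple of x :: y] * prod_diff (h sigma) x0 r y)).
  have [|_ ->] := @Rintegral_lin_comb _ _ _ mum {set 'I_m} xpredT c (fun sigma y => Kz [tuple of x :: y] * prod_diff (h sigma) x0 r y).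
    by move=> sigma _; have [] := key sigma Bx.
  rewrite -sumrB; apply: eq_bigr => sigma _; have [_ <-] := key sigma Bx.
  by rewrite mulrBr.
have sumE (y : m.-tuple Rn) : \sum_(sigma : {set 'I_m}) c sigma * (Kz [tuple of x :: y] * prod_diff (h sigma) x0 r y) =
    Kz [tuple of x :: y] * off_ball_factor r x y - Kz [tuple of x :: y] * off_ball_factor r' x y.
  have expand t : \sum_(sigma : {set 'I_m}) c sigma * \prod_i comm_arg b (fB t) sigma i (tnth y i) =
      \prod_i (b i x - b i (tnth y i)) * \prod_i (f i \_ (B t)) (tnth y i).
    rewrite -big_split/= -prod_sub_expand; apply: eq_bigr => sigma _; congr (_ * _).
    by apply: eq_bigr => i _; rewrite /comm_arg; case: ifP.
  transitivity (Kz [tuple of x :: y] * (\sum_(sigma : {set 'I_m}) c sigma * \prod_i h sigma i (tnth y i) -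
      \sum_(sigma : {set 'I_m}) c sigma * \prod_i comm_arg b (fB (2 * r)) sigma i (tnth y i))).
    rewrite -sumrB mulr_sumr; apply: eq_bigr => sigma _; rewrite /prod_diff.
    by rewrite -(hE sigma); ring.
  by rewrite !expand /off_ball_factor /prod_diff; ring.
move: cptE; under eq_Rintegral do rewrite sumE.
rewrite RintegralB//; [|exact: off_ball_integrable|exact: off_ball_integrable (lt_le_trans r0 rr') Bx'].
by rewrite /commutator_ball => h'; lra.
Qed.

Lemma sum_split_at r (y : m.-tuple Rn) :
  \sum_(alpha : {set 'I_m} | alpha != finset.set0)
    \prod_i split_at x0 r alpha f i (tnth y i) = prod_diff f x0 r y.
Proof.
have : \prod_i f i (tnth y i) =
    \sum_(alpha : {set 'I_m}) \prod_i split_at x0 r alpha f i (tnth y i).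
  transitivity (\prod_i ((f i \_ (~` B (2 * r))) (tnth y i) + (f i \_ (B (2 * r))) (tnth y i))).
    apply: eq_bigr => i _; rewrite !patchE in_setC.
    by case: (_ \in _); rewrite ?add0r ?addr0.
  rewrite bigA_distr; apply: eq_bigr => alpha _; apply: eq_bigr => i _.
  by rewrite /split_at; case: ifP.
rewrite (bigD1 finset.set0)//= split_at0 /prod_diff => ->.
by rewrite addrAC subrr add0r.
Qed.

Lemma split_at_far r (alpha : {set 'I_m}) (y : m.-tuple Rn) i : i \in alpha ->
  split_at x0 r alpha f i (tnth y i) != 0 -> 2 * r <= enorm (tnth y i - x0).
Proof.
rewrite /split_at => ->; rewrite patchE; case: ifP => [|_]; last by rewrite eqxx.
by move=> /set_mem /= /negP; rewrite -leNgt.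
Qed.

(** Where the product does not vanish, some [y_i] is outside the double ball while [x] is in the
    ball, so the tuple is off the diagonal and [K] agrees with its extension. *)
Lemma commutator_integrandE r alpha x (y : m.-tuple Rn) : 0 < r -> B r x -> alpha != finset.set0 ->
  commutator_integrand K b (split_at x0 r alpha f) x y =
  Kz [tuple of x :: y] * (\prod_i (b i x - b i (tnth y i)) *
    \prod_i split_at x0 r alpha f i (tnth y i)).
Proof.
move=> r0 Bx /finset.set0Pn[i0 i0a]; rewrite /commutator_integrand big_split/=.
have [s0|s0] := eqVneq (split_at x0 r alpha f i0 (tnth y i0)) 0.
  have P0 : \prod_i split_at x0 r alpha f i (tnth y i) = 0 by rewrite (bigD1 i0)//= s0 mul0r.
  by rewrite P0 !mulr0.
have far := split_at_far i0a s0.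
rewrite off_diag_extE//; exists ord0, (lift ord0 i0); rewrite tnth0 tnthS.
apply: contraTneq far => <-; rewrite -ltNge; have : enorm (x - x0) < r by exact: Bx.
by move: r0; move: (enorm _) => u; lra.
Qed.

Lemma split_at_norm_le r alpha i z : `|split_at x0 r alpha f i z| <= `|f i z|.
Proof. by rewrite /split_at; case: ifP => _; exact: norm_patch_le. Qed.

Lemma split_at_integrable r alpha x : 0 < r -> B r x -> alpha != finset.set0 ->
  mum.-integrable setT (EFin \o commutator_integrand K b (split_at x0 r alpha f) x).
Proof.
move=> r0 Bx a0.
rewrite (_ : EFin \o _ = EFin \o (fun y : m.-tuple Rn => Kz [tuple of x :: y] *
   (\prod_i (b i x - b i (tnth y i)) * \prod_i split_at x0 r alpha f i (tnth y i)))); last first.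
  by apply/funext => y /=; rewrite commutator_integrandE.
apply: (kernel_integrable r0 Bx) => [|y|y].
- apply: measurable_funM.
    apply: measurable_prod => i _; apply: measurable_funB; first exact: measurable_cst.
    by apply: (measurableT_comp (mb i)); exact: measurable_tnth.
  apply: measurable_prod_tnth_fin => i; rewrite /split_at; case: ifP => _.
    exact: measurable_patch_set (measurableC (measurable_eball _ _)) (mf i).
  exact: measurable_patch_set (measurable_eball _ _) (mf i).
- rewrite -big_split/= normr_prod; apply: ler_prod => i _.
  by rewrite normr_ge0 !normrM ler_wpM2l// split_at_norm_le.
- move: a0 => /finset.set0Pn[i0 i0a] h; exists i0; apply: split_at_far i0a _.
  by apply: contraNneq h => h; rewrite [X in _ * X](bigD1 i0)//= h mul0r mulr0.
Qed.

Lemma commutator_ballE r x : 0 < r -> B r x ->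
  commutator_ball r x = commutator_cpt Te b (split_at x0 r finset.set0 f) x +
    \sum_(alpha : {set 'I_m} | alpha != finset.set0)
      \int[mum]_y commutator_integrand K b (split_at x0 r alpha f) x y.
Proof.
move=> r0 Bx; rewrite /commutator_ball split_at0; congr (_ + _).
have [|_] := @Rintegral_lin_comb _ _ _ mum {set 'I_m} (fun alpha => alpha != finset.set0) (fun=> 1)
  (fun alpha => commutator_integrand K b (split_at x0 r alpha f) x).
  by move=> alpha a0; exact: split_at_integrable.
under [X in _ = X -> _]eq_bigr do rewrite mul1r.
move=> <-; apply: eq_Rintegral => y _.
rewrite /off_ball_factor -sum_split_at !mulr_sumr; apply: eq_bigr => alpha a0.
by rewrite mul1r commutator_integrandE.
Qed.

(** [truncn] plus 1 exceeds its argument strictly, so the open ball of that radius contains [x].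
    Using integer radii only gives a countable gluing, which keeps the function measurable. *)
Definition commutator_glued (x : Rn) : R :=
  commutator_ball (Num.truncn (enorm (x - x0))).+1%:R x.

Lemma measurable_commutator_glued : measurable_fun setT commutator_glued.
Proof.
move=> _ Y mY; rewrite setTI.
pose k x := Num.truncn (enorm (x - x0)).
have mk j : measurable (k @^-1` [set j]).
  rewrite (_ : _ @^-1` _ = B j.+1%:R `\` B j%:R).
    by apply: measurableD; exact: measurable_eball.
  apply/seteqP; split=> x /=.
    move=> <-; split; first exact: truncnS_gt.
    by apply/negP; rewrite -leNgt truncn_le enorm_ge0.
  move=> [h1 /negP]; rewrite -leNgt => h2.
  by apply/eqP; rewrite /k truncn_eq ?enorm_ge0// h2 h1.
rewrite (_ : _ @^-1` _ = \bigcup_j (k @^-1` [set j] `&` commutator_ball j.+1%:R @^-1` Y)).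
  apply: bigcup_measurable => j _; apply: measurableI => //.
  by rewrite -[X in measurable X]setTI; exact: measurable_commutator_ball.
apply/seteqP; split=> x /=; first by exists (k x).
by move=> [j _ [/= <-]].
Qed.

(** Each integer radius is compared with [r] on the smaller of the two balls, and countably many
    comparisons leave one null set. *)
Lemma commutator_gluedE r : 0 < r ->
  {ae mu, forall x, B r x -> commutator_glued x = commutator_ball r x}.
Proof.
move=> r0.
have h : {ae mu, forall x, forall k : nat, B (Num.min r k.+1%:R) x ->
    commutator_ball k.+1%:R x = commutator_ball r x}.
  apply: ae_foralln => k.
  have [rk|kr] := leP r k.+1%:R; first exact: commutator_ball_consistent.
  have := @commutator_ball_consistent k.+1%:R r (ltr0Sn _ _) (ltW kr).
  by apply: filterS => x + Bx => ->.
apply: filterS h => x h Bx; apply: h; rewrite /eball /= lt_min truncnS_gt andbT.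
exact: Bx.
Qed.

Lemma is_commutator_glued : is_commutator K Te x0 b f commutator_glued.
Proof.
split; first exact: measurable_commutator_glued.
move=> r r0; apply: filterS (commutator_gluedE r0) => x h Bx; split.
  by move=> alpha a0; exact: split_at_integrable.
by rewrite h// commutator_ballE.
Qed.

End commutator_ball.

(** * Bounds for the commutator *)

Section oscillation_bound.
Context {R : realType} {n : nat}.
Local Notation Rn := 'rV[R]_n.
Local Notation mu := (@lebesgueRn R n).
Hypothesis n_gt0 : (0 < n)%N.
Variable x0 : Rn.
Local Notation B := (eball x0).

Lemma Lp_le_patch th (g : Rn -> R) (E : set Rn) (a : R) : 0 < th ->
  Lp_le mu th E g a -> Lp_le mu th setT (g \_ E) a.
Proof. by move=> th0; rewrite /Lp_le integral_power_patch// invr_gt0. Qed.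

Lemma measurable_oscillation (b : Rn -> R) lam N r : measurable_fun setT b ->
  measurable_fun setT (oscillation x0 b lam N r).
Proof.
move=> mb; apply: measurable_funD; last exact: measurable_cst.
apply: measurable_funM; last exact: measurable_cst.
by apply: measurableT_comp => //; apply: measurable_funB => //; exact: measurable_cst.
Qed.

(** The weight [r^(- n lam)] in [oscillation] cancels the growth [r^(n lam)] of the Campanato bound,
    so that both terms scale like the volume to the power [1/q]. *)
Lemma Lp_oscillation (b : Rn -> R) (q lam N r : R) : measurable_fun setT b -> 1 < q ->
  0 < lam -> 0 <= N -> (campanato_norm q lam x0 b <= N%:E)%E -> 0 < r ->
  Lp_le mu q^-1 (B r) (oscillation x0 b lam N r)
    ((campanato_const n q lam + 2 `^ (n%:R * q^-1)) * N * r `^ (n%:R * q^-1)).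
Proof.
move=> mb q1 lam0 N0 bN r0.
have q0 : 0 < q^-1 by rewrite invr_gt0 (lt_trans ltr01).
have q01 : 0 < q^-1 <= 1 by rewrite q0 invf_le1 ?(ltW q1)// (lt_trans ltr01).
have mE : measurable (B r) by exact: measurable_eball.
have := campanato_dyadic n_gt0 mb q1 lam0 N0 bN 0 r0; rewrite expr0 mul1r mulr1.
set c := campanato_const _ _ _; have c0 : 0 < c by exact: campanato_const_gt0.
set me := ball_mean b x0 r; set w := r `^ (- (n%:R * lam)) => H.
have w0 : 0 <= w by exact: powR_ge0.
have mbm : measurable_fun (B r) (fun x => b x - me).
  by apply: measurable_funB; [exact: measurable_funTS|exact: measurable_cst].
have a0 : 0 <= c * N * r `^ (n%:R * (q^-1 + lam)) by rewrite !mulr_ge0 ?powR_ge0 ?(ltW c0).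
have H1 := Lp_leZ w q0 mE mbm a0 H.
have v0 : 0 <= vol x0 r by rewrite ltW// vol_gt0.
have m1 : measurable_fun (B r) (fun=> 1 : R) by exact: measurable_cst.
have H2 := Lp_leZ N q0 mE m1 (powR_ge0 _ _) (Lp_le_cst1 mE q0 v0 (mu_eball_le x0 r0)).
have H1' : Lp_le mu q^-1 (B r) (fun x => `|b x - me| * w) (`|w| * (c * N * r `^ (n%:R * (q^-1 + lam)))).
  apply: (Lp_le_sub _ q0 _ _ H1) => [//||x _]; first by rewrite mulr_ge0/=.
  by rewrite !normrM normr_id mulrC.
have m2 : measurable_fun (B r) (fun x => `|b x - me| * w).
  by apply: measurable_funM; [exact: measurableT_comp|exact: measurable_cst].
have m3 : measurable_fun (B r) (fun=> N * 1 : R) by exact: measurable_cst.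
have a1 : 0 <= `|w| * (c * N * r `^ (n%:R * (q^-1 + lam))) by rewrite mulr_ge0.
have a2 : 0 <= `|N| * vol x0 r `^ q^-1 by rewrite mulr_ge0 ?powR_ge0.
apply: (Lp_le_sub _ q0 _ _ (Lp_leD q01 mE m2 m3 a1 a2 H1' H2)) => // [|x _].
  rewrite addr_ge0// andTb (ger0_norm w0) (ger0_norm N0) [leRHS](_ : _ = c * N * r `^ (n%:R * q^-1) + 2 `^ (n%:R * q^-1) * N * r `^ (n%:R * q^-1)); last by ring.
  apply: lerD.
    rewrite le_eqVlt; apply/orP; left; apply/eqP.
    rewrite (_ : w * _ = c * N * (r `^ (n%:R * (q^-1 + lam)) * w)); last by ring.
    congr (_ * _); by rewrite /w -powRD ?(gt_eqF r0) ?implybT//; congr (_ `^ _); ring.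
  rewrite [2 `^ _ * _]mulrC -mulrA; apply: ler_wpM2l => //.
  exact: vol_powR_le (ltW q0).
by rewrite /oscillation mulr1.
Qed.

End oscillation_bound.

Section commutator_bound.
Context {R : realType} {n m : nat}.
Local Notation Rn := 'rV[R]_n.
Local Notation mu := (@lebesgueRn R n).
Local Notation mum := (tuple_measure mu m).
Hypotheses (n_gt0 : (0 < n)%N) (m_gt0 : (0 < m)%N).
Variables (K : m.+1.-tuple Rn -> R) (T : ('I_m -> Rn -> R) -> (Rn -> R) -> R)
  (Te : ('I_m -> Rn -> R) -> Rn -> R).
Hypotheses (CZ_T : CZ_integral K T) (T_Te : bounded_extension T Te).
Local Notation Kz := (off_diag_ext K).
Variables (x0 : Rn) (ps qs lam : 'I_m -> R).
Hypotheses (ps_gt1 : forall i, 1 < ps i) (qs_gt1 : forall i, 1 < qs i)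
  (pqs : \sum_i ((qs i)^-1 + (ps i)^-1) < 1) (lam_gt0 : forall i, 0 < lam i).
Local Notation B := (eball x0).

(* The exponent of b_i f_i for i in sigma, of f_i for the other i. *)
Definition mixed_exponent (sigma : {set 'I_m}) i : R :=
  if i \in sigma then ((qs i)^-1 + (ps i)^-1)^-1 else ps i.

(** The exponents depend on [sigma], hence one constant for each; they are fixed before [b] and [f],
    as the final constant must be. *)
Definition extension_const (Cl : {set 'I_m} -> R) : Prop := forall sigma, 0 < Cl sigma /\
  forall (g : 'I_m -> Rn -> R) (a : 'I_m -> R), (forall i, measurable_fun setT (g i)) ->
    (forall i, 0 <= a i) ->
    (forall i, Lp_le mu (mixed_exponent sigma i)^-1 setT (g i) (a i)) ->
    measurable_fun setT (Te g) /\
    Lp_le mu (\sum_i (mixed_exponent sigma i)^-1) setT (Te g) (Cl sigma * \prod_i a i).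

Let psV_gt0 i : 0 < (ps i)^-1. Proof. by rewrite invr_gt0 (lt_trans ltr01). Qed.
Let qsV_gt0 i : 0 < (qs i)^-1. Proof. by rewrite invr_gt0 (lt_trans ltr01). Qed.

Lemma sum_pos (a : 'I_m -> R) : (forall i, 0 < a i) -> 0 < \sum_i a i.
Proof.
move=> a0; rewrite (bigD1 (Ordinal m_gt0))//= ltr_wpDr// sumr_ge0// => i _.
exact: ltW.
Qed.

Lemma mixed_exponent_gt1 sigma i : 1 < mixed_exponent sigma i.
Proof.
rewrite /mixed_exponent; case: ifP => _ //.
by rewrite invf_gt1 ?addr_gt0// (pair_lt1 ps_gt1 qs_gt1 pqs).
Qed.

Lemma extension_const_exists : exists Cl, extension_const Cl.
Proof.
have h sigma : exists C, 0 < C /\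
  forall (g : 'I_m -> Rn -> R) (a : 'I_m -> R), (forall i, measurable_fun setT (g i)) ->
    (forall i, 0 <= a i) ->
    (forall i, Lp_le mu (mixed_exponent sigma i)^-1 setT (g i) (a i)) ->
    measurable_fun setT (Te g) /\
    Lp_le mu (\sum_i (mixed_exponent sigma i)^-1) setT (Te g) (C * \prod_i a i).
  by have [C C0 hC] := extension_bound T_Te m_gt0 (mixed_exponent_gt1 sigma); exists C.
by have /choice[Cl hCl] := h; exists Cl.
Qed.

Let th := \sum_i (ps i)^-1 + \sum_i (qs i)^-1.
Let e := n%:R * (\sum_i lam i) - n%:R * (\sum_i (ps i)^-1).

(** The first summand bounds the local part: the 2 is the factor [k.+1] of [campanato_dyadic] at
    [k = 1], the power of 2 comes from the radius [2r], and [4^e] from rewriting [r^e] by [(4r)^e].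
    The second bounds the off-ball part, with the norms of the oscillations and a volume factor. *)
Definition bound_const (Cl : {set 'I_m} -> R) (CK : R) : R :=
  (\sum_sigma Cl sigma) * \prod_i (campanato_const n (qs i) (lam i) * 2) *
    (2 `^ (n%:R * th + e) / 4 `^ e) +
  kernel_const (n := n) ps qs lam CK * \prod_i (campanato_const n (qs i) (lam i) + 2 `^ (n%:R * (qs i)^-1)) *
    2 `^ (n%:R * \sum_i (ps i)^-1).

Let thE : th = \sum_i ((qs i)^-1 + (ps i)^-1).
Proof. by rewrite /th addrC -big_split. Qed.

Let th_gt0 : 0 < th. Proof. by rewrite addr_gt0 ?sum_pos. Qed.
Let th_lt1 : th < 1. Proof. by rewrite thE. Qed.

Lemma bound_const_gt0 Cl CK : 0 < CK -> extension_const Cl -> 0 < bound_const Cl CK.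
Proof.
move=> CK0 hCl; have c0 i : 0 < campanato_const n (qs i) (lam i) by exact: campanato_const_gt0.
apply: addr_gt0; last first.
  rewrite !mulr_gt0 ?powR_gt0 ?exprn_gt0// prodr_gt0// => i _; last by rewrite addr_gt0 ?powR_gt0.
  exact: tail_const_gt0.
rewrite !mulr_gt0 ?invr_gt0 ?powR_gt0//; last by rewrite prodr_gt0// => i _; rewrite mulr_gt0.
rewrite (bigD1 finset.set0)//= ltr_wpDr ?(hCl _).1// sumr_ge0// => sigma _.
exact/ltW/(hCl sigma).1.
Qed.

Variables (b f : 'I_m -> Rn -> R) (N : 'I_m -> R).
Hypotheses (hb : forall i, locally_Lp x0 (qs i) (b i))
  (hf : forall i, locally_Lp x0 (ps i) (f i)) (N_ge0 : forall i, 0 <= N i)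
  (bN : forall i, (campanato_norm (qs i) (lam i) x0 (b i) <= (N i)%:E)%E).
Let mb i : measurable_fun setT (b i) := (hb i).1.
Let mf i : measurable_fun setT (f i) := (hf i).1.
Local Notation fB r := (fun i => f i \_ (B r)).

Variable S : R -> R.
Hypothesis f_tail : forall r, 0 < r -> forall J, tail_sum x0 ps lam f r J <= S r.

Let S_ge0 r : 0 < r -> 0 <= S r.
Proof. by move=> r0; have := f_tail r0 0; rewrite /tail_sum big_ord0. Qed.

Variable CK : R.
Hypothesis CK_gt0 : 0 < CK.
Hypothesis CK_bound : forall (x : Rn) (y : m.-tuple Rn) i (dl : R),
  0 < dl -> dl <= enorm (x - tnth y i) -> `|Kz [tuple of x :: y]| <= CK / dl ^+ (m * n).

Let kc := kernel_const (n := n) ps qs lam CK.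
Let kc_gt0 : 0 < kc.
Proof.
by rewrite !mulr_gt0 ?exprn_gt0// prodr_gt0// => i _; exact: tail_const_gt0.
Qed.

Let osc_const_ge0 i : 0 <= campanato_const n (qs i) (lam i) + 2 `^ (n%:R * (qs i)^-1).
Proof. by apply: addr_ge0; [exact/ltW/campanato_const_gt0|exact: powR_ge0]. Qed.

(** Pointwise the integral is at most a constant times the product of the oscillations. Hoelder's
    inequality gives the exponent with inverse the sum of the [1/q_i]; the missing sum of the
    [1/p_i] is made up by the volume. *)
Lemma off_ball_part_bound r : 0 < r ->
  Lp_le mu th (B r) (fun x => \int[mum]_y (Kz [tuple of x :: y] * off_ball_factor x0 b f r x y))
    (kc * S r * (\prod_i ((campanato_const n (qs i) (lam i) + 2 `^ (n%:R * (qs i)^-1)) *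
       N i * r `^ (n%:R * (qs i)^-1)) * vol x0 r `^ (\sum_i (ps i)^-1))).
Proof.
move=> r0; have mE : measurable (B r) by exact: measurable_eball.
set a := fun i => (campanato_const n (qs i) (lam i) + 2 `^ (n%:R * (qs i)^-1)) *
       N i * r `^ (n%:R * (qs i)^-1).
have a0 i : 0 <= a i.
  by apply: mulr_ge0; [apply: mulr_ge0; [exact: osc_const_ge0|exact: N_ge0]|exact: powR_ge0].
have mW i : measurable_fun (B r) (oscillation x0 (b i) (lam i) (N i) r).
  by apply: measurable_funTS; exact: measurable_oscillation.
have mWp : measurable_fun (B r) (fun x => \prod_i oscillation x0 (b i) (lam i) (N i) r x).
  by apply: measurable_prod => i _; exact: mW.
have H1 : Lp_le mu (\sum_i (qs i)^-1) (B r) (fun x => \prod_i oscillation x0 (b i) (lam i) (N i) r x) (\prod_i a i).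
  apply: Lp_le_prod0 => // [|i]; first exact: sum_pos.
  exact: Lp_oscillation.
have v0 : 0 <= vol x0 r by rewrite ltW// vol_gt0.
have pa0 : 0 <= \prod_i a i by exact: prodr_ge0.
have H2 := Lp_le_lower0 (sum_pos qsV_gt0) (sum_pos psV_gt0) mE mWp pa0 v0 (mu_eball_le x0 r0) H1.
rewrite addrC -/th in H2.
have H3 := Lp_leZ (kc * S r) th_gt0 mE mWp (mulr_ge0 pa0 (powR_ge0 _ _)) H2.
have kS0 : 0 <= kc * S r by rewrite mulr_ge0 ?(ltW kc_gt0) ?S_ge0.
rewrite (ger0_norm kS0) in H3.
apply: (Lp_le_sub _ th_gt0 _ _ H3) => // [|x Bx].
  by rewrite mulr_ge0//= mulr_ge0 ?powR_ge0.
have W0 : 0 <= \prod_i oscillation x0 (b i) (lam i) (N i) r x.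
  by apply: prodr_ge0 => i _; exact: oscillation_ge0.
have int := off_ball_integrable n_gt0 CZ_T ps_gt1 qs_gt1 pqs lam_gt0 hb hf N_ge0 bN f_tail CK_gt0 CK_bound r0 Bx.
apply: (le_trans (le_normr_Rintegral measurableT int)).
have le1 := kernel_integral_le n_gt0 ps_gt1 qs_gt1 pqs lam_gt0 hb hf N_ge0 bN f_tail CK_gt0 CK_bound r0 Bx
  (off_ball_factor_bound x0 b f r x) (@off_ball_factor_far _ _ _ x0 b f r x).
have i0 : (0 <= \int[mum]_y `|Kz [tuple of x :: y] * off_ball_factor x0 b f r x y|%:E)%E.
  by apply: integral_ge0 => y _; rewrite lee_fin.
apply: le_trans (ler_norm _); rewrite -lee_fin; apply: (le_trans _ le1).
by rewrite /Rintegral fineK// ge0_fin_numE//; exact: le_lt_trans le1 (ltry _).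
Qed.

Variable Cl : {set 'I_m} -> R.
Hypothesis Cl_const : extension_const Cl.

Let A r i : R := campanato_const n (qs i) (lam i) * N i * 2 * (2 * r) `^ (n%:R * ((qs i)^-1 + lam i)).
(** The radius is [4r], though only the ball of radius [2r] enters the local part, to match the term
    [j = 0] of [tail_sum]. *)
Let F r i : R := local_norm x0 (ps i) (f i) (2 ^+ 2 * r).

Let A_ge0 r i : 0 <= A r i.
Proof. by rewrite !mulr_ge0 ?powR_ge0// ltW// campanato_const_gt0. Qed.

Let F_ge0 r i : 0 <= F r i.
Proof. exact: local_norm_ge0. Qed.

(** With the [b_i] centred at their means, each [1/q_i] is spent once, outside [Te] for [i] not in
    [sigma] and inside for the others. So every term has the same total [th] and the same product of
    bounds. *)
Lemma commutator_cpt_bound r : 0 < r ->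
  Lp_le mu th (B r) (commutator_cpt Te b (fB (2 * r)))
    (\sum_sigma Cl sigma * \prod_i (A r i * F r i)).
Proof.
move=> r0; have mE t : measurable (B t) by exact: measurable_eball.
pose be i x := b i x - ball_mean (b i) x0 r.
have hbe i : locally_Lp x0 (qs i) (be i) by exact: locally_Lp_subC.
have mbe i : measurable_fun setT (be i) := (hbe i).1.
have r2 : B r `<=` B (2 * r) by apply: le_eball; move: r0; lra.
have be2 i : Lp_le mu (qs i)^-1 (B (2 * r)) (be i) (A r i).
  by have := campanato_dyadic n_gt0 (mb i) (qs_gt1 i) (lam_gt0 i) (N_ge0 i) (bN i) 1 r0; rewrite expr1.
have AA i : 0 <= A r i <= A r i by rewrite A_ge0/=.
have be1 i : Lp_le mu (qs i)^-1 (B r) (be i) (A r i) by apply: (Lp_le_sub r2 _ (AA i) _ (be2 i)).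
have FF i : 0 <= F r i <= F r i by rewrite F_ge0/=.
have f2 i : Lp_le mu (ps i)^-1 (B (2 * r)) (f i) (F r i).
  apply: (Lp_le_sub _ (psV_gt0 i) (FF i) _ (Lp_le_local_norm (ps_gt1 i) ((hf i).2 (2 ^+ 2 * r)))) => //.
  by apply: le_eball; rewrite ler_pM2r// expr2; lra.
have s_gt0 i : 0 < ((qs i)^-1 + (ps i)^-1)^-1 by rewrite invr_gt0 addr_gt0.
have s_gt1 i : 1 < ((qs i)^-1 + (ps i)^-1)^-1 by rewrite invf_gt1 ?addr_gt0// (pair_lt1 ps_gt1 qs_gt1 pqs).
have shift : {ae mu, forall x, commutator_cpt Te be (fB (2 * r)) x = commutator_cpt Te b (fB (2 * r)) x}.
  apply: (commutator_cpt_shift T_Te s_gt1) => i.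
  - exact: supported_Lp_in_Lp (s_gt0 i) (fB_supported ps_gt1 qs_gt1 pqs hf (2 * r) i).
  - exact: supported_Lp_in_Lp (s_gt0 i) (bfB_supported ps_gt1 qs_gt1 pqs hf (2 * r) i hb).
  - exact: supported_Lp_in_Lp (s_gt0 i) (bfB_supported ps_gt1 qs_gt1 pqs hf (2 * r) i hbe).
have mc (g : 'I_m -> Rn -> R) : (forall i, locally_Lp x0 (qs i) (g i)) ->
    measurable_fun (B r) (commutator_cpt Te g (fB (2 * r))).
  by move=> hg; apply: measurable_funTS; exact: (measurable_commutator_cpt m_gt0 T_Te ps_gt1 qs_gt1 pqs hf).
apply: (@Lp_le_ae _ _ _ _ _ _ _ (commutator_cpt Te be (fB (2 * r)))) => //; [exact: mc|exact: mc| |].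
  by apply: filterS shift => x ->.
have marg sigma i : measurable_fun setT (comm_arg be (fB (2 * r)) sigma i).
  by have [] := comm_arg_supported ps_gt1 qs_gt1 pqs hf sigma (2 * r) i hbe.
pose aa (sigma : {set 'I_m}) i := if i \in sigma then A r i * F r i else F r i.
have aa0 sigma i : 0 <= aa sigma i by rewrite /aa; case: ifP => _ //; rewrite mulr_ge0.
have Te_bound sigma : measurable_fun setT (Te (comm_arg be (fB (2 * r)) sigma)) /\
    Lp_le mu (\sum_i (mixed_exponent sigma i)^-1) setT (Te (comm_arg be (fB (2 * r)) sigma)) (Cl sigma * \prod_i aa sigma i).
  apply: (Cl_const sigma).2 => // i; rewrite /comm_arg /mixed_exponent /aa.
  case: ifP => _; last exact: Lp_le_patch.
  rewrite invrK mul_patch; apply: Lp_le_patch; first by rewrite addr_gt0.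
  by apply: Lp_leM0 => //; exact: measurable_funTS.
have mprod sigma : measurable_fun setT (fun x => \prod_(i | i \notin sigma) be i x).
  under eq_fun do rewrite big_mkcond; apply: measurable_prod => i _.
  by case: (i \notin sigma); [exact: mbe|exact: measurable_cst].
apply: Lp_le_sum => //.
- by rewrite th_gt0 ltW.
- move=> sigma; apply: measurable_funTS; apply: measurable_funM; last exact: (Te_bound sigma).1.
  by apply: measurable_funM; [exact: measurable_cst|exact: mprod].
- by move=> sigma; rewrite mulr_ge0 ?(ltW (Cl_const sigma).1)// prodr_ge0// => i _; rewrite mulr_ge0.
move=> sigma _; have [mTe LTe] := Te_bound sigma.
have t0 : 0 < \sum_i (mixed_exponent sigma i)^-1.
  by apply: sum_pos => i; rewrite invr_gt0 (lt_trans ltr01)// mixed_exponent_gt1.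
have a00 : 0 <= Cl sigma * \prod_i aa sigma i by rewrite mulr_ge0 ?(ltW (Cl_const sigma).1)// prodr_ge0.
have LTe' : Lp_le mu (\sum_i (mixed_exponent sigma i)^-1) (B r) (Te (comm_arg be (fB (2 * r)) sigma)) (Cl sigma * \prod_i aa sigma i).
  by apply: (Lp_le_sub _ t0 _ _ LTe) => //; rewrite a00/=.
have := @Lp_le_mul_prod _ _ _ mu _ (index_enum 'I_m) (fun i => i \notin sigma) (fun i => (qs i)^-1)
  _ _ (B r) (Te (comm_arg be (fB (2 * r)) sigma)) be (A r) t0 qsV_gt0 (mE r) (measurable_funTS mTe)
  (fun i => measurable_funTS (mbe i)) a00 (A_ge0 r) LTe' (fun i _ => be1 i).
rewrite (_ : _ + _ = th); last first.
  rewrite thE [X in _ + X]big_mkcond -big_split/=; apply: eq_bigr => i _.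
  by rewrite /mixed_exponent; case: ifP => _; rewrite /= ?invrK ?addr0// addrC.
rewrite (_ : _ * \prod_(i | _) A r i = Cl sigma * \prod_i (A r i * F r i)); last first.
  rewrite -mulrA; congr (_ * _); rewrite [X in _ * X]big_mkcond -big_split/=; apply: eq_bigr => i _.
  by rewrite /aa; case: ifP => _; rewrite /= ?mulr1// mulrC.
move=> H; apply: (Lp_le_sub _ th_gt0 _ _ H) => // [|x _].
  by rewrite lexx andbT mulr_ge0 ?(ltW (Cl_const sigma).1)// prodr_ge0// => i _; rewrite mulr_ge0.
by rewrite !normrM normrX normrN1 expr1n mul1r mulrC.
Qed.

Lemma commutator_ball_bound r : 0 < r ->
  Lp_le mu th (B r) (commutator_ball K Te x0 b f r)
    (bound_const Cl CK * \prod_i N i * r `^ (n%:R * th) * S r).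
Proof.
move=> r0; have mE : measurable (B r) by exact: measurable_eball.
have th01 : 0 < th <= 1 by rewrite th_gt0 ltW.
have P0 : 0 <= \prod_i N i by exact: prodr_ge0.
have c0 i : 0 < campanato_const n (qs i) (lam i) by exact: campanato_const_gt0.
have H1 := commutator_cpt_bound r0; have H2 := off_ball_part_bound r0.
have m1 : measurable_fun setT (commutator_cpt Te b (fB (2 * r))).
  exact: (measurable_commutator_cpt m_gt0 T_Te ps_gt1 qs_gt1 pqs hf).
have m2 : measurable_fun setT (fun x => \int[mum]_y (Kz [tuple of x :: y] * off_ball_factor x0 b f r x y)).
  have mc := measurable_commutator_ball m_gt0 CZ_T T_Te ps_gt1 qs_gt1 pqs hb hf r.
  have := measurable_funB mc m1; rewrite (_ : _ \- _ = (fun x => \int[mum]_y (Kz [tuple of x :: y] * off_ball_factor x0 b f r x y)))//.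
  by apply/funext => x /=; rewrite /commutator_ball addrAC subrr add0r.
have Cl0 : 0 <= \sum_sigma Cl sigma by apply: sumr_ge0 => sigma _; exact/ltW/(Cl_const sigma).1.
have a1 : 0 <= \sum_sigma Cl sigma * \prod_i (A r i * F r i).
  by rewrite -mulr_suml mulr_ge0// prodr_ge0// => i _; rewrite mulr_ge0.
have a2 : 0 <= kc * S r * (\prod_i ((campanato_const n (qs i) (lam i) + 2 `^ (n%:R * (qs i)^-1)) *
       N i * r `^ (n%:R * (qs i)^-1)) * vol x0 r `^ (\sum_i (ps i)^-1)).
  apply: mulr_ge0; first by rewrite mulr_ge0 ?(ltW kc_gt0) ?S_ge0.
  apply: mulr_ge0; last exact: powR_ge0.
  apply: prodr_ge0 => i _; apply: mulr_ge0; last exact: powR_ge0.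
  by apply: mulr_ge0; [exact: osc_const_ge0|exact: N_ge0].
apply: (Lp_le_sub _ th_gt0 _ _ (Lp_leD th01 mE (measurable_funTS m1) (measurable_funTS m2) a1 a2 H1 H2)) => //.
rewrite addr_ge0//= /bound_const -/kc !mulrDl; apply: lerD.
(* This is the term [j = 0] of the dyadic sum, whose factor [3^m] is at least 1. *)
- have tail1 : (4 * r) `^ e * \prod_i F r i <= S r.
    have := f_tail r0 1; rewrite /tail_sum big_ord1/= -/e => h; apply: le_trans h.
    rewrite (_ : 4 * r = 2 ^+ 2 * r); last by rewrite expr2; ring.
    have PF : 0 <= \prod_i F r i by apply: prodr_ge0 => i _; exact: F_ge0.
    rewrite -mulrA ler_peMl//; first exact: mulr_ge0 (powR_ge0 _ _) PF.
    by rewrite exprn_ege1// ler1n.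
  rewrite -mulr_suml big_split/= /A !big_split/= prod_powR ?mulr_gt0//.
  rewrite (_ : \sum_i (n%:R * ((qs i)^-1 + lam i)) = n%:R * th + e); last first.
    by rewrite -mulr_sumr big_split/= /th /e; ring.
  have r4 : r `^ e = (4 * r) `^ e / 4 `^ e.
    by rewrite powRM ?(ltW r0)// mulrAC mulfV ?mul1r// gt_eqF// powR_gt0.
  rewrite [(2 * r) `^ _]powRM ?(ltW r0)// [r `^ (_ + e)]powRD ?(gt_eqF r0) ?implybT// r4.
  set c := \prod_i campanato_const _ _ _; set t := \prod_(i < m) 2.
  set P := \prod_i N i; set s := \sum_sigma Cl sigma; set FF := \prod_i F r i.
  set u := 2 `^ _; set v := 4 `^ _; set w := r `^ _; set z := (4 * r) `^ e.
  rewrite (_ : _ * (_ * FF) = s * (c * t) * (u / v) * P * w * (z * FF)); last by ring.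
  apply: ler_wpM2l; last exact: tail1.
  rewrite !mulr_ge0 ?invr_ge0 ?powR_ge0 ?prodr_ge0//.
  by move=> i _; rewrite ltW.
- rewrite !big_split/= prod_powR// -mulr_sumr.
  have V : vol x0 r `^ (\sum_i (ps i)^-1) <= 2 `^ (n%:R * \sum_i (ps i)^-1) * r `^ (n%:R * \sum_i (ps i)^-1).
    by apply: vol_powR_le => //; exact/ltW/sum_pos.
  rewrite (_ : n%:R * th = n%:R * \sum_i (qs i)^-1 + n%:R * \sum_i (ps i)^-1); last by rewrite /th; ring.
  rewrite [r `^ (_ + _)]powRD ?(gt_eqF r0) ?implybT//.
  set o := \prod_i (_ + _); set P := \prod_i N i; set u := r `^ _; set v := r `^ _.
  set w := 2 `^ _ in V *; set z := vol _ _ `^ _ in V *.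
  rewrite [leRHS](_ : _ = kc * S r * (o * P * u * (w * v))); last by ring.
  apply: ler_wpM2l; first by rewrite mulr_ge0 ?(ltW kc_gt0) ?S_ge0.
  apply: ler_wpM2l V; rewrite !mulr_ge0 ?powR_ge0 ?prodr_ge0//.
Qed.

End commutator_bound.

Theorem theorem4p2 (R : realType) (m n : nat) (m_gt0 : (0 < m)%N) (n_gt0 : (0 < n)%N)
    (K : m.+1.-tuple 'rV[R]_n -> R)
    (T : ('I_m -> 'rV[R]_n -> R) -> ('rV[R]_n -> R) -> R)
    (Te : ('I_m -> 'rV[R]_n -> R) -> 'rV[R]_n -> R)
    (CZ_T : CZ_integral K T) (T_Te : bounded_extension T Te)
    (x0 : 'rV[R]_n) (p : R) (ps qs lam : 'I_m -> R)
    (p_gt1 : 1 < p) (ps_gt1 : forall i, 1 < ps i) (qs_gt1 : forall i, 1 < qs i)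
    (pE : p^-1 = \sum_(i < m) (ps i)^-1 + \sum_(i < m) (qs i)^-1)
    (lam_bounds : forall i, 0 < lam i < n%:R^-1)
    (psi : 'rV[R]_n -> R -> R) (phi : 'I_m -> 'rV[R]_n -> R -> R)
    (psi_gt0 : forall x (r : R), 0 < r -> 0 < psi x r)
    (phi_gt0 : forall i x (r : R), 0 < r -> 0 < phi i x r)
    (psi_meas : measurable_weight psi) (phi_meas : forall i, measurable_weight (phi i))
    (C : R) (C_gt0 : 0 < C)
    (weights : forall r : R, 0 < r ->
      (\int[@lebesgue_measure R]_(t in `]r, +oo[)
         (((1 + ln (t / r)) ^+ m *
           t `^ (n%:R * \sum_(i < m) lam i - n%:R * \sum_(i < m) (ps i)^-1 - 1))%R%:E *
          ess_inf_after (fun s => \prod_(i < m) (phi i x0 s * s `^ (n%:R / ps i)))%R t)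
       <= (C * psi x0 r)%:E)%E) :
  exists2 C' : R, 0 < C' & forall b f : 'I_m -> 'rV[R]_n -> R,
    (forall i, in_LC (qs i) (lam i) x0 (b i)) ->
    (forall i, in_LM (ps i) (phi i) x0 (f i)) ->
    exists F, [/\ is_commutator K Te x0 b f F,
                  in_LM p psi x0 F
                & (morrey_norm p psi x0 F <=
                   (C' * \prod_(i < m) fine (campanato_norm (qs i) (lam i) x0 (b i))
                       * \prod_(i < m) fine (morrey_norm (ps i) (phi i) x0 (f i)))%:E)%E].
Proof.
have CZ_K : CZ_kernel K by case: CZ_T.
have lam_gt0 i : 0 < lam i by have /andP[] := lam_bounds i.
have pqs : \sum_i ((qs i)^-1 + (ps i)^-1) < 1.
  by rewrite big_split/= addrC -pE invf_lt1// (lt_trans ltr01).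
have [CK CK0 hCK] := kernel_bound CZ_K.
have [Cl hCl] := extension_const_exists m_gt0 T_Te ps_gt1 qs_gt1 pqs.
set e := n%:R * \sum_(i < m) lam i - n%:R * \sum_(i < m) (ps i)^-1.
pose C1 := bound_const ps qs lam Cl CK (n := n).
(* The powers of 2 come from the volume in the Morrey norms of the [f_i], [C] from the hypothesis on
   the weights, [weight_const] from the dyadic sum. [C3] is the lower volume bound, needed when the
   norm of the commutator is divided by a power of the volume. *)
pose C2 := \prod_(i < m) (2 `^ (n%:R / ps i)) * C * weight_const m e.
pose C3 : R := (2 / n%:R) `^ (n%:R * p^-1).
have C10 : 0 < C1 by exact: bound_const_gt0.
have C20 : 0 < C2.
  by rewrite !mulr_gt0 ?weight_const_gt0// prodr_gt0// => i _; rewrite powR_gt0.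
have C30 : 0 < C3 by rewrite powR_gt0// divr_gt0// ltr0n.
have p0 : 0 < p^-1 by rewrite invr_gt0 (lt_trans ltr01).
have C1E : C1 = bound_const ps qs lam Cl CK (n := n) by [].
have C2E : C2 = \prod_(i < m) (2 `^ (n%:R / ps i)) * C * weight_const m e by [].
have C3E : C3 = (2 / n%:R) `^ (n%:R * p^-1) by [].
clearbody C1 C2 C3.
exists (C1 * C2 / C3); first by rewrite divr_gt0// mulr_gt0.
move=> b f hb hf.
have bL i : locally_Lp x0 (qs i) (b i) by apply: in_Lp_loc_locally; exact: (hb i).1.
have fL i : locally_Lp x0 (ps i) (f i) by apply: in_Lp_loc_locally; exact: (hf i).1.
pose N i := fine (campanato_norm (qs i) (lam i) x0 (b i)).
pose M i := fine (morrey_norm (ps i) (phi i) x0 (f i)).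
have camp_ge0 i : (0 <= campanato_norm (qs i) (lam i) x0 (b i))%E.
  by apply: le_trans (ereal_sup_ubound (ex_intro2 _ _ 1 ltr01 erefl)); exact: poweR_ge0.
have N0 i : 0 <= N i by exact: fine_ge0.
have bN i : (campanato_norm (qs i) (lam i) x0 (b i) <= (N i)%:E)%E.
  by rewrite fineK// ge0_fin_numE//; exact: (hb i).2.
have fM i s : 0 < s -> 0 <= M i /\ Lp_le (@lebesgueRn R n) (ps i)^-1 (eball x0 s) (f i)
    (M i * 2 `^ (n%:R / ps i) * (phi i x0 s * s `^ (n%:R / ps i))).
  by apply: (morrey_local n_gt0 (ps_gt1 i) (fL i).1); [exact: phi_gt0|exact: (hf i).2].
have M0 i : 0 <= M i by have [] := fM i 1 ltr01.
(* The dyadic sum at radius [r] is at most this multiple of [psi x0 r], which the Morrey norm of the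
   commutator divides out. *)
pose S r := \prod_(i < m) M i * C2 * psi x0 r.
have tail r : 0 < r -> forall J, tail_sum x0 ps lam f r J <= S r.
  move=> r0 J.
  have g0 s : 0 < s -> 0 <= \prod_(i < m) (phi i x0 s * s `^ (n%:R / ps i)).
    by move=> s0; apply: prodr_ge0 => i _; rewrite mulr_ge0 ?powR_ge0// ltW ?phi_gt0.
  have A0 : 0 <= \prod_(i < m) (M i * 2 `^ (n%:R / ps i)).
    by apply: prodr_ge0 => i _; rewrite mulr_ge0 ?powR_ge0.
  have F0 j : 0 <= \prod_i local_norm x0 (ps i) (f i) (2 ^+ j.+2 * r).
    by apply: prodr_ge0 => i _; exact: local_norm_ge0.
  have FA j s : 2 ^+ j.+2 * r < s -> \prod_i local_norm x0 (ps i) (f i) (2 ^+ j.+2 * r) <=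
      \prod_(i < m) (M i * 2 `^ (n%:R / ps i)) * \prod_(i < m) (phi i x0 s * s `^ (n%:R / ps i)).
    move=> js; have s0 : 0 < s by apply: lt_trans js; rewrite mulr_gt0 ?exprn_gt0.
    rewrite -big_split/=; apply: ler_prod => i _; rewrite local_norm_ge0/=.
    apply: (local_norm_le (ps_gt1 i) (ltW js)); last exact: (fM i s s0).2.
    by rewrite !mulr_ge0 ?powR_ge0// ltW ?phi_gt0.
  have := @weight_sum _ m e r _ _ _ _ r0 g0 A0 F0 FA (weights r r0) J => h.
  apply: le_trans h _; rewrite le_eqVlt; apply/orP; left; apply/eqP.
  by rewrite /S C2E big_split/=; ring.
have mglued := measurable_commutator_glued m_gt0 CZ_T T_Te ps_gt1 qs_gt1 pqs bL fL.
have glued_bound r : 0 < r -> Lp_le (@lebesgueRn R n) p^-1 (eball x0 r) (commutator_glued K Te x0 b f)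
    (C1 * \prod_(i < m) N i * r `^ (n%:R * p^-1) * S r).
  move=> r0; rewrite pE C1E.
  apply: (@Lp_le_ae _ _ _ _ _ _ _ (commutator_ball K Te x0 b f r)).
  - exact: measurable_eball.
  - exact: measurable_funTS.
  - by apply: measurable_funTS; exact: (measurable_commutator_ball m_gt0 CZ_T T_Te ps_gt1 qs_gt1 pqs).
  - exact: (commutator_gluedE n_gt0 m_gt0 CZ_T T_Te ps_gt1 qs_gt1 pqs lam_gt0 bL fL N0 bN tail CK0 hCK r0).
  - exact: (commutator_ball_bound n_gt0 m_gt0 CZ_T T_Te ps_gt1 qs_gt1 pqs lam_gt0 bL fL N0 bN tail CK0 hCK hCl r0).
have PN0 : 0 <= \prod_(i < m) N i by exact: prodr_ge0.
have PM0 : 0 <= \prod_(i < m) M i by exact: prodr_ge0.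
have S0 r : 0 < r -> 0 <= S r by move=> r0; rewrite !mulr_ge0 ?(ltW C20) ?(ltW (psi_gt0 _ _ _)).
have norm_le : (morrey_norm p psi x0 (commutator_glued K Te x0 b f) <=
    (C1 * C2 / C3 * \prod_(i < m) N i * \prod_(i < m) M i)%:E)%E.
  apply: ge_ereal_sup => _ [r /= r0 <-].
  have a0 : 0 <= C1 * \prod_(i < m) N i * r `^ (n%:R * p^-1) * S r.
    exact: mulr_ge0 (mulr_ge0 (mulr_ge0 (ltW C10) PN0) (powR_ge0 _ _)) (S0 r r0).
  have /(Lp_leP _ _ _ p0 a0) := glued_bound r r0; rewrite invrK => H.
  have v0 : 0 < vol x0 r by exact: vol_gt0.
  have c0 : 0 <= (psi x0 r)^-1 * vol x0 r `^ (- p^-1).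
    by rewrite mulr_ge0 ?powR_ge0// invr_ge0 ltW ?psi_gt0.
  apply: (le_trans (lee_wpmul2l _ H)); first by rewrite lee_fin.
  rewrite -EFinM lee_fin powRN /S.
  have V : C3 * r `^ (n%:R * p^-1) <= vol x0 r `^ p^-1 by rewrite C3E; exact: vol_powR_ge (ltW p0).
  have ps0 : psi x0 r != 0 by rewrite gt_eqF ?psi_gt0.
  set P := \prod_(i < m) N i in PN0 *; set Q := \prod_(i < m) M i in PM0 *.
  set w := r `^ _ in V *; set v := vol x0 r `^ _ in V *.
  have vv0 : 0 < v by rewrite powR_gt0.
  rewrite [leLHS](_ : _ = C1 * C2 * P * Q * (w / v)); last by field; rewrite ps0 gt_eqF.
  rewrite (_ : C1 * C2 / C3 * P * Q = C1 * C2 * P * Q * C3^-1); last by ring.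
  apply: ler_wpM2l; first exact: mulr_ge0 (mulr_ge0 (mulr_ge0 (ltW C10) (ltW C20)) PN0) PM0.
  by rewrite ler_pdivrMr// ler_pdivlMl.
exists (commutator_glued K Te x0 b f); split=> //.
  exact: (is_commutator_glued n_gt0 m_gt0 CZ_T T_Te ps_gt1 qs_gt1 pqs lam_gt0 bL fL N0 bN tail CK0 hCK).
split; last by apply: le_lt_trans norm_le _; exact: ltry.
apply: (locally_Lp_in_Lp_loc (x0 := x0)); split=> // t.
(* The bound holds for positive radii, so [t] is enlarged to [|t| + 1]. *)
apply: (@le_lt_trans _ _ (\int[@lebesgueRn R n]_(x in eball x0 (`|t| + 1)) (`|commutator_glued K Te x0 b f x| `^ p)%:E)%E).
  apply: ge0_le_integral_sup => //; try by move=> x _; rewrite lee_fin powR_ge0.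
  by apply: le_eball; rewrite (le_trans (ler_norm t))// lerDl.
apply: (@Lp_le_lty _ _ _ _ _ (C1 * \prod_(i < m) N i * (`|t| + 1) `^ (n%:R * p^-1) * S (`|t| + 1))).
by apply: glued_bound; rewrite ltr_wpDl.
Qed.
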